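(* Let $w$ be a weight vector for $H_A(\beta)$ and let $\beta_0\in\mathbb{C}$ be a homogenizing value for $A$, $\beta$ and $w$. Then the linear map \[ \rho:\mathscr{N}_w(H_A(\beta))\longrightarrow \mathscr{N}_{(0,w)}(H_{\rho(A)}(\beta_0,\beta)) \] is injective, and its image is spanned by the basic Nilsson solutions of $H_{\rho(A)}(\beta_0,\beta)$ in the direction of $(0,w)$ that are associated to standard pairs of $\mathrm{in}_{(0,w)}(I_{\rho(A)})$ that pass through zero.
   Context: Hypergeometric systems. $\mathbb{N}=\{0,1,2,\dots\}$. $A=[a_{ij}]\in\mathbb{Z}^{d\times n}$ is a matrix whose columns $a_1,\dots,a_n$ generate $\mathbb{Z}^d$ as a group, and $\beta\in\mathbb{C}^d$. $D$ is the complex Weyl algebra in $x_1,\dots,x_n,\partial_1,\dots,\partial_n$; $I_A=\langle \partial^u-\partial^v\mid u,v\in\mathbb{N}^n,\ Au=Av\rangle\subseteq\mathbb{C}[\partial_1,\dots,\partial_n]$ is the toric ideal; $E_i=\sum_{j}a_{ij}x_j\partial_j$; $H_A(\beta)=D\cdot I_A+\langle E_1-\beta_1,\dots,E_d-\beta_d\rangle$ is a left $D$-ideal. $\ker_{\mathbb{Z}}(A)=\{u\in\mathbb{Z}^n: Au=0\}$, and $|u|$ is the sum of the coordinates of a vector $u$. Weight vectors. For $w\in\mathbb{R}^n$, the $(-w,w)$-weight of $x^u\partial^v$ is $-w\cdot u+w\cdot v$; the initial form $\mathrm{in}_{(-w,w)}(f)$ of a nonzero $f\in D$ is the sum of its terms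 of maximal weight; $\mathrm{in}_{(-w,w)}(J)$ is the left ideal generated by the initial forms of nonzero elements of a left ideal $J$. Similarly $\mathrm{in}_w(J)$ for an ideal $J\subseteq\mathbb{C}[\partial]$, where $\partial^v$ has weight $w\cdot v$. A vector $w\in\mathbb{R}^n_{>0}$ is a weight vector for $H_A(\beta)$ if there is a strongly convex open rational polyhedral cone $\mathscr{C}\subset\mathbb{R}^n_{>0}$ containing $w$ such that for all $w'\in\mathscr{C}$: $\mathrm{in}_w(I_A)=\mathrm{in}_{w'}(I_A)$ and $\mathrm{in}_{(-w,w)}(H_A(\beta))=\mathrm{in}_{(-w',w')}(H_A(\beta))$. Then $\mathrm{in}_w(I_A)$ is a monomial ideal. When $(1,\dots,1)$ lies in the rational row span of the matrix, the positivity requirements ($w\in\mathbb{R}^n_{>0}$, $\mathscr{C}\subset\mathbb{R}^n_{>0}$) are dropped. $\mathscr{C}^*=\{u\in\mathbb{R}^n: u\cdot w'\ge 0\ \forall w'\in\mathscr{C}\}$. Nilsson series. With $\log(x)=(\log x_1,\dots,\log x_n)$, a basic Nilsson solution of $H_A(\beta)$ in the direction of $w$ is a formal solution of $H_A(\beta)$ of the form $\phi=\sum_{u\in C}x^{v+u}p_u(\log(x))$, with $v\in\mathbb{C}^n$, such that: (1) $C\subseteq\mathscr{C}^*\cap\ker_{\mathbb{Z}}(A)$ for some strongly convex open rational polyhedral cone $\mathscr{C}\ni w$ (contained in $\mathbb{R}^n_{>0}$ unless $(1,\dots,1)$ lies in the rational row span of the matrix) such that $\mathrm{in}_w(I_A)=\mathrm{in}_{w'}(I_A)$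 and $\mathrm{in}_{(-w,w)}(H_A(\beta))=\mathrm{in}_{(-w',w')}(H_A(\beta))$ for all $w'\in\mathscr{C}$; (2) the $p_u$ are polynomials and their degrees are bounded by a common integer $K$; (3) $p_0\neq0$. $\mathscr{N}_w(H_A(\beta))$ is the $\mathbb{C}$-span of the basic Nilsson solutions in the direction of $w$. The initial series of such a $\phi$ is $\mathrm{in}_w(\phi)=x^vp_0(\log(x))$. The polynomials $p_u$ of a basic Nilsson solution automatically lie in the symmetric algebra of $\ker_{\mathbb{Z}}(A)$, i.e. they are polynomials in the linear forms $t\mapsto\gamma\cdot t$, $\gamma\in\ker_{\mathbb{Z}}(A)$. Standard pairs and (fake) exponents. A standard pair of a monomial ideal $I\subseteq\mathbb{C}[\partial_1,\dots,\partial_n]$ is a pair $(\partial^\alpha,\sigma)$ with $\alpha\in\mathbb{N}^n$, $\sigma\subseteq\{1,\dots,n\}$, such that $\alpha+\mathbb{C}^\sigma$ is an irreducible component of the Zariski closure of $\{u\in\mathbb{N}^n:\partial^u\notin I\}$ in $\mathbb{C}^n$ and $\alpha$ is the coordinatewise minimal element of $(\alpha+\mathbb{C}^\sigma)\cap\mathbb{N}^n$, where $\mathbb{C}^\sigma=\{t: t_i=0\text{ for }i\notin\sigma\}$. A fake exponent of $H_A(\beta)$ with respect to $w$ is a vector $v\in\mathbb{C}^n$ such that $x^v$ is a solution of $\mathrm{in}_w(I_A)+\langle E-\beta\rangle$; equivalently $Av=\beta$ and there is a standard pair $(\partial^\alpha,\sigma)$ of $\mathrm{in}_w(I_A)$ with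 $v_i=\alpha_i$ for all $i\notin\sigma$ (the fake exponent corresponding to that standard pair, which is unique if it exists). A basic Nilsson solution $\sum_{u\in C}x^{v+u}p_u(\log(x))$ is associated to a standard pair if $v$ is the fake exponent corresponding to that pair. Homogenization. $\rho(A)\in\mathbb{Z}^{(d+1)\times(n+1)}$ is obtained from $A$ by attaching a column of zeros on the left and then a top row of ones; its columns, and the corresponding variables $x_0,\dots,x_n$, are indexed by $0,1,\dots,n$. All notions above apply to $\rho(A)$, $(\beta_0,\beta)$, $(0,w)$. A standard pair $(\partial^\alpha,\sigma)$ of $\mathrm{in}_{(0,w)}(I_{\rho(A)})$ passes through zero if $0\in\sigma$. $\beta_0\in\mathbb{C}$ is a homogenizing value for $A,\beta,w$ if $\beta_0\notin\mathbb{Z}$ and $\beta_0-|v|\notin\mathbb{Z}$ for every fake exponent $v$ of $H_A(\beta)$ with respect to $w$. Standing assumption: $(0,w)$ is a weight vector for $H_{\rho(A)}(\beta_0,\beta)$. For $p$ in the symmetric algebra of $\ker_{\mathbb{Z}}(A)$ write $p(t_1,\dots,t_n)=\sum_\alpha c_\alpha\prod_{j=1}^{n-d}(\gamma_j\cdot(t_1,\dots,t_n))^{\alpha_j}$ with $\{\gamma_j\}$ a $\mathbb{Z}$-basis of $\ker_{\mathbb{Z}}(A)$, and set $\widehat p(t_0,\dots,t_n)=\sum_\alpha c_\alpha\prod_{j}(-|\gamma_j|t_0+\gamma_j\cdot(t_1,\dots,t_n))^{\alpha_j}$. For $s_0\notin\mathbb{Z}$, $s\in\mathbb{C}^n$ and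 a polynomial $\hat p$, $\partial_0^{-1}[x_0^{s_0}x^s\hat p(\log x_0,\dots,\log x_n)]$ denotes the unique expression $x_0^{s_0+1}x^s\hat q(\log x_0,\dots,\log x_n)$, $\hat q$ a polynomial, whose $\partial_0$-derivative is $x_0^{s_0}x^s\hat p(\log x_0,\dots,\log x_n)$; iterate to define $\partial_0^{-k}$ for $k>0$. For a basic Nilsson solution $\phi=\sum_{u\in C}x^{v+u}p_u(\log(x))$ put \[\rho(\phi)=\sum_{u\in C}\partial_0^{|u|}\bigl[x_0^{\beta_0-|v|}x^{v+u}\widehat{p_u}(\log x_0,\log x_1,\dots,\log x_n)\bigr].\] The linear map $\rho$ on $\mathscr{N}_w(H_A(\beta))$ is obtained by choosing a basis of $\mathscr{N}_w(H_A(\beta))$ consisting of basic Nilsson solutions in the direction of $w$ whose initial series are linearly independent, applying the formula above to the basis elements, and extending linearly. It takes values in $\mathscr{N}_{(0,w)}(H_{\rho(A)}(\beta_0,\beta))$. *)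

(* Defs.v *)
From HB Require Import structures.
From mathcomp Require Import all_boot all_order all_algebra.
From mathcomp Require Import boolp classical_sets functions fsbigop reals.
From mathcomp Require Import complex mpoly.

Set Implicit Arguments.
Unset Strict Implicit.
Unset Printing Implicit Defensive.

Import Order.TTheory GRing.Theory Num.Theory.
Local Open Scope classical_set_scope.
Local Open Scope ring_scope.

(* The complex numbers are R[i] for R : realType.  Vectors are columns. *)

Section Vectors.

Definition vsum (V : nmodType) n (u : 'cV[V]_n) : V := \sum_i u i 0.

Definition dot (T : pzRingType) n (u v : 'cV[T]_n) : T := \sum_i u i 0 * v i 0.

Definition nvec n (u : 'X_{1..n}) : 'cV[int]_n := \col_i (u i)%:Z.

End Vectors.

Section Spans.
Variables (K : pzRingType) (V : lmodType K).

Definition lspan (S : set V) : set V :=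
  [set f | exists k (c : 'I_k -> K) (g : 'I_k -> V),
     (forall i, S (g i)) /\ f = \sum_i c i *: g i].

Definition lin_indep (I : Type) (g : I -> V) : Prop :=
  forall k (j : 'I_k -> I) (c : 'I_k -> K),
    injective j -> \sum_i c i *: g (j i) = 0 -> forall i, c i = 0.

Definition is_basis (I : Type) (g : I -> V) (N : set V) : Prop :=
  lin_indep g /\ lspan (range g) = N.

End Spans.

Section Ideals.
Variables (T : zmodType) (mul : T -> T -> T).

Definition left_ideal (J : set T) : Prop :=
  [/\ J 0, forall f g, J f -> J g -> J (f + g) & forall p f, J f -> J (mul p f)].

Definition left_ideal_gen (S : set T) : set T := smallest left_ideal S.

End Ideals.

(* The polynomial sum_(a, b) c_(a, b) x^a xi^b in 2n variables, with x_i the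
   variable lshift n i and xi_i the variable rshift n i, stands for the
   operator sum_(a, b) c_(a, b) x^a d^b of the Weyl algebra D: every element of
   D has exactly one such normally ordered expression. *)
Notation weyl K n := {mpoly K[n + n]}.

Section Weyl.
Variables (K : comNzRingType) (n : nat).

Definition wx (i : 'I_n) : weyl K n := 'X_(lshift n i).
Definition wd (i : 'I_n) : weyl K n := 'X_(rshift n i).

(* The action of D on a module on which x_i acts as X i and d_i as Y i. *)
Definition weyl_act (V : lmodType K) (X Y : 'I_n -> V -> V) (P : weyl K n)
    (f : V) : V :=
  \sum_(m <- msupp P) P@_m *:
    (\big[comp/idfun]_(i < n) iter (m (lshift n i)) (X i))
      ((\big[comp/idfun]_(i < n) iter (m (rshift n i)) (Y i)) f).

(* Left multiplication by x_i and by d_i on normally ordered expressions; the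
   latter is d_i c(x) = c(x) d_i + (dc/dx_i)(x). *)
Definition wx_mul (i : 'I_n) (P : weyl K n) : weyl K n := wx i * P.
Definition wd_mul (i : 'I_n) (P : weyl K n) : weyl K n :=
  wd i * P + mderiv (lshift n i) P.

Definition weyl_mul (P Q : weyl K n) : weyl K n := weyl_act wx_mul wd_mul P Q.

Definition wd_poly (f : {mpoly K[n]}) : weyl K n := f \mPo [tuple wd i | i < n].

End Weyl.

Section InitialForms.
Variables (K : comNzRingType) (R : realType).

Definition init_form N (wt : 'X_{1..N} -> R) (f : {mpoly K[N]}) : {mpoly K[N]} :=
  \sum_(m <- msupp f | all (fun m' => wt m' <= wt m) (msupp f)) f@_m *: 'X_[m].

Definition init_ideal N (mul : {mpoly K[N]} -> {mpoly K[N]} -> {mpoly K[N]})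
    (wt : 'X_{1..N} -> R) (J : set {mpoly K[N]}) : set {mpoly K[N]} :=
  left_ideal_gen mul [set init_form wt f | f in J `&` [set f | f != 0]].

Definition wt_poly n (w : 'cV[R]_n) (m : 'X_{1..n}) : R :=
  \sum_i w i 0 * (m i)%:R.

Definition wt_weyl n (w : 'cV[R]_n) (m : 'X_{1..n + n}) : R :=
  \sum_i (- (w i 0 * (m (lshift n i))%:R) + w i 0 * (m (rshift n i))%:R).

(* in_w(J) for an ideal J of C[d], and in_(-w,w)(J) for a left ideal J of D. *)
Definition in_poly n (w : 'cV[R]_n) (J : set {mpoly K[n]}) :=
  init_ideal *%R (wt_poly w) J.

Definition in_weyl n (w : 'cV[R]_n) (J : set (weyl K n)) :=
  init_ideal (@weyl_mul K n) (wt_weyl w) J.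

End InitialForms.

Section Hypergeometric.
Variables (R : realType) (d n : nat).
Local Notation C := R[i].
Implicit Types (A : 'M[int]_(d, n)) (beta : 'cV[C]_d) (w : 'cV[R]_n).

Definition columns_generate A : Prop :=
  forall y : 'cV[int]_d, exists z : 'cV[int]_n, A *m z = y.

Definition kerZ A : set 'cV[int]_n := [set u | A *m u = 0].

Definition toric_ideal A : set {mpoly C[n]} :=
  left_ideal_gen *%R
    [set f | exists u v : 'X_{1..n},
       A *m nvec u = A *m nvec v /\ f = 'X_[u] - 'X_[v]].

Definition euler_op A (i : 'I_d) : weyl C n :=
  \sum_j (A i j)%:~R *: (wx C j * wd C j).

(* The left D-ideal D.J + < E_1 - beta_1, ..., E_d - beta_d >. *)
Definition ideal_with_euler (J : set {mpoly C[n]}) A beta : set (weyl C n) :=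
  left_ideal_gen (@weyl_mul C n)
    ([set wd_poly f | f in J] `|`
     range (fun i : 'I_d => euler_op A i - (beta i 0)%:MP)).

Definition hyp_ideal A beta : set (weyl C n) :=
  ideal_with_euler (toric_ideal A) A beta.

(* For nonempty {y | B y > 0}, the closure is {y | B y >= 0}; strong convexity
   says that this closure contains no line. *)
Definition strongly_convex_open_rational_cone (Cn : set 'cV[R]_n) : Prop :=
  exists m (B : 'M[rat]_(m, n)),
    let By (y : 'cV[R]_n) := map_mx ratr B *m y in
    [/\ Cn = [set y | forall i, 0 < By y i 0]
      & forall y, (forall i, 0 <= By y i 0) -> (forall i, 0 <= By (- y) i 0) ->
          y = 0].

Definition ones_in_row_span A : Prop :=
  ((const_mx 1 : 'rV[rat]_n) <= map_mx intr A)%MS.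

Definition weight_cone A beta w (Cn : set 'cV[R]_n) : Prop :=
  [/\ strongly_convex_open_rational_cone Cn,
      Cn w,
      ones_in_row_span A \/ (forall y, Cn y -> forall i, 0 < y i 0)
    & forall w', Cn w' ->
        in_poly w (toric_ideal A) = in_poly w' (toric_ideal A) /\
        in_weyl w (hyp_ideal A beta) = in_weyl w' (hyp_ideal A beta)].

Definition weight_vector A beta w : Prop := exists Cn, weight_cone A beta w Cn.

Definition dual_cone (Cn : set 'cV[R]_n) : set 'cV[R]_n :=
  [set u | forall w', Cn w' -> 0 <= dot u w'].

End Hypergeometric.

(* A function f stands for the formal series sum_e x^e f_e(log x). *)
Notation logseries R n := ('cV[R[i]]_n -> {mpoly R[i][n]}).

Section Series.
Variables (R : realType) (n : nat).
Local Notation C := R[i].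
Implicit Types (f phi : logseries R n) (v e : 'cV[C]_n).

Definition ser_term e (p : {mpoly C[n]}) : logseries R n :=
  fun e' => if e' == e then p else 0.

Definition ser_x (i : 'I_n) f : logseries R n := fun e => f (e - delta_mx i 0).

(* d_i (x^e p(log x)) = x^(e - e_i) (e_i p + dp/dt_i)(log x) *)
Definition ser_d (i : 'I_n) f : logseries R n := fun e =>
  let e' := e + delta_mx i 0 in e' i 0 *: f e' + mderiv i (f e').

Definition solution (J : set (weyl C n)) f : Prop :=
  forall P, J P -> weyl_act ser_x ser_d P f = 0.

Definition shift v (u : 'cV[int]_n) : 'cV[C]_n := v + map_mx intr u.

Definition init_series v phi : logseries R n := ser_term v (phi v).

End Series.

Section Nilsson.
Variables (R : realType) (d n : nat).
Local Notation C := R[i].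
Implicit Types (A : 'M[int]_(d, n)) (beta : 'cV[C]_d) (w : 'cV[R]_n).
Implicit Types (v : 'cV[C]_n) (phi : logseries R n).

(* phi is a basic Nilsson solution sum_(u in S) x^(v+u) p_u(log x), with
   p_u = phi (shift v u). *)
Definition basic_nilsson A beta w v phi : Prop :=
  [/\ solution (hyp_ideal A beta) phi,
      exists (Cn : set 'cV[R]_n) (S : set 'cV[int]_n),
        [/\ weight_cone A beta w Cn,
            forall u, S u -> dual_cone Cn (map_mx intr u) /\ kerZ A u
          & [set e | phi e != 0] `<=` [set shift v u | u in S]],
      exists K : nat, forall e, (msize (phi e) <= K)%N
    & phi v != 0].

Definition nilsson_space A beta w : set (logseries R n) :=
  lspan [set phi | exists v, basic_nilsson A beta w v phi].

Definition fake_exponent A beta w v : Prop :=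
  solution (ideal_with_euler (in_poly w (toric_ideal A)) A beta)
    (ser_term v 1).

End Nilsson.

Section StandardPairs.
Variables (R : realType) (n : nat).
Local Notation C := R[i].

Definition zariski_closed (Y : set 'cV[C]_n) : Prop :=
  exists F : set {mpoly C[n]},
    Y = [set y | forall f, F f -> f.@[fun i => y i 0] = 0].

Definition zariski_closure (S : set 'cV[C]_n) : set 'cV[C]_n :=
  smallest zariski_closed S.

Definition zariski_irreducible (Y : set 'cV[C]_n) : Prop :=
  Y !=set0 /\
  forall Z1 Z2, zariski_closed Z1 -> zariski_closed Z2 ->
    Y `<=` Z1 `|` Z2 -> Y `<=` Z1 \/ Y `<=` Z2.

Definition irreducible_component (Y Z : set 'cV[C]_n) : Prop :=
  [/\ zariski_irreducible Y, Y `<=` Z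
    & forall Y', zariski_irreducible Y' -> Y `<=` Y' -> Y' `<=` Z -> Y' = Y].

Definition cnvec (u : 'X_{1..n}) : 'cV[C]_n := \col_i (u i)%:R.

(* alpha + C^sigma *)
Definition coord_affine (alpha : 'X_{1..n}) (sigma : {set 'I_n}) : set 'cV[C]_n :=
  [set y | forall i, i \notin sigma -> y i 0 = (alpha i)%:R].

Definition standard_pair (J : set {mpoly C[n]}) (alpha : 'X_{1..n})
    (sigma : {set 'I_n}) : Prop :=
  irreducible_component (coord_affine alpha sigma)
    (zariski_closure [set cnvec u | u in [set u | ~ J 'X_[u]]]) /\
  forall u : 'X_{1..n}, coord_affine alpha sigma (cnvec u) -> (alpha <= u)%MM.

(* v is the fake exponent corresponding to the standard pair (alpha, sigma). *)
Definition exponent_of_pair d (A : 'M[int]_(d, n)) (beta : 'cV[C]_d)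
    (alpha : 'X_{1..n}) (sigma : {set 'I_n}) (v : 'cV[C]_n) : Prop :=
  map_mx intr A *m v = beta /\ coord_affine alpha sigma v.

End StandardPairs.

Section Homogenization.
Variables (R : realType) (d n : nat).
Local Notation C := R[i].
Implicit Types (A : 'M[int]_(d, n)) (beta : 'cV[C]_d) (w : 'cV[R]_n).
Implicit Types (v : 'cV[C]_n) (phi : logseries R n).

Definition rho_mx A : 'M[int]_(1 + d, 1 + n) :=
  block_mx (const_mx 1) (const_mx 1) 0 A.

Definition rho_par (beta0 : C) beta : 'cV[C]_(1 + d) := col_mx (const_mx beta0) beta.

Definition rho_wt w : 'cV[R]_(1 + n) := col_mx 0 w.

Definition idx0 : 'I_(1 + n) := lshift n ord0.

Definition homogenizing_value A beta w (beta0 : C) : Prop :=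
  (forall z : int, beta0 != z%:~R) /\
  (forall v, fake_exponent A beta w v ->
     forall z : int, beta0 - vsum v != z%:~R).

Definition ker_zbasis A (gamma : 'M[int]_(n, n - d)) : Prop :=
  A *m gamma = 0 /\
  forall u, kerZ A u -> exists! z : 'cV[int]_(n - d), u = gamma *m z.

Definition lin_form (gamma : 'M[int]_(n, n - d)) (j : 'I_(n - d)) : {mpoly C[n]} :=
  \sum_i (gamma i j)%:~R *: 'X_i.

Definition lin_form_hat (gamma : 'M[int]_(n, n - d)) (j : 'I_(n - d)) :
    {mpoly C[1 + n]} :=
  - (vsum (col j gamma))%:~R *: 'X_idx0
  + \sum_i (gamma i j)%:~R *: 'X_(rshift 1 i).

Definition is_hat A (p : {mpoly C[n]}) (ph : {mpoly C[1 + n]}) : Prop :=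
  exists (gamma : 'M[int]_(n, n - d)) (q : {mpoly C[n - d]}),
    [/\ ker_zbasis A gamma,
        p = q \mPo [tuple lin_form gamma j | j < n - d]
      & ph = q \mPo [tuple lin_form_hat gamma j | j < n - d]].

(* There is exactly one ph with is_hat A p ph when p is in the symmetric
   algebra of kerZ A, and none otherwise. *)
Definition hat A (p : {mpoly C[n]}) : {mpoly C[1 + n]} := xget 0 (is_hat A p).

(* (e, p) stands for x^e p(log x); the polynomial q is unique when the exponent
   of x_0 in e is not an integer. *)
Definition antideriv0 (t : 'cV[C]_(1 + n) * {mpoly C[1 + n]}) :
    'cV[C]_(1 + n) * {mpoly C[1 + n]} :=
  let e' := t.1 + delta_mx idx0 0 in
  (e', xget 0 [set q | ser_d idx0 (ser_term e' q) = ser_term t.1 t.2]).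

(* d_0^k (x^e p(log x)) *)
Definition d0_pow (k : int) (e : 'cV[C]_(1 + n)) (p : {mpoly C[1 + n]}) :
    logseries R (1 + n) :=
  match k with
  | Posz k => iter k (ser_d idx0) (ser_term e p)
  | Negz k => let t := iter k.+1 antideriv0 (e, p) in ser_term t.1 t.2
  end.

(* The summands have pairwise distinct exponents, so that for each e at most
   one of them is nonzero at e. *)
Definition rho_basic A (beta0 : C) v phi : logseries R (1 + n) := fun e =>
  \sum_(u \in [set u | phi (shift v u) != 0])
    d0_pow (vsum u) (col_mx (const_mx (beta0 - vsum v)) (shift v u))
      (hat A (phi (shift v u))) e.

(* Only the values of rho on nilsson_space A beta w are relevant. *)
Definition homogenization_map A beta w (beta0 : C)
    (rho : logseries R n -> logseries R (1 + n)) : Prop :=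
  let N := nilsson_space A beta w in
  (forall (a : C) f g, N f -> N g -> rho (a *: f + g) = a *: rho f + rho g) /\
  exists (I : Type) (v : I -> 'cV[C]_n) (phi : I -> logseries R n),
    [/\ forall i, basic_nilsson A beta w (v i) (phi i),
        is_basis phi N,
        lin_indep (fun i => init_series (v i) (phi i))
      & forall i, rho (phi i) = rho_basic A beta0 (v i) (phi i)].

Definition through_zero_solutions A beta w (beta0 : C) : set (logseries R (1 + n)) :=
  [set psi | exists alpha sigma (v : 'cV[C]_(1 + n)),
     [/\ standard_pair (in_poly (rho_wt w) (@toric_ideal R _ _ (rho_mx A))) alpha sigma,
         idx0 \in sigma,
         exponent_of_pair (rho_mx A) (rho_par beta0 beta) alpha sigma v
       & basic_nilsson (rho_mx A) (rho_par beta0 beta) (rho_wt w) v psi]].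

End Homogenization.

(* Main.v *)
From HB Require Import structures.
Require Import Defs.
From mathcomp Require Import all_boot all_order all_algebra.
From mathcomp Require Import boolp classical_sets functions fsbigop reals.
From mathcomp Require Import complex ssrcomplements mpoly.
Local Open Scope classical_set_scope.
Local Open Scope ring_scope.

(** The polynomials of a Nilsson solution are killed by the derivations along the rows of
    [A], so [p-hat (t_0, t) = p (t_1 - t_0, ..., t_n - t_0)].  For a base point [v] with
    [beta0 - |v|] not an integer, every power of [d_0] is invertible on
    [x_0^(beta0 - |v|) C[log x]], and sending [x^(v+u) p] to
    [d_0^|u| (x_0^(beta0 - |v|) x^(v+u) p-hat)] is a linear map [T_v] on the series supported
    on [v + Z^n].  It satisfies [d_j T_v = d_0 T_v d_j] for [j >= 1], hence
    [d_0^k d^a T_v = d_0^(k + |a|) T_v d^a].  Thus a binomial [d^a - d^b] kills [phi] iff its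
    homogenization kills [T_v phi], and [phi] solves [H_A(beta)] iff [T_v phi] solves
    [H_rho(A)(beta0, beta)].  Every solution supported on [(beta0 - |v|, v) + ker rho(A)] is
    some [T_v phi].

    Injectivity: terms of lowest weight cannot cancel, and [T_v] keeps initial series
    independent.  Image: [v] kills the initial monomials of [I_A] iff [(beta0 - |v|, v)] lies
    on a standard pair through zero, because [in_w] of the homogenized toric ideal is a
    monomial ideal.

    The map [rho] equals [T_(v_i)] on the basis element [phi_i], with a base point that
    varies with [i].  Changing the base point by [u0] replaces [phi] by [G phi], where [G] is
    a polynomial in the derivations of the logarithms.  These commute with the Weyl algebra,
    so [G phi] is again a solution; expanding it in the basis yields elements with the same
    exponent or a strictly larger one.  Two comparable exponents have different negative
    supports, so an induction on exponents terminates. *)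

Set Implicit Arguments.
Unset Strict Implicit.
Unset Printing Implicit Defensive.

Import Order.TTheory GRing.Theory Num.Theory.

(** * Linear combinations *)

Lemma lin_sumZ (K : pzRingType) (V W : lmodType K) (h : V -> W) (I : Type) (r : seq I)
  (c : I -> K) (g : I -> V) : linear h ->
  h (\sum_(i <- r) c i *: g i) = \sum_(i <- r) c i *: h (g i).
Proof.
move=> lh; pose H := GRing.isLinear.Build _ _ _ _ h lh.
pose hL : {linear V -> W} := HB.pack h H.
by rewrite -[h]/(hL : V -> W) linear_sum; apply: eq_bigr => i _; rewrite linearZ.
Qed.

Lemma lin_sum (K : pzRingType) (V W : lmodType K) (h : V -> W) (I : Type) (r : seq I)
  (g : I -> V) : linear h -> h (\sum_(i <- r) g i) = \sum_(i <- r) h (g i).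
Proof.
move=> lh; have := lin_sumZ r (fun=> 1) g lh.
under eq_bigr => i _ do rewrite scale1r.
by move=> ->; apply: eq_bigr => i _; rewrite scale1r.
Qed.

Section LinearExtension.
Variables (K : pzRingType) (V : lmodType K).

Lemma lspan_sum (S : set V) (I : Type) (s : seq I) (c : I -> K) (g : I -> V) :
  (forall i, lspan S (g i)) -> lspan S (\sum_(i <- s) c i *: g i).
Proof.
move=> gS; elim: s => [|i s IHs].
  by rewrite big_nil; exists 0%N, (fun=> 0), (fun=> 0); split=> [[]|]; rewrite ?big_ord0.
rewrite big_cons; have [k [a [f [fS ->]]]] := IHs.
have [l [b [h [hS ->]]]] := gS i.
exists (l + k)%N, (fun j : 'I_(l + k) => match fintype.split j with inl x => c i * b x | inr y => a y end),
  (fun j : 'I_(l + k) => match fintype.split j with inl x => h x | inr y => f y end); split.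
  by move=> j; case: fintype.split.
rewrite big_split_ord /= scaler_sumr; congr (_ + _); apply: eq_bigr => j _.
  by rewrite (unsplitK (inl j)) scalerA.
by rewrite (unsplitK (inr j)).
Qed.

Lemma lspan_incl (S : set V) f : S f -> lspan S f.
Proof.
by move=> Sf; exists 1%N, (fun=> 1), (fun=> f); split; rewrite ?big_ord1 ?scale1r.
Qed.

(** Coefficients of equal indices are added up and the zero ones dropped, so that every listed index
    really occurs. The leading-term arguments start from such an expansion. *)
Lemma lspan_uniq (I : choiceType) (g : I -> V) f : lspan (range g) f ->
  exists (s : seq I) (c : I -> K),
    [/\ uniq s, {in s, forall i, c i != 0} & f = \sum_(i <- s) c i *: g i].
Proof.
move=> [k [c [h [hg ->]]]].
have /choice[j jP] : forall a, exists i, g i = h a by move=> a; case: (hg a) => i _ <-; exists i.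
pose c' i := \sum_(a < k | j a == i) c a.
exists [seq i <- undup (codom (j : 'I_k -> I)) | c' i != 0], c'; split.
- by rewrite filter_uniq // undup_uniq.
- by move=> i; rewrite mem_filter => /andP[].
have -> : \sum_(i <- [seq i <- undup (codom (j : 'I_k -> I)) | c' i != 0]) c' i *: g i =
    \sum_(i <- undup (codom (j : 'I_k -> I))) c' i *: g i.
  rewrite big_filter big_mkcond; apply: eq_bigr => i _.
  by case: eqP => // ->; rewrite scale0r.
transitivity (\sum_(a < k) \sum_(i <- undup (codom (j : 'I_k -> I)) | (j a : I) == i) c a *: h a).
  apply: eq_bigr => a _; rewrite (big_mkcond (fun i => j a == i)) (bigD1_seq (j a)) ?undup_uniq ?mem_undup ?codom_f //=.
  rewrite eqxx big1 ?addr0 // => i; rewrite eq_sym => /negPf ->; by [].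
rewrite (exchange_big_dep xpredT) //=; apply: eq_bigr => i _.
by rewrite scaler_suml; apply: eq_bigr => a /eqP <-; rewrite jP.
Qed.

Lemma lin_indep_uniq (I : choiceType) (g : I -> V) (s : seq I) (c : I -> K) :
  lin_indep g -> uniq s -> \sum_(i <- s) c i *: g i = 0 -> {in s, forall i, c i = 0}.
Proof.
move=> indep s_uniq sum0 i /(nthP i)[k ks <-].
pose j (a : 'I_(size s)) := nth i s a.
have := indep _ j (c \o j) _ _ (Ordinal ks); apply.
  by move=> a b /eqP; rewrite nth_uniq // => /eqP/val_inj.
by rewrite -[RHS]sum0 [RHS](big_nth i) big_mkord.
Qed.

End LinearExtension.

Section MonomialExtension.
Variables (K : nzRingType) (n : nat) (V : lmodType K) (F : 'X_{1..n} -> V).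

(** Linear extension from monomials. The actions of operators on series, homogenization and graded
    parts all have this form. *)
Definition mlin (p : {mpoly K[n]}) : V := \sum_(m <- msupp p) p@_m *: F m.

Lemma mlinwE k p : (msize p <= k)%N ->
  mlin p = \sum_(m : 'X_{1..n < k}) p@_m *: F m.
Proof.
move=> pk; rewrite /mlin (big_mksub 'X_{1..n < k}) /=; first last.
- by move=> m /msize_mdeg_lt /leq_trans; apply.
- exact: msupp_uniq.
rewrite big_rmcond // => m /memN_msupp_eq0 ->; by rewrite scale0r.
Qed.

Lemma mlin_is_linear : linear mlin.
Proof.
move=> a p q; pose k := maxn (msize (a *: p + q)) (maxn (msize p) (msize q)).
rewrite !(@mlinwE k) ?leq_max ?leqnn ?orbT // scaler_sumr -big_split /=.
by apply: eq_bigr => m _; rewrite mcoeffD mcoeffZ scalerDl scalerA.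
Qed.

HB.instance Definition _ :=
  GRing.isLinear.Build K {mpoly K[n]} V *:%R mlin mlin_is_linear.

Lemma mlinX m : mlin 'X_[m] = F m.
Proof. by rewrite /mlin msuppX big_seq1 mcoeffX eqxx scale1r. Qed.

End MonomialExtension.

(** * The action of the Weyl algebra on formal series *)

Section IteratedOperators.
Variables (n : nat) (V : Type) (F : 'I_n -> V -> V).

Definition opm (k : 'I_n -> nat) : V -> V :=
  \big[comp/idfun]_(i < n) iter (k i) (F i).

Lemma opm_morph (W : Type) (F' : 'I_n -> W -> W) (h : V -> W) k x :
  (forall i y, h (F i y) = F' i (h y)) ->
  h (opm k x) = (\big[comp/idfun]_(i < n) iter (k i) (F' i)) (h x).
Proof.
move=> hF; rewrite /opm; elim: (index_enum _) => [|i s IHs]; first by rewrite !big_nil.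
rewrite !big_cons /= -IHs; set y := (_ x).
by elim: (k i) => //= j IHj; rewrite hF IHj.
Qed.

Lemma opm_ext k k' x : k =1 k' -> opm k x = opm k' x.
Proof.
by move=> kk'; rewrite /opm; congr (_ x); apply: eq_bigr => i _; rewrite kk'.
Qed.

Lemma opm_ind (P : V -> Prop) k x :
  (forall i y, P y -> P (F i y)) -> P x -> P (opm k x).
Proof.
move=> PF Px; rewrite /opm; elim: (index_enum _) => [|i s IHs]; first by rewrite big_nil.
by rewrite big_cons /=; elim: (k i) => //= j; apply: PF.
Qed.

Lemma opm1 i x : opm (fun j => i == j) x = F i x.
Proof.
rewrite /opm; transitivity (iter (count_mem i (index_enum 'I_n)) (F i) x).
  elim: (index_enum _) => [|j s IHs]; first by rewrite big_nil.
  by rewrite big_cons /= IHs (eq_sym j); case: eqP => [->|].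
by rewrite count_uniq_mem ?index_enum_uniq // mem_index_enum.
Qed.

Lemma opm0 x : opm (fun=> 0%N) x = x.
Proof. by rewrite /opm; elim: (index_enum _) => [|i s IHs]; rewrite ?big_nil ?big_cons. Qed.

Hypothesis F_comm : forall i j x, F i (F j x) = F j (F i x).

Lemma opmD k l x : opm (fun i => k i + l i)%N x = opm k (opm l x).
Proof.
rewrite /opm; elim: (index_enum _) => [|j s IHs]; first by rewrite !big_nil.
rewrite !big_cons /= IHs iterD; congr iter.
set y := (_ x); have comm z : F j ((\big[comp/idfun]_(i <- s) iter (k i) (F i)) z) =
    (\big[comp/idfun]_(i <- s) iter (k i) (F i)) (F j z).
  elim: s {IHs y} => [|i s IHs]; first by rewrite !big_nil.
  by rewrite !big_cons /= -IHs; elim: (k i) => //= r <-; exact: F_comm.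
by elim: (l j) => //= q ->; rewrite comm.
Qed.

End IteratedOperators.

Lemma opm_linear (K : pzRingType) (V : lmodType K) n (F : 'I_n -> V -> V) k :
  (forall i, linear (F i)) -> linear (opm F k).
Proof.
move=> lF a x y; rewrite /opm; elim: (index_enum _) => [|i s IHs]; first by rewrite !big_nil.
by rewrite !big_cons /= IHs; elim: (k i) => //= j ->; rewrite lF.
Qed.

Section MonomialExtensionTheory.
Variables (K : comNzRingType) (n : nat) (V : lmodType K).
Implicit Types (F G : 'X_{1..n} -> V) (q : {mpoly K[n]}).

Lemma eq_mlin F G q : {in msupp q, F =1 G} -> mlin F q = mlin G q.
Proof. by move=> FG; apply: eq_big_seq => m /FG ->. Qed.

Lemma mlinD F G q : mlin (fun m => F m + G m) q = mlin F q + mlin G q.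
Proof. by rewrite -big_split; apply: eq_bigr => m _; rewrite scalerDr. Qed.

Lemma mlin_morph (W : lmodType K) (h : V -> W) F q : linear h ->
  mlin (fun m => h (F m)) q = h (mlin F q).
Proof. by move=> lh; rewrite /mlin (lin_sumZ _ _ _ lh). Qed.

Lemma mlin_mulX F u q : mlin F ('X_[u] * q) = mlin (fun m => F (u + m)%MM) q.
Proof.
rewrite {1}[q]mpolyE mulr_sumr linear_sum; apply: eq_bigr => m _.
by rewrite -scalerAr linearZ /= -mpolyXD mlinX.
Qed.

Lemma mlin_deriv F i q :
  mlin F q^`M(i) = mlin (fun m => (m i)%:R *: F (m - U_(i))%MM) q.
Proof.
rewrite {1}[q]mpolyE (linear_sum (mderiv i)) /= linear_sum; apply: eq_bigr => m _.
by rewrite mderivZ mderivX linearZ /= linearZ /= mlinX.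
Qed.

End MonomialExtensionTheory.

Section SeriesActions.
Variables (R : realType) (n : nat).
Local Notation C := R[i].
Implicit Types (f g : logseries R n) (e : 'cV[C]_n) (P Q : weyl C n).

Lemma ser_x_linear (i : 'I_n) : linear (@ser_x R n i).
Proof. by move=> a f g; apply/funext. Qed.

Lemma ser_d_linear (i : 'I_n) : linear (@ser_d R n i).
Proof.
move=> a f g; apply/funext => e.
rewrite /ser_d /= -[RHS]/(a *: (_ + _) + (_ + _)) -/(ser_d i g e) /ser_d.
rewrite -[(a *: f + g) _]/(a *: f _ + g _) mderivD mderivZ !scalerDr !scalerA.
by rewrite [_ * a]mulrC addrACA.
Qed.

Lemma ser_xC (i j : 'I_n) f : ser_x i (ser_x j f) = ser_x j (ser_x i f).
Proof. by apply/funext => e; rewrite /ser_x addrAC. Qed.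

Lemma ser_dC (i j : 'I_n) f : ser_d i (ser_d j f) = ser_d j (ser_d i f).
Proof.
apply/funext => e; rewrite /ser_d /= !mderivD !mderivZ !scalerDr !scalerA mderiv_comm.
have [->//|ij] := eqVneq i j.
rewrite !mxE !eqxx (negPf ij) eq_sym (negPf ij) /= !addr0 !(addrAC e (delta_mx j 0)).
by rewrite [_ * _]mulrC addrACA.
Qed.

Lemma opm_ser_x (k : 'I_n -> nat) f e :
  opm (@ser_x R n) k f e = f (e - \col_i (k i)%:R).
Proof.
have -> : \col_i (k i)%:R = \sum_i (k i)%:R *: (delta_mx i 0 : 'cV[C]_n).
  apply/matrixP => i j; rewrite !mxE summxE (bigD1 i) //= !mxE eqxx ord1 eqxx mulr1.
  by rewrite big1 ?addr0 // => l li; rewrite !mxE eq_sym (negPf li) mulr0.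
rewrite /opm; elim: (index_enum _) e => [|i s IHs] e; first by rewrite !big_nil subr0.
rewrite !big_cons /= opprD addrA -IHs.
elim: (k i) e => [|j IHj] e /=; first by rewrite scale0r subr0.
by rewrite /ser_x -/(ser_x _ _) IHj -addrA -opprD -nat1r scalerDl scale1r.
Qed.

(** The commutation rule d_i x^m = x^m d_i + m_i x^(m - e_i). The truncated subtraction is harmless,
    since for m_i = 0 the last coefficient is zero. *)
Lemma ser_d_opm_x i (m : 'I_n -> nat) f :
  ser_d i (opm (@ser_x R n) m f) = opm (@ser_x R n) m (ser_d i f) +
    (m i)%:R *: opm (@ser_x R n) (fun j => m j - (i == j))%N f.
Proof.
apply/funext => e; rewrite -[RHS]/(_ + (m i)%:R *: _) !opm_ser_x /ser_d !opm_ser_x.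
set k := \col_j (m j)%:R; rewrite (addrAC e (- k)).
have [mi0|mi] := posnP (m i).
  by rewrite mi0 scale0r addr0 !mxE mi0 subr0.
have -> : e - \col_j (m j - (i == j))%N%:R = e + delta_mx i 0 - k.
  apply/matrixP => j l; rewrite !mxE ord1 eqxx andbT eq_sym -addrA; congr (_ + _).
  by case: eqP => [->|_] /=; rewrite ?subn0 ?sub0r // natrB // opprB ?addrA.
by rewrite [RHS]addrAC -scalerDl !mxE subrK.
Qed.

Local Notation act P f := (weyl_act (@ser_x R n) (@ser_d R n) P f).

Definition weyl_mon (f : logseries R n) (m : 'X_{1..n + n}) : logseries R n :=
  opm (@ser_x R n) (fun i => m (lshift n i))
    (opm (@ser_d R n) (fun i => m (rshift n i)) f).

Lemma weyl_mon0 f : weyl_mon f 0%MM = f.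
Proof.
rewrite /weyl_mon (@opm_ext _ _ _ _ (fun=> 0%N)); last by move=> i; rewrite mnm0E.
by rewrite opm0 (@opm_ext _ _ _ _ (fun=> 0%N)) ?opm0 // => i; rewrite mnm0E.
Qed.

Lemma weyl_actE P f : act P f = mlin (weyl_mon f) P.
Proof. by []. Qed.

Lemma weyl_act_wx i Q f : act (wx_mul i Q) f = ser_x i (act Q f).
Proof.
rewrite !weyl_actE mlin_mulX -(mlin_morph _ _ (ser_x_linear i)); apply: eq_mlin => m _.
rewrite /weyl_mon -(opm1 (@ser_x R n) i) -opmD; last exact: ser_xC.
rewrite [in X in X = _](@opm_ext _ _ (@ser_d R n) _ (fun j => m (rshift n j))).
  by apply: opm_ext => j; rewrite mnmDE mnm1E eq_lshift.
by move=> j; rewrite mnmDE mnm1E eq_lrshift.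
Qed.

Lemma weyl_act_wd i Q f : act (wd_mul i Q) f = ser_d i (act Q f).
Proof.
rewrite !weyl_actE /wd_mul linearD /= mlin_mulX mlin_deriv -mlinD.
rewrite -(mlin_morph _ _ (ser_d_linear i)); apply: eq_mlin => m _.
rewrite /weyl_mon ser_d_opm_x -(opm1 (@ser_d R n) i) -opmD; last exact: ser_dC.
congr (_ + _ *: _).
  rewrite (@opm_ext _ _ _ _ (fun j => m (lshift n j))); last first.
    by move=> j; rewrite mnmDE mnm1E eq_rlshift.
  by congr opm; apply: opm_ext => j; rewrite mnmDE mnm1E eq_rshift.
rewrite (@opm_ext _ _ _ _ (fun j => m (lshift n j) - (i == j))%N); last first.
  by move=> j; rewrite mnmBE mnm1E eq_lshift.
by congr opm; apply: opm_ext => j; rewrite mnmBE mnm1E eq_lrshift subn0.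
Qed.

(** [weyl_mul P] is itself the action of P on normally ordered expressions, so it suffices that
    evaluation at [f] intertwines [wx_mul] with [ser_x] and [wd_mul] with [ser_d]. *)
Lemma weyl_act_mul P Q f : act (weyl_mul P Q) f = act P (act Q f).
Proof.
rewrite /weyl_mul /weyl_act -/(mlin (weyl_mon f) _).
rewrite linear_sum; apply: eq_bigr => m _; rewrite linearZ; congr (_ *: _).
rewrite -/(opm (@wx_mul _ n) _) -/(opm (@wd_mul _ n) _).
rewrite -[LHS]/(act _ f) (opm_morph (h := fun Q => act Q f) (F' := @ser_x R n)); last first.
  by move=> i y; rewrite weyl_act_wx.
congr (_ _); rewrite (opm_morph (h := fun Q => act Q f) (F' := @ser_d R n)) // => i y.
by rewrite weyl_act_wd.
Qed.

Lemma weyl_act_linear_r P : linear (fun f => act P f).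
Proof.
move=> a f g; rewrite /weyl_act scaler_sumr -big_split; apply: eq_bigr => m _ /=.
rewrite -/(opm _ _) -/(opm _ _) (opm_linear _ ser_d_linear) (opm_linear _ ser_x_linear).
by rewrite scalerDr !scalerA mulrC.
Qed.

(** This allows being a solution to be tested on generators of the left ideal. *)
Lemma annihilator_left_ideal f : left_ideal (@weyl_mul C n) [set P | act P f = 0].
Proof.
split=> [|P Q /= Pf Qf|P Q /= Qf]; rewrite /= ?weyl_actE ?linear0 //.
  by rewrite linearD /= -!weyl_actE Pf Qf addr0.
rewrite -weyl_actE weyl_act_mul Qf; have := weyl_act_linear_r P (-1) 0 0.
by rewrite scaler0 addr0 scaleN1r addNr.
Qed.

Definition dmon (m : 'X_{1..n}) f : logseries R n := opm (@ser_d R n) m f.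

Definition dact (q : {mpoly C[n]}) f : logseries R n := mlin (dmon ^~ f) q.

Lemma dmonD a b f : dmon (a + b)%MM f = dmon a (dmon b f).
Proof.
rewrite /dmon -opmD; last exact: ser_dC.
by apply: opm_ext => i; rewrite mnmDE.
Qed.

Lemma dmonU i f : dmon U_(i)%MM f = ser_d i f.
Proof. by rewrite -(opm1 (@ser_d R n) i); apply: opm_ext => j; rewrite mnm1E. Qed.

Lemma dmon0 f : dmon 0%MM f = f.
Proof.
by rewrite /dmon (opm_ext _ (k' := fun=> 0%N)) ?opm0 // => i; rewrite mnm0E.
Qed.

Lemma dmon_linear m : linear (dmon m).
Proof. exact/opm_linear/ser_d_linear. Qed.

Lemma weyl_act_wd_poly q f : act (wd_poly q) f = dact q f.
Proof.
rewrite weyl_actE /wd_poly {1}[q]mpolyE (raddf_sum (comp_mpoly _)) /= linear_sum; apply: eq_bigr => m _.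
rewrite comp_mpolyZ linearZ /=; congr (_ *: _); rewrite comp_mpolyX.
under eq_bigr => i _ do rewrite tnth_mktuple.
rewrite mprodXnE mlinX /weyl_mon.
rewrite (@opm_ext _ _ _ _ (fun=> 0%N)); last first.
  by move=> j; rewrite mnm_sumE big1 // => i _; rewrite mulmnE mnm1E eq_rlshift.
rewrite opm0; apply: opm_ext => j.
rewrite mnm_sumE (bigD1 j) //= mulmnE mnm1E eqxx mul1n big1 ?addn0 // => i ij.
by rewrite mulmnE mnm1E eq_rshift (negPf ij).
Qed.

Lemma dact_annihilator f : left_ideal *%R [set q | dact q f = 0].
Proof.
split=> [|p q /= pf qf|p q /= qf]; rewrite /= /dact ?linear0 //.
  by rewrite linearD /= -/(dact p f) -/(dact q f) pf qf addr0.
rewrite {1}[p]mpolyE mulr_suml linear_sum big1 // => m _.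
rewrite -scalerAl linearZ /= mlin_mulX.
rewrite (eq_mlin (G := fun u => dmon m (dmon u f))); last by move=> u _; rewrite dmonD.
rewrite (mlin_morph _ _ (dmon_linear m)) -/(dact q f) qf.
have := dmon_linear m (-1) 0 0; rewrite scaler0 addr0 scaleN1r addNr => ->.
by rewrite scaler0.
Qed.

(** The operator x_j d_j preserves exponents: it sends x^e p(log x) to x^e (e_j p + dp/dt_j)(log x).
    An Euler equation is therefore a separate condition on each coefficient. *)
Lemma weyl_act_euler d (A : 'M[int]_(d, n)) (beta : 'cV[C]_d) i f e :
  act (euler_op R A i - (beta i 0)%:MP) f e =
  ((map_mx intr A *m e) i 0 - beta i 0) *: f e + \sum_j (A i j)%:~R *: (f e)^`M(j).
Proof.
rewrite weyl_actE linearB /= /euler_op linear_sum /=.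
have -> : mlin (weyl_mon f) (beta i 0)%:MP = beta i 0 *: f.
  rewrite -[_%:MP]mulr1 mul_mpolyC linearZ /= -mpolyX0 mlinX; congr (_ *: _).
  by rewrite weyl_mon0.
have -> : \sum_j mlin (weyl_mon f) ((A i j)%:~R *: (wx C j * wd C j)) =
    \sum_j (A i j)%:~R *: ser_x j (ser_d j f).
  apply: eq_bigr => j _; rewrite linearZ /=; congr (_ *: _).
  have -> : wx C j * wd C j = wx_mul j (wd_mul j 1) by rewrite /wx_mul /wd_mul mderivC mulr1 addr0.
  rewrite -weyl_actE weyl_act_wx weyl_act_wd weyl_actE -mpolyX0 mlinX.
  by rewrite weyl_mon0.
rewrite -[LHS]/((\sum_j (A i j)%:~R *: ser_x j (ser_d j f)) e - beta i 0 *: f e).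
rewrite scalerBl addrAC; congr (_ - _).
rewrite fct_sumE mxE scaler_suml -big_split; apply: eq_bigr => j _.
rewrite -[LHS]/((A i j)%:~R *: ser_x j (ser_d j f) e) /ser_x /ser_d subrK.
by rewrite scalerDr scalerA !mxE.
Qed.

(** The ideal [J] is arbitrary so that the criterion serves both for [hyp_ideal] and for the initial
    ideal in the definition of a fake exponent. *)
Lemma solution_ideal_with_euler d (A : 'M[int]_(d, n)) (beta : 'cV[C]_d) J f :
  solution (ideal_with_euler J A beta) f <->
  (forall q, J q -> dact q f = 0) /\
  forall i e, ((map_mx intr A *m e) i 0 - beta i 0) *: f e +
    \sum_j (A i j)%:~R *: (f e)^`M(j) = 0.
Proof.
split=> [sol|[torf eulf] P]; last first.
  apply: (smallest_sub (annihilator_left_ideal f)) => {}P [[q Jq <-]|[i _ <-]] /=.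
    by rewrite weyl_act_wd_poly torf.
  by apply/funext => e; rewrite weyl_act_euler eulf.
split=> [q Jq|i e].
  rewrite -weyl_act_wd_poly; apply: sol; apply: sub_gen_smallest; left.
  by exists q.
rewrite -weyl_act_euler sol //; apply: sub_gen_smallest; right; exact: imageT.
Qed.

Lemma solution_hyp_ideal d (A : 'M[int]_(d, n)) (beta : 'cV[C]_d) f :
  solution (hyp_ideal A beta) f <->
  (forall a b, A *m nvec a = A *m nvec b -> dmon a f = dmon b f) /\
  forall i e, ((map_mx intr A *m e) i 0 - beta i 0) *: f e +
    \sum_j (A i j)%:~R *: (f e)^`M(j) = 0.
Proof.
rewrite solution_ideal_with_euler; split=> -[torf eulf]; split=> //.
  move=> a b Aab; apply/eqP; rewrite -subr_eq0; apply/eqP.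
  have := torf ('X_[a] - 'X_[b]); rewrite /dact linearB /= !mlinX; apply.
  by apply: sub_gen_smallest; exists a, b.
apply: (smallest_sub (dact_annihilator f)) => _ [a [b [Aab ->]]] /=.
by rewrite /dact linearB /= !mlinX (torf a b) ?subrr.
Qed.

End SeriesActions.

(** * The hat operator *)

Section ChainRule.
Variables (K S : comNzRingType) (n : nat) (c : {rmorphism K -> S}) (h : 'I_n -> S).

(** The chain rule for an abstract derivation killing scalars. It is applied to partial derivatives
    in [mderiv_msubst] and to an auxiliary variable in [msubst_translate]. *)
Lemma mmap_derivation (D : S -> S) :
  {morph D : x y / x + y} -> (forall x y, D (x * y) = D x * y + x * D y) ->
  (forall a, D (c a) = 0) ->
  forall p, D (mmap c h p) = \sum_i D (h i) * mmap c h (mderiv i p).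
Proof.
move=> DD DM Dc; pose good p := D (mmap c h p) = \sum_i D (h i) * mmap c h (mderiv i p).
have goodC a : good a%:MP.
  by rewrite /good mmapC Dc big1 // => i _; rewrite mderivC mmap0 mulr0.
have goodD p q : good p -> good q -> good (p + q).
  rewrite /good mmapD DD => -> ->; rewrite -big_split; apply: eq_bigr => i _ /=.
  by rewrite mderivD mmapD mulrDr.
have goodM p q : good p -> good q -> good (p * q).
  rewrite /good rmorphM DM => -> ->; rewrite mulr_suml mulr_sumr -big_split.
  apply: eq_bigr => i _ /=; rewrite mderivM mmapD !rmorphM /= mulrDr; congr (_ + _).
    by rewrite mulrA.
  by rewrite mulrCA.
have goodX i : good 'X_i.
  rewrite /good mmapX mmap1U (bigD1 i) //= mderivX mnm1E eqxx scale1r.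
  have -> : (U_(i) - U_(i))%MM = 0%MM :> 'X_{1..n} by apply/mnmP => j; rewrite mnmBE mnm0E subnn.
  rewrite mpolyX0 rmorph1 mulr1 big1 ?addr0 // => j ji.
  by rewrite mderivX mnm1E eq_sym (negPf ji) scale0r mmap0 mulr0.
have good1 : good 1 by rewrite -mpolyC1.
elim/mpolyind => [|a m p _ _ IHp]; first exact: (goodC 0).
apply: goodD => //; rewrite -mul_mpolyC; apply: (goodM) => //.
rewrite mpolyXE_id; elim/big_ind: _ => // i _.
by elim: (m i) => [|k IHk]; rewrite ?expr0 ?exprS //; apply: (goodM).
Qed.

Lemma mmap_morph (T : comNzRingType) (f : {rmorphism S -> T}) p :
  f (mmap c h p) = mmap (f \o c) (f \o h) p.
Proof.
rewrite /mmap rmorph_sum; apply: eq_bigr => m _; rewrite rmorphM rmorph_prod.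
by congr (_ * _); apply: eq_bigr => i _; rewrite rmorphXn.
Qed.

End ChainRule.

Lemma mmap_ext (K : nzRingType) (S : nzRingType) n (c c' : K -> S) (h h' : 'I_n -> S) p :
  c =1 c' -> h =1 h' -> mmap c h p = mmap c' h' p.
Proof.
move=> cc hh; apply: eq_bigr => m _; rewrite cc; congr (_ * _).
by apply: eq_bigr => i _; rewrite hh.
Qed.

Section Substitution.
Variable K : comNzRingType.

Definition msubst n k (h : 'I_n -> {mpoly K[k]}) (p : {mpoly K[n]}) : {mpoly K[k]} :=
  locked (mmap (@mpolyC k K) h p).

Lemma msubst_mmap n k (h : 'I_n -> {mpoly K[k]}) p : msubst h p = mmap (@mpolyC k K) h p.
Proof. by rewrite /msubst -lock. Qed.

Lemma msubstE n k (h : 'I_n -> {mpoly K[k]}) p : p \mPo [tuple h i | i < n] = msubst h p.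
Proof. by rewrite msubst_mmap; apply: mmap_ext => // i; rewrite tnth_mktuple. Qed.

Lemma msubst_ext n k (h h' : 'I_n -> {mpoly K[k]}) p : h =1 h' -> msubst h p = msubst h' p.
Proof. by move=> hh; rewrite !msubst_mmap; apply: mmap_ext. Qed.

Lemma msubstX n k (h : 'I_n -> {mpoly K[k]}) i : msubst h 'X_i = h i.
Proof. by rewrite msubst_mmap mmapX mmap1U. Qed.

Lemma msubst_linear n k (h : 'I_n -> {mpoly K[k]}) : linear (msubst h).
Proof. by move=> a p q; rewrite !msubst_mmap mmapD mmapZ mul_mpolyC. Qed.

HB.instance Definition _ n k h :=
  GRing.isLinear.Build K {mpoly K[n]} {mpoly K[k]} *:%R (@msubst n k h) (msubst_linear h).

Lemma msubst_id n (p : {mpoly K[n]}) : msubst (fun i => 'X_i) p = p.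
Proof. by rewrite -msubstE comp_mpoly_id. Qed.

Lemma msubst_comp n k l (g : 'I_k -> {mpoly K[l]}) (h : 'I_n -> {mpoly K[k]}) p :
  msubst g (msubst h p) = msubst (fun i => msubst g (h i)) p.
Proof.
rewrite (msubst_mmap g) (msubst_mmap h) mmap_morph msubst_mmap; apply: mmap_ext => [a|i] /=.
  exact: mmapC.
by rewrite msubst_mmap.
Qed.

Lemma mderiv_msubst n k (h : 'I_n -> {mpoly K[k]}) j p :
  mderiv j (msubst h p) = \sum_i mderiv j (h i) * msubst h (mderiv i p).
Proof.
rewrite msubst_mmap (@mmap_derivation _ _ _ _ _ (mderiv j)) => [|x y|x y|a]; last 3 first.
- exact: mderivD.
- exact: mderivM.
- exact: mderivC.
by apply: eq_bigr => i _; rewrite msubst_mmap.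
Qed.

Lemma mderivU n (i j : 'I_n) : mderiv i 'X_j = (i == j)%:R :> {mpoly K[n]}.
Proof.
rewrite mderivX mnm1E eq_sym; case: eqP => [->|_]; last by rewrite scale0r.
have -> : (U_(j) - U_(j))%MM = 0%MM :> 'X_{1..n} by apply/mnmP => l; rewrite mnmBE mnm0E subnn.
by rewrite scale1r mpolyX0.
Qed.

End Substitution.

Section Invariance.
Variables (K : numFieldType) (n : nat).

Lemma mpoly_mulrn_eq0 k (q : {mpoly K[n]}) : (0 < k)%N -> q *+ k = 0 -> q = 0.
Proof.
move=> k0; rewrite -scaler_nat => /(congr1 (fun r => k%:R^-1 *: r)).
by rewrite scalerA mulVf ?pnatr_eq0 -?lt0n // scale1r scaler0.
Qed.

(* The substitution is joined to the identity by [X_i + s * sum_k a_ki y_k], whose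
   derivative in [s] vanishes by the chain rule. *)
Lemma msubst_translate m (a : 'I_m -> 'I_n -> K) (y : 'I_m -> {mpoly K[n]}) p :
  (forall k, \sum_i a k i *: mderiv i p = 0) ->
  msubst (fun i => 'X_i + \sum_k a k i *: y k) p = p.
Proof.
move=> ap0; pose g i : {mpoly K[n]} := \sum_k a k i *: y k.
pose F := mmap (@polyC _ \o @mpolyC n K) (fun i => ('X_i)%:P + (g i)%:P * 'X) p.
have F' : F^`() = 0.
  rewrite (@mmap_derivation _ _ _ _ _ (@deriv _)) //; last 3 first.
  - by move=> u v; rewrite derivD.
  - by move=> u v; rewrite derivM.
  - by move=> u; rewrite /= derivC.
  pose f := mmap (@polyC _ \o @mpolyC n K) (fun i => ('X_i)%:P + (g i)%:P * 'X).
  transitivity (\sum_i \sum_k (y k)%:P * f (a k i *: mderiv i p)).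
    apply: eq_bigr => i _; rewrite derivD derivC add0r derivM derivC mul0r add0r derivX mulr1.
    rewrite [g i]/g rmorph_sum mulr_suml; apply: eq_bigr => k _.
    rewrite -[LHS]/((a k i *: y k)%:P * f (mderiv i p)).
    by rewrite -mul_mpolyC polyCM /f mmapZ -mulrA mulrCA.
  rewrite exchange_big big1 //= => k _; rewrite -mulr_sumr -raddf_sum ap0.
  by rewrite raddf0 mulr0.
have FC : F = (F`_0)%:P.
  apply/polyP => -[|i]; rewrite coefC //=; apply: (@mpoly_mulrn_eq0 i.+1) => //.
  by rewrite -coef_deriv F' coef0.
have Fx x : F.[x] = mmap (@mpolyC n K) (fun i => 'X_i + g i * x) p.
  rewrite -[F.[x]]/(horner_eval x F) mmap_morph; apply: mmap_ext => i /=.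
    by rewrite /horner_eval hornerC.
  by rewrite /horner_eval hornerD hornerM !hornerC hornerX.
transitivity F.[1].
  by rewrite Fx msubst_mmap; apply: mmap_ext => // i; rewrite mulr1.
rewrite FC hornerC -[RHS]msubst_id msubst_mmap.
rewrite -[LHS](hornerC _ 0) -FC Fx; apply: mmap_ext => // i; by rewrite mulr0 addr0.
Qed.

End Invariance.

Section Hat.
Variables (R : realType) (n : nat).
Local Notation C := R[i].

(** The hat operator as a single substitution, free of any basis of the kernel and defined on all
    polynomials. [hatE] compares it with [hat A]. *)
Definition hatp (p : {mpoly C[n]}) : {mpoly C[1 + n]} :=
  msubst (fun i => 'X_(rshift 1 i) - 'X_(idx0 n)) p.

(** Restriction to t_0 = 0, a left inverse of [hatp]. *)
Definition unhat (r : {mpoly C[1 + n]}) : {mpoly C[n]} :=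
  msubst (fun i => match fintype.split i with inl _ => 0 | inr j => 'X_j end) r.

HB.instance Definition _ := GRing.Linear.copy hatp
  (msubst (fun i => 'X_(rshift 1 i) - 'X_(idx0 n))).
HB.instance Definition _ := GRing.Linear.copy unhat
  (msubst (fun i : 'I_(1 + n) => match fintype.split i with inl _ => 0 | inr j => 'X_j end : {mpoly C[n]})).

Lemma hatp0 : hatp 0 = 0.
Proof. exact: linear0. Qed.

Lemma hatpP a p q : hatp (a *: p + q) = a *: hatp p + hatp q.
Proof. exact: linearP. Qed.

Lemma hatpZ a p : hatp (a *: p) = a *: hatp p.
Proof. exact: linearZ. Qed.

Lemma unhat0 : unhat 0 = 0.
Proof. exact: linear0. Qed.

Lemma unhatP a p q : unhat (a *: p + q) = a *: unhat p + unhat q.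
Proof. exact: linearP. Qed.

Lemma split_idx0 : fintype.split (idx0 n) = inl ord0.
Proof. exact: (unsplitK (inl _)). Qed.

Lemma split_rshift1 (j : 'I_n) : fintype.split (rshift 1 j) = inr j.
Proof. exact: (unsplitK (inr _)). Qed.

Lemma split1P (i : 'I_(1 + n)) : i = idx0 n \/ exists j, i = rshift 1 j.
Proof.
rewrite -(splitK i); case: (fintype.split i) => [j|j] /=; last by right; exists j.
by rewrite (ord1 j); left.
Qed.

Lemma unhatK p : unhat (hatp p) = p.
Proof.
rewrite /unhat /hatp msubst_comp -[RHS]msubst_id; apply: msubst_ext => i.
by rewrite raddfB /= !msubstX split_idx0 split_rshift1 subr0.
Qed.

Lemma hatp_inj : injective hatp.
Proof. exact: can_inj unhatK. Qed.

(** A polynomial killed by the sum of all partial derivatives is invariant under translation by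
    multiples of (1, ..., 1), here by -t_0 (1, ..., 1), so its restriction to t_0 = 0 determines
    it. *)
Lemma hatpK r : \sum_i mderiv i r = 0 -> hatp (unhat r) = r.
Proof.
move=> r0; rewrite /unhat /hatp msubst_comp.
rewrite -[RHS](@msubst_translate _ _ 1 (fun _ _ => 1) (fun=> - 'X_(idx0 n))); last first.
  by move=> _; rewrite -[RHS]r0; apply: eq_bigr => i _; rewrite scale1r.
apply: msubst_ext => i; rewrite big_ord1 scale1r.
have [->|[j ->]] := split1P i; first by rewrite split_idx0 raddf0 subrr.
by rewrite split_rshift1 msubstX.
Qed.

Lemma mderiv_hatp j p : mderiv (rshift 1 j) (hatp p) = hatp (mderiv j p).
Proof.
rewrite mderiv_msubst (bigD1 j) //= mderivB !mderivU eqxx eq_rlshift subr0 mul1r.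
rewrite big1 ?addr0 // => i ij.
by rewrite mderivB !mderivU eq_rshift eq_rlshift eq_sym (negPf ij) subr0 mul0r.
Qed.

Lemma mderiv0_hatp p : mderiv (idx0 n) (hatp p) = - hatp (\sum_j mderiv j p).
Proof.
rewrite mderiv_msubst linear_sum -sumrN; apply: eq_bigr => i _.
by rewrite mderivB !mderivU eqxx eq_lrshift sub0r mulN1r.
Qed.

Lemma sum_mderiv_hatp p : \sum_i mderiv i (hatp p) = 0.
Proof.
rewrite big_split_ord /= big_ord1 mderiv0_hatp linear_sum addrC; apply/eqP.
by rewrite subr_eq0; apply/eqP; apply: eq_bigr => i _; rewrite mderiv_hatp.
Qed.

End Hat.

(** * Integral bases of the kernel lattice *)

Section KernelBasis.
Variables (d n : nat) (A : 'M[int]_(d, n)).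
Hypothesis genA : columns_generate A.

Lemma right_inverse : exists B : 'M[int]_(n, d), A *m B = 1%:M.
Proof.
have /choice[b bP] (k : 'I_d) : exists z, A *m z = col k 1%:M by exact: genA.
exists (\matrix_(i, k) b k i 0); apply/matrixP => i k.
have /matrixP/(_ i 0) := bP k; rewrite !mxE => <-.
by apply: eq_bigr => j _; rewrite !mxE.
Qed.

(** Take a Smith normal form A = L D U. Surjectivity of A makes the d diagonal entries of D nonzero,
    so the kernel of D consists of the vectors whose first d coordinates vanish, and the last n - d
    columns of the inverse of U form a basis. *)
Lemma ker_zbasis_exists : exists gamma, ker_zbasis A gamma.
Proof.
have [B AB] := right_inverse.
have [L Lu [U Uu [s _ AE]]] := int_Smith_normal_form A.
set D := (\matrix_(i, j) _) in AE.
have DE i l (u : 'M[int]_(n, l)) k : (D *m u) i k =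
    \sum_(j < n) (if i == j :> nat then s`_i * u j k else 0).
  by rewrite mxE; apply: eq_bigr => j _; rewrite mxE; case: eqP; rewrite ?mulr1n ?mulr0n ?mul0r.
have DX : D *m (U *m B *m L) = 1%:M.
  have := congr1 (fun M => invmx L *m M *m L) AB.
  by rewrite AE !mulmxA mulVmx // mul1mx mulmx1 mulVmx // => <-; rewrite -!mulmxA.
(* The diagonal entries of D X = 1 are nonzero, so row i of D has a column of index i with a nonzero
   entry. This also gives d <= n. *)
have s_neq0 (i : 'I_d) : exists2 j : 'I_n, i = j :> nat & s`_i != 0.
  have /matrixP/(_ i i) := DX; rewrite DE !mxE eqxx.
  case: (pickP (fun j : 'I_n => i == j :> nat)) => [j /eqP ij sum1|none].
    exists j => //; apply/eqP => si0; move: sum1; rewrite big1 // => k _.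
    by rewrite si0 mul0r if_same.
  by rewrite big1 // => k _; rewrite none.
have dn : (d <= n)%N.
  case: (leqP d n) => // nd; have [j /= nj] := s_neq0 (Ordinal nd).
  by move: (ltn_ord j); rewrite -nj ltnn.
pose N : 'M[int]_(n, n - d) := \matrix_(l, j) (l == d + j :> nat)%N%:R.
have sh (j : 'I_(n - d)) : (d + j < n)%N by rewrite -ltn_subRL.
have NE (z : 'cV[int]_(n - d)) j : (N *m z) (Ordinal (sh j)) 0 = z j 0.
  rewrite mxE (bigD1 j) //= mxE eqxx mul1r big1 ?addr0 // => k kj.
  by rewrite mxE /= eqn_add2l eq_sym val_eqE (negPf kj) mul0r.
have DN : D *m N = 0.
  apply/matrixP => i j; rewrite DE !mxE big1 // => k _; case: eqP => // ik.
  rewrite mxE -ik; case: eqP => [e|_]; last by rewrite mulr0.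
  by move: (ltn_ord i); rewrite e ltnNge leq_addr.
exists (invmx U *m N); split.
  by rewrite AE -!mulmxA (mulmxA U) mulmxV // mul1mx DN mulmx0.
move=> u; rewrite /kerZ /= => Au0.
have Uu0 (l : 'I_n) : (l < d)%N -> (U *m u) l 0 = 0.
  move=> ld; have : D *m (U *m u) = 0.
    by have := congr1 (mulmx (invmx L)) Au0; rewrite AE -!mulmxA !mulmxA mulVmx // mul1mx mulmx0.
  move=> /matrixP/(_ (Ordinal ld) 0); rewrite DE [RHS]mxE (bigD1 l) //= eqxx big1 ?addr0; last first.
    by move=> k kl; rewrite eq_sym val_eqE (negPf kl).
  have [j _ sl] := s_neq0 (Ordinal ld).
  by move=> /eqP; rewrite mulf_eq0 (negPf sl) => /eqP.
exists (\col_j (U *m u) (Ordinal (sh j)) 0); split.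
  rewrite -mulmxA -[u in LHS](mulKmx Uu); congr (_ *m _); apply/matrixP => l k.
  rewrite (ord1 k); have [ld|dl] := ltnP l d.
    rewrite Uu0 // mxE big1 // => j _; rewrite [N l j]mxE.
    by rewrite ltn_eqF ?mul0r // (leq_trans ld) ?leq_addr.
  have ld : (l - d < n - d)%N by rewrite ltn_sub2r // (leq_ltn_trans dl).
  have -> : l = Ordinal (sh (Ordinal ld)) by apply: val_inj; rewrite /= subnKC.
  by rewrite NE [RHS]mxE.
move=> z uz; apply/matrixP => j k; rewrite (ord1 k) mxE -NE uz.
by rewrite !mulmxA mulmxV // mul1mx.
Qed.

End KernelBasis.

Section HatOperator.
Variables (R : realType) (d n : nat) (A : 'M[int]_(d, n)).
Local Notation C := R[i].

(** [lin_form_hat] is [lin_form] with t_i - t_0 in place of t_i, so the value depends neither on the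
    basis nor on the presentation of [p]. *)
Lemma is_hatE (p : {mpoly C[n]}) ph : is_hat A p ph -> ph = hatp p.
Proof.
move=> [g [q [_ -> ->]]]; rewrite !msubstE /hatp msubst_comp; apply: msubst_ext => j.
rewrite /lin_form raddf_sum /= /lin_form_hat.
under [RHS]eq_bigr => i _ do rewrite linearZ /= msubstX scalerBr.
rewrite big_split /= addrC; congr (_ + _).
rewrite sumrN -scaler_suml scaleNr; congr (- (_ *: _)).
by rewrite /vsum rmorph_sum; apply: eq_bigr => i _; rewrite mxE.
Qed.

(** By [is_hatE] only a presentation of [p] has to be found. If A B = 1, the columns of 1 - B A lie
    in the kernel. Since [p] is killed by the rows of A, replacing each X_i by the linear form of
    column i of 1 - B A leaves [p] unchanged, and expanding these columns in the basis gives [q]. *)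
Lemma hatE (p : {mpoly C[n]}) : columns_generate A ->
  (forall i, \sum_j (A i j)%:~R *: mderiv j p = 0) -> hat A p = hatp p.
Proof.
move=> genA Ap0; have [g gA] := ker_zbasis_exists genA.
suff [ph] : exists ph, is_hat A p ph by move=> hp; have := is_hatE (xgetPex 0 (ex_intro _ _ hp)).
have [B AB] := right_inverse genA; have [Ag0 gP] := gA.
have /choice[z zP] (k : 'I_n) : exists z, col k (1%:M - B *m A) = g *m z.
  have [|z [? _]] := gP (col k (1%:M - B *m A)); last by exists z.
  by rewrite /kerZ /= colE mulmxA mulmxBr mulmxA AB mul1mx mulmx1 subrr mul0mx.
pose q := msubst (fun i => \sum_j (z i j 0)%:~R *: 'X_j : {mpoly C[n - d]}) p.
exists (q \mPo [tuple lin_form_hat R g j | j < n - d]), g, q; split=> //.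
rewrite msubstE /q msubst_comp.
(* With this choice X_i + sum_k A_ki y_k is the linear form of column i of 1 - B A. *)
pose y (k : 'I_d) : {mpoly C[n]} := - \sum_l (B l k)%:~R *: 'X_l.
transitivity (msubst (fun i => 'X_i + \sum_k (A k i)%:~R *: y k) p).
  by rewrite msubst_translate.
rewrite /y {y}; apply: msubst_ext => i; rewrite raddf_sum /=.
transitivity (\sum_l ((1%:M - B *m A) l i)%:~R *: 'X_l : {mpoly C[n]}).
  have E l : ((1%:M - B *m A) l i)%:~R = (l == i)%:R - ((B *m A) l i)%:~R :> C.
    by rewrite !mxE rmorphB /= rmorph_nat.
  under [RHS]eq_bigr => l _ do rewrite E scalerBl.
  have -> : 'X_i = \sum_l (l == i)%:R *: 'X_l :> {mpoly C[n]}.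
    rewrite (bigD1 i) //= eqxx scale1r big1 ?addr0 // => l li.
    by rewrite (negPf li) scale0r.
  rewrite big_split /=.
  congr (_ + _); rewrite sumrN.
  under eq_bigr => k _ do rewrite scalerN scaler_sumr.
  rewrite sumrN exchange_big; congr (- _); apply: eq_bigr => l _ /=.
  rewrite mxE rmorph_sum scaler_suml; apply: eq_bigr => k _.
  by rewrite scalerA rmorphM mulrC.
transitivity (\sum_l \sum_j (z i j 0 * g l j)%:~R *: 'X_l : {mpoly C[n]}).
  apply: eq_bigr => l _; rewrite -scaler_suml -rmorph_sum; congr (_%:~R *: _).
  have /matrixP/(_ l 0) := zP i; rewrite !mxE => ->.
  by apply: eq_bigr => j _; rewrite mulrC.
rewrite exchange_big; apply: eq_bigr => j _; rewrite linearZ /= msubstX /lin_form scaler_sumr.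
by apply: eq_bigr => l _; rewrite scalerA rmorphM.
Qed.

End HatOperator.

(** * Powers of d_0 *)

Section LowerOrderPerturbation.
Variables (K : fieldType) (n : nat).
Implicit Types (p q : {mpoly K[n]}).

Lemma msize_mderiv (i : 'I_n) p : (msize p^`M(i) <= (msize p).-1)%N.
Proof.
rewrite [in X in (X <= _)%N]msizeE big_seq; elim/big_ind: _ => // [a b|m].
  by rewrite geq_max => -> ->.
rewrite mcoeff_msupp mcoeff_mderiv => pm.
have : (m + U_(i))%MM \in msupp p.
  by rewrite mcoeff_msupp; apply: contraNneq pm => ->; rewrite mul0rn.
by move=> /msize_mdeg_lt; rewrite mdegD mdeg1 addn1; case: (msize p).
Qed.

(** A nonzero multiple of [p] plus a term of smaller degree keeps the leading monomial of [p]. For p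
    = 0 the truncated bound forces q = 0. *)
Lemma msize_scale_add c p q : c != 0 -> (msize q <= (msize p).-1)%N ->
  msize (c *: p + q) = msize p.
Proof.
move=> c0 qp; apply/eqP; rewrite eqn_leq; apply/andP; split.
  rewrite (leq_trans (msizeD_le _ _)) // geq_max msizeZ_le /=.
  exact: leq_trans qp (leq_pred _).
have [->|p0] := eqVneq p 0; first by rewrite msize0.
rewrite -(mlead_deg p0); apply: msize_mdeg_lt.
rewrite mcoeff_msupp mcoeffD mcoeffZ [X in _ + X]memN_msupp_eq0 ?addr0.
  by rewrite mulf_neq0 // -mcoeff_msupp mlead_supp.
by apply: msize_mdeg_ge; rewrite (leq_trans qp) // -(mlead_deg p0).
Qed.

Lemma scale_add_eq0 c p q : c != 0 -> (msize q <= (msize p).-1)%N ->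
  c *: p + q = 0 -> p = 0.
Proof.
move=> c0 qp E; apply/eqP; rewrite -msize_poly_eq0 -(msize_scale_add c0 qp) E.
by rewrite msize0.
Qed.

Lemma msize_sum_mderiv (c : 'I_n -> K) p :
  (msize (\sum_j c j *: p^`M(j)) <= (msize p).-1)%N.
Proof.
elim/big_ind: _ => [|x y xp yp|j _]; first by rewrite msize0.
  by rewrite (leq_trans (msizeD_le _ _)) // geq_max xp.
exact: leq_trans (msizeZ_le _ _) (msize_mderiv _ _).
Qed.

End LowerOrderPerturbation.

(** Suited to facts about d_0^k: they pass from k to k + 1 by applying d_0 and back by its
    injectivity. *)
Lemma int_step_ind (P : int -> Prop) :
  P 0 -> (forall k, P k <-> P (k + 1)) -> forall k, P k.
Proof.
move=> P0 PS; apply: int_rect => // k Pk; first by rewrite -addn1 PoszD; apply: (PS k).1.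
by apply: (PS _).2; rewrite -addn1 PoszD opprD addrNK.
Qed.

Lemma mnm_ind n (P : 'X_{1..n} -> Prop) :
  P 0%MM -> (forall i m, P m -> P (U_(i) + m)%MM) -> forall m, P m.
Proof.
move=> P0 PS m; elim: {m}(mdeg m) {-2}m (erefl (mdeg m)) => [|k IHk] m mk.
  by move/eqP: mk; rewrite mdeg_eq0 => /eqP ->.
have [i mi] : exists i, m i != 0%N.
  apply: contra_eqP mk => /forallNP m0; rewrite mdegE big1 // => i _.
  by apply/eqP; apply: contra_notT (m0 i).
have Um : (U_(i) <= m)%MM by rewrite lep1mP.
rewrite -(submK Um) addmC; apply: PS; apply: IHk.
by apply/eqP; rewrite -(eqn_add2r 1) -{1}(mdeg1 i) -mdegD submK // mk addn1.
Qed.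

Definition nonint (R : realType) (s : R[i]) := forall z : int, s != z%:~R.

Lemma nonintB (R : realType) (s : R[i]) : forall k : int, nonint s -> nonint (s - k%:~R).
Proof. by move=> k sZ z; rewrite subr_eq -rmorphD; exact: sZ. Qed.

Lemma nonint_neq0 (R : realType) (s : R[i]) : nonint s -> s != 0.
Proof. by move=> /(_ 0). Qed.

(* [diff0 s] and [dpow s k] are the polynomial parts of [d_0] and [d_0^k] acting on
   [x_0^s C[log x]]. *)
Section PowersOfD0.
Variables (R : realType) (n : nat).
Local Notation C := R[i].
Local Notation i0 := (idx0 n).
Implicit Types (s : C) (p q r : {mpoly C[1 + n]}) (k l : int).

Definition diff0 s p := s *: p + p^`M(i0).

Lemma diff0E s p : diff0 s p = s *: p + p^`M(i0).
Proof. by []. Qed.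

Lemma diff0_linear s : linear (diff0 s).
Proof.
move=> a p q; rewrite /diff0 mderivD mderivZ !scalerDr !scalerA mulrC.
by rewrite addrACA.
Qed.

Lemma diff0_eq0 s p : s != 0 -> diff0 s p = 0 -> p = 0.
Proof. by move=> s0; apply: scale_add_eq0 => //; exact: msize_mderiv. Qed.

Lemma diff0_inj s : s != 0 -> injective (diff0 s).
Proof.
move=> s0 p q pq; apply/eqP; rewrite -subr_eq0; apply/eqP; apply: (diff0_eq0 s0).
by rewrite addrC -scaleN1r diff0_linear pq scaleN1r addNr.
Qed.

Lemma msize_diff0 s p : s != 0 -> msize (diff0 s p) = msize p.
Proof. by move=> s0; apply: msize_scale_add => //; exact: msize_mderiv. Qed.

Lemma diff0_surj s p : s != 0 -> exists q, diff0 s q = p.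
Proof.
move=> s0; elim: {p}(msize p) {-2}p (leqnn (msize p)) => [|k IHk] p pk.
  exists 0; rewrite /diff0 scaler0 mderiv0 add0r; apply/esym/eqP.
  by rewrite -msize_poly_eq0 -leqn0.
(* The derivative has smaller degree, hence a preimage q by induction, and then s^-1 (p - q) is a
   preimage of p. *)
have [q qE] : exists q, diff0 s q = p^`M(i0).
  apply: IHk; rewrite (leq_trans (msize_mderiv _ _)) //.
  by move: pk; case: (msize p).
exists (s^-1 *: (p - q)); rewrite /diff0 scalerA mulfV // scale1r mderivZ mderivB -qE.
by rewrite /diff0 addrK scalerA mulVf // scale1r subrK.
Qed.

Lemma mderiv_diff0 s j p : (diff0 s p)^`M(j) = diff0 s p^`M(j).
Proof. by rewrite /diff0 mderivD mderivZ mderiv_comm. Qed.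

Definition diff0_inv s p := xget 0 [set q | diff0 s q = p].

Lemma diff0_invK s p : s != 0 -> diff0 s (diff0_inv s p) = p.
Proof. by move=> s0; have := xgetPex 0 (diff0_surj p s0). Qed.

(** After k' derivations the exponent of x_0 is s - k', which is the factor of the next one. The
    antiderivation following k' others lands on exponent s + k' + 1, which is where [diff0] is
    inverted. *)
Fixpoint dpow_pos s (k : nat) p :=
  if k is k'.+1 then diff0 (s - k'%:R) (dpow_pos s k' p) else p.

Fixpoint dpow_neg s (k : nat) p :=
  if k is k'.+1 then diff0_inv (s + k'.+1%:R) (dpow_neg s k' p) else p.

Definition dpow s k p :=
  match k with Posz k => dpow_pos s k p | Negz k => dpow_neg s k.+1 p end.

Section NonIntegral.
Variable s : C.
Hypothesis sZ : nonint s.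

Let sk k : s - k%:~R != 0.
Proof. exact/nonint_neq0/(nonintB _ sZ). Qed.

(** One recursion for all integers. On the negative side it is the defining property of [diff0_inv],
    available because s - k is never zero. *)
Lemma dpowS k p : dpow s (k + 1) p = diff0 (s - k%:~R) (dpow s k p).
Proof.
case: k => [k|[|k]]; first by rewrite -PoszD addn1.
  have := sk (Negz 0); rewrite -[dpow s (Negz 0) p]/(diff0_inv (s + 1) p) NegzE rmorphN opprK => s1.
  exact: (esym (diff0_invK _ s1)).
have := sk (Negz k.+1).
have -> : Negz k.+1 + 1 = Negz k by rewrite !NegzE -(addn1 k.+1) PoszD opprD addrNK.
rewrite -[dpow s (Negz k.+1) p]/(diff0_inv (s + k.+2%:R) (dpow s (Negz k) p)).
rewrite NegzE rmorphN opprK => s1; exact: (esym (diff0_invK _ s1)).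
Qed.

Lemma dpow_linear k : linear (dpow s k).
Proof.
elim/int_step_ind: k => // k; split=> H a p q.
  by rewrite !dpowS H diff0_linear.
by apply: (diff0_inj (sk k)); rewrite diff0_linear -!dpowS H.
Qed.

Lemma mderiv_dpow k j p : (dpow s k p)^`M(j) = dpow s k p^`M(j).
Proof.
elim/int_step_ind: k => // k; split=> H; first by rewrite !dpowS mderiv_diff0 H.
by apply: (diff0_inj (sk k)); rewrite -mderiv_diff0 -!dpowS H.
Qed.

Lemma msize_dpow k p : msize (dpow s k p) = msize p.
Proof. by elim/int_step_ind: k => // k; rewrite dpowS msize_diff0. Qed.

Lemma dpow0 k : dpow s k 0 = 0.
Proof. by apply/eqP; rewrite -msize_poly_eq0 msize_dpow msize0. Qed.

Lemma dpow_eq0 k p : dpow s k p = 0 -> p = 0.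
Proof.
by move=> /eqP; rewrite -msize_poly_eq0 msize_dpow msize_poly_eq0 => /eqP.
Qed.

End NonIntegral.

Lemma dpowD s k l p : nonint s -> dpow s (k + l) p = dpow (s - k%:~R) l (dpow s k p).
Proof.
move=> sZ; have skZ := nonintB k sZ.
elim/int_step_ind: l => [|l]; first by rewrite addr0.
rewrite addrA !dpowS // rmorphD opprD addrA; split=> [->//|].
by apply: diff0_inj; apply/nonint_neq0/(nonintB l skZ).
Qed.

Lemma dpowNK s k p : nonint s -> dpow s k (dpow (s - k%:~R) (- k) p) = p.
Proof.
move=> sZ; have skZ := nonintB k sZ.
have := dpowD (- k) k p skZ; rewrite addNr rmorphN opprK subrK => <-.
by rewrite /=.
Qed.

Lemma ser_d0_term e p :
  ser_d i0 (ser_term e p) = ser_term (e - delta_mx i0 0) (diff0 (e i0 0) p).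
Proof.
apply/funext => x; rewrite /ser_d /ser_term /diff0 -subr_eq opprK.
by case: eqP => [->|_] //; rewrite scaler0 mderiv0 addr0.
Qed.

Lemma ser_term_inj e : injective (@ser_term R (1 + n) e).
Proof. by move=> p q /(congr1 (fun f => f e)); rewrite /ser_term eqxx. Qed.

Lemma antideriv0E e p :
  antideriv0 (e, p) = (e + delta_mx i0 0, diff0_inv (e i0 0 + 1) p).
Proof.
rewrite /antideriv0 /diff0_inv /=; congr (_, xget 0 _); apply/seteqP.
have E q : ser_d i0 (ser_term (e + delta_mx i0 0) q) = ser_term e (diff0 (e i0 0 + 1) q).
  by rewrite ser_d0_term addrK !mxE !eqxx.
by split=> q /=; rewrite E; [move=> /ser_term_inj | move=> ->].
Qed.

Lemma d0_powE k (e : 'cV[C]_(1 + n)) p :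
  d0_pow k e p = ser_term (e - k%:~R *: delta_mx i0 0) (dpow (e i0 0) k p).
Proof.
case: k => k; rewrite /d0_pow.
  rewrite -[dpow _ _ _]/(dpow_pos (e i0 0) k p).
  elim: k => [|k IHk] /=; first by rewrite scale0r subr0.
  rewrite IHk ser_d0_term !mxE !eqxx mulr1 -addrA -opprD; congr (ser_term (_ - _) _).
  by rewrite -[k.+1%:~R]/(k.+1%:R : C) -natr1 scalerDl scale1r.
have H j : iter j (@antideriv0 R n) (e, p) =
    (e + j%:R *: delta_mx i0 0, dpow_neg (e i0 0) j p).
  elim: j => [|j IHj] /=; first by rewrite scale0r addr0.
  rewrite IHj antideriv0E !mxE !eqxx mulr1 -!addrA; congr (_ + _, diff0_inv (_ + _) _).
    by rewrite -natr1 scalerDl scale1r.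
  by rewrite -natr1.
by rewrite H NegzE rmorphN scaleNr opprK.
Qed.

End PowersOfD0.

(** * Homogenization relative to a base point *)

Section Shifts.
Variables (R : realType) (n : nat).
Local Notation C := R[i].
Implicit Types (v e : 'cV[C]_n) (u : 'cV[int]_n).

Lemma shift0 v : shift v 0 = v.
Proof. by apply/matrixP => i j; rewrite !mxE addr0. Qed.

Lemma shiftD v u u' : shift v (u + u') = shift (shift v u) u'.
Proof. by apply/matrixP => i j; rewrite !mxE rmorphD addrA. Qed.

Lemma shift_delta v u i : shift v (u + delta_mx i 0) = shift v u + delta_mx i 0.
Proof.
by rewrite shiftD; congr (_ + _); apply/matrixP => j k; rewrite !mxE rmorph_nat.
Qed.

Lemma shift_inj v : injective (shift v).
Proof.
move=> u u' /(addrI v)/matrixP uu'; apply/matrixP => i j.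
by have := uu' i j; rewrite !mxE => /eqP; rewrite eqr_int => /eqP.
Qed.

Lemma vsumD (V : nmodType) (x y : 'cV[V]_n) : vsum (x + y) = vsum x + vsum y.
Proof. by rewrite /vsum -big_split; apply: eq_bigr => i _; rewrite mxE. Qed.

Lemma vsum_shift v u : vsum (shift v u) = vsum v + (vsum u)%:~R.
Proof.
rewrite vsumD; congr (_ + _); rewrite /vsum rmorph_sum.
by apply: eq_bigr => i _; rewrite mxE.
Qed.

Lemma vsum_delta (K : pzSemiRingType) i : vsum (delta_mx i 0 : 'cV[K]_n) = 1.
Proof.
rewrite /vsum (bigD1 i) //= mxE !eqxx big1 ?addr0 // => j ji.
by rewrite mxE (negPf ji).
Qed.

(** All of v + Z^n is allowed, not only v + ker A, so that the condition is stable under the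
    derivations d_i. *)
Definition lattice v (phi : logseries R n) :=
  forall e, phi e != 0 -> exists u, e = shift v u.

Lemma lattice_ser_d v i phi : lattice v phi -> lattice v (ser_d i phi).
Proof.
move=> lat e; rewrite /ser_d; have [->|/lat[u eu] _] := eqVneq (phi (e + delta_mx i 0)) 0.
  by rewrite scaler0 mderiv0 addr0 eqxx.
exists (u - delta_mx i 0); apply: (addIr (delta_mx i 0)).
by rewrite -shift_delta subrK.
Qed.

Lemma lattice_dmon v m phi : lattice v phi -> lattice v (dmon m phi).
Proof. by move=> lat; apply: (opm_ind (P := lattice v)) => // *; apply: lattice_ser_d. Qed.

Lemma latticeB v phi psi : lattice v phi -> lattice v psi -> lattice v (phi - psi).
Proof.
move=> lphi lpsi e; rewrite -[(phi - psi) e]/(phi e - psi e).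
have [->|/lphi//] := eqVneq (phi e) 0; have [->|/lpsi//] := eqVneq (psi e) 0.
by rewrite subr0 eqxx.
Qed.

End Shifts.

Section Transfer.
Variables (R : realType) (n : nat) (beta0 : R[i]).
Local Notation C := R[i].
Local Notation i0 := (idx0 n).
Implicit Types (v : 'cV[C]_n) (u : 'cV[int]_n) (phi : logseries R n).

(** The coordinate of index 0 is the one forced by the Euler equation of the top row of [rho_mx A]:
    the total degree is beta0. *)
Definition hlift (e : 'cV[C]_n) : 'cV[C]_(1 + n) := col_mx (const_mx (beta0 - vsum e)) e.

Lemma hlift0 e : hlift e i0 0 = beta0 - vsum e.
Proof. by rewrite /hlift col_mxEu mxE. Qed.

Lemma hliftS e j : hlift e (rshift 1 j) 0 = e j 0.
Proof. by rewrite /hlift col_mxEd. Qed.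

Lemma hliftK : cancel hlift (@dsubmx _ 1 n 1).
Proof. by move=> e; rewrite /hlift col_mxKd. Qed.

Lemma hliftP (e : 'cV[C]_(1 + n)) :
  (e == hlift (dsubmx e)) = (e i0 0 == beta0 - vsum (dsubmx e)).
Proof.
apply/eqP/eqP => [->|e0]; first by rewrite hlift0 hliftK.
apply/matrixP => i j; rewrite (ord1 j); have [->|[k ->]] := split1P i.
  by rewrite hlift0.
by rewrite hliftS mxE.
Qed.

Lemma dsubmx_delta0 (e : 'cV[C]_(1 + n)) : dsubmx (e + delta_mx i0 0) = dsubmx e.
Proof. by apply/matrixP => i j; rewrite !mxE eq_rlshift addr0. Qed.

Lemma dsubmx_deltaS (e : 'cV[C]_(1 + n)) j :
  dsubmx (e + delta_mx (rshift 1 j) 0) = dsubmx e + delta_mx j 0.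
Proof. by apply/matrixP => i k; rewrite !mxE eq_rshift. Qed.

(** Outside v + Z^n this is the default 0, which is harmless for series satisfying [lattice v]:
    their coefficients vanish there. *)
Definition offset v (e : 'cV[C]_n) : 'cV[int]_n := xget 0 [set u | e = shift v u].

Lemma offset_shift v u : offset v (shift v u) = u.
Proof. by apply: xget_unique => // u' /shift_inj ->. Qed.

(* For a basic Nilsson solution with exponent [v] this is its homogenization, and it
   is linear in [phi]; the dependence on the base point [v] is genuine. *)
Definition transfer v phi : logseries R (1 + n) := fun x : 'cV[C]_(1 + n) =>
  let e' := dsubmx x in
  if x == hlift e' then
    dpow (beta0 - vsum v) (vsum (offset v e')) (hatp (phi e'))
  else 0.

Lemma transfer_hlift v phi u :
  transfer v phi (hlift (shift v u)) =
  dpow (beta0 - vsum v) (vsum u) (hatp (phi (shift v u))).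
Proof. by rewrite /transfer hliftK eqxx offset_shift. Qed.

Lemma transfer_exponent v phi : transfer v phi (hlift v) = hatp (phi v).
Proof.
have := transfer_hlift v phi 0; rewrite shift0 => ->.
by have -> : vsum (0 : 'cV[int]_n) = 0 by rewrite /vsum big1 // => i _; rewrite mxE.
Qed.

Section BasePoint.
Variable v : 'cV[C]_n.
Hypothesis vZ : nonint (beta0 - vsum v).
Local Notation s := (beta0 - vsum v).

Lemma transfer_eq0 phi e : phi (dsubmx e) = 0 -> transfer v phi e = 0.
Proof. by move=> H; rewrite /transfer H hatp0 (@dpow0 _ _ _ vZ) if_same. Qed.

Lemma transfer_neq0 phi e : transfer v phi e != 0 ->
  e = hlift (dsubmx e) /\ phi (dsubmx e) != 0.
Proof.
move=> ne; have p0 : phi (dsubmx e) != 0.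
  by apply: contraNneq ne => /transfer_eq0 ->.
split=> //; apply/eqP; move: ne; rewrite /transfer; case: ifP => // _.
by rewrite eqxx.
Qed.

Lemma transfer_linear : linear (transfer v).
Proof.
move=> a f g; apply/funext => e; rewrite -[RHS]/(a *: transfer v f e + transfer v g e).
rewrite /transfer; case: eqP => _; last by rewrite scaler0 addr0.
by rewrite -(dpow_linear vZ) -hatpP.
Qed.

Lemma transferB f g : transfer v (f - g) = transfer v f - transfer v g.
Proof. by rewrite addrC -scaleN1r transfer_linear scaleN1r addrC. Qed.

Lemma transfer_inj phi : lattice v phi -> transfer v phi = 0 -> phi = 0.
Proof.
move=> lat T0; apply/funext => e; apply/eqP; apply: contraT => /[dup] pe /lat[u eu].
move: (congr1 (fun F => F (hlift e)) T0); rewrite eu transfer_hlift => /(dpow_eq0 vZ) E.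
have p0 : phi (shift v u) = 0 by apply: hatp_inj; rewrite hatp0.
by move: pe; rewrite eu p0 eqxx.
Qed.

(** Applying d_j lowers |u| by one, so after it [transfer] uses one power of d_0 less. The extra d_0
    on the right restores it, and d_j commutes with the powers of d_0. *)
Lemma ser_d_transfer j phi : lattice v phi ->
  ser_d (rshift 1 j) (transfer v phi) = ser_d i0 (transfer v (ser_d j phi)).
Proof.
move=> lat; apply/funext => e; rewrite /ser_d /=.
(* Both sides read only this coefficient of [phi]. If it is zero both vanish; otherwise the exponent
   lies in v + Z^n. *)
have [f0|fn0] := eqVneq (phi (dsubmx e + delta_mx j 0)) 0.
  rewrite [LHS](_ : _ = 0); last first.
    by rewrite transfer_eq0 ?dsubmx_deltaS // scaler0 mderiv0 addr0.
  rewrite transfer_eq0 ?scaler0 ?mderiv0 ?addr0 // dsubmx_delta0 f0.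
  by rewrite scaler0 mderiv0 addr0.
have [u eu] := lat _ fn0.
pose u' := u - delta_mx j 0; have eu' : dsubmx e = shift v u'.
  by apply: (addIr (delta_mx j 0)); rewrite -shift_delta subrK.
rewrite /transfer !hliftP dsubmx_delta0 dsubmx_deltaS !mxE !eqxx eq_lrshift addr0.
rewrite vsumD vsum_delta opprD addrA -subr_eq opprK.
case: eqP => [e0|_]; last by rewrite !scaler0 !mderiv0.
set f := phi _; rewrite eu eu' !offset_shift.
have -> : e i0 0 + (true && true)%:R = s - (vsum u')%:~R.
  by rewrite e0 eu' vsum_shift opprD addrA.
rewrite -[RHS]diff0E -(dpowS vZ).
have Eu : vsum u' + 1 = vsum u by rewrite -(vsum_delta _ j) -vsumD subrK.
rewrite Eu hatpP (dpow_linear vZ) (mderiv_dpow vZ) mderiv_hatp.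
by [].
Qed.

Lemma dmon_transfer c phi : lattice v phi ->
  dmon c (transfer v phi) =
  iter (mdeg c) (ser_d i0) (transfer v (dmon [multinom c (rshift 1 j) | j < n] phi)).
Proof.
elim/mnm_ind: c phi => [|i c IHc] phi lat.
  rewrite dmon0 mdeg0 /=; congr transfer; rewrite (_ : [multinom _ | _ < _] = 0%MM) ?dmon0 //.
  by apply/mnmP => j; rewrite mnmE !mnm0E.
rewrite dmonD dmonU IHc // mdegD mdeg1 iterD /=.
have comm (F : logseries R (1 + n)) k : ser_d i (iter k (ser_d i0) F) = iter k (ser_d i0) (ser_d i F).
  elim: k => [|k IHk]; first by [].
  by rewrite !iterS ser_dC IHk.
rewrite comm; have [->|[j ->]] := split1P i.
  rewrite -[RHS]iterS [RHS]iterSr [in RHS](_ : [multinom _ | j < n] = [multinom c (rshift 1 j) | j < n]) //.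
  by apply/mnmP => j; rewrite !mnmE eq_lrshift.
rewrite ser_d_transfer; last exact: lattice_dmon.
rewrite -[RHS]iterS [RHS]iterSr -(dmonU j) -dmonD.
rewrite [in RHS](_ : [multinom _ | j < n] = U_(j) + [multinom c (rshift 1 j) | j < n])%MM //.
by apply/mnmP => k; rewrite mnmDE !mnmE eq_rshift.
Qed.

Lemma ser_d0_eq0 (F : logseries R (1 + n)) :
  (forall e, F e != 0 -> nonint (e i0 0)) -> ser_d i0 F = 0 -> F = 0.
Proof.
move=> FZ F0; apply/funext => e; apply/eqP; apply: contraT => Fe.
have := congr1 (fun G => G (e - delta_mx i0 0)) F0; rewrite /ser_d /= subrK.
by move=> /(diff0_eq0 (nonint_neq0 (FZ _ Fe))) E; rewrite E eqxx in Fe.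
Qed.

Lemma transfer_nonint phi e : lattice v phi -> transfer v phi e != 0 -> nonint (e i0 0).
Proof.
move=> lat /transfer_neq0[-> /lat[u]]; rewrite hliftK => ->.
by rewrite hlift0 vsum_shift opprD addrA; apply: nonintB.
Qed.

(** Only nonintegral exponents of x_0 occur, before and after derivation, so d_0 can be cancelled
    repeatedly. *)
Lemma iter_ser_d0_inj k phi psi : lattice v phi -> lattice v psi ->
  iter k (ser_d i0) (transfer v phi) = iter k (ser_d i0) (transfer v psi) -> phi = psi.
Proof.
move=> lphi lpsi; pose F := transfer v (phi - psi).
have lat := latticeB lphi lpsi.
have linD (j : nat) (f g : logseries R (1 + n)) :
    iter j (ser_d i0) (f - g) = iter j (ser_d i0) f - iter j (ser_d i0) g.
  elim: j => //= j ->; rewrite addrC -scaleN1r ser_d_linear.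
  by rewrite scaleN1r addrC.
have nonintF j e : iter j (ser_d i0) F e != 0 -> nonint (e i0 0).
  elim: j e => [|j IHj] e /=; first exact: transfer_nonint.
  rewrite /ser_d; have [->|/IHj + _] := eqVneq (iter j (ser_d i0) F (e + delta_mx i0 0)) 0.
    by rewrite scaler0 mderiv0 addr0 eqxx.
  by move=> /(nonintB 1); rewrite !mxE !eqxx addrK.
move=> E; have : iter k (ser_d i0) F = 0.
  by rewrite /F transferB linD; apply/eqP; rewrite subr_eq0; apply/eqP; exact: E.
elim: k {E} => [|k IHk] /=.
  by move=> /(transfer_inj lat)/eqP; rewrite subr_eq0 => /eqP.
by move=> /(ser_d0_eq0 (nonintF k)).
Qed.

(** A binomial of the homogenized ideal has two monomials of equal degree, so by [dmon_transfer] the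
    same power of d_0 stands on both sides. Conversely a binomial of I_A is made homogeneous with
    powers of d_0, which are then cancelled. *)
Lemma transfer_toric d (A : 'M[int]_(d, n)) phi : lattice v phi ->
  (forall a b, A *m nvec a = A *m nvec b -> dmon a phi = dmon b phi) <->
  (forall a b, rho_mx A *m nvec a = rho_mx A *m nvec b ->
    dmon a (transfer v phi) = dmon b (transfer v phi)).
Proof.
pose tail (a : 'X_{1..1 + n}) := [multinom a (rshift 1 j) | j < n].
have nvecE (a : 'X_{1..1 + n}) : nvec a = col_mx (const_mx (a i0)%:Z) (nvec (tail a)).
  apply/matrixP => i j; rewrite (ord1 j) mxE; have [->|[k ->]] := split1P i.
    by rewrite col_mxEu mxE.
  by rewrite col_mxEd mxE mnmE.
have rhoE (a b : 'X_{1..1 + n}) : rho_mx A *m nvec a = rho_mx A *m nvec b <->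
    mdeg a = mdeg b /\ A *m nvec (tail a) = A *m nvec (tail b).
  have degE (c : 'X_{1..1 + n}) : (const_mx 1 : 'M[int]_1) *m const_mx (c i0)%:Z + const_mx 1 *m nvec (tail c)
      = const_mx (mdeg c)%:Z :> 'M_1.
    apply/matrixP => i j; rewrite (ord1 i) (ord1 j) mdegE big_split_ord /= big_ord1.
    rewrite !mxE big_ord1 !mxE mul1r PoszD; congr (_ + _).
    rewrite -natz natr_sum; apply: eq_bigr => k _.
    by rewrite !mxE mul1r mnmE natz.
  rewrite !nvecE /rho_mx !mul_block_col !degE !mul0mx !add0r; split=> [|[-> ->//]].
  by move=> /eq_col_mx[/matrixP/(_ 0 0) + ->]; rewrite !mxE => -[].
move=> lat; split=> tor a b.
  move=> /rhoE[ab Aab]; rewrite (dmon_transfer a lat) (dmon_transfer b lat) ab.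
  exact: (congr1 (fun F => iter (mdeg b) (ser_d i0) (transfer v F)) (tor _ _ Aab)).
pose c (k : nat) (a : 'X_{1..n}) : 'X_{1..1 + n} :=
  [multinom (if fintype.split i is inr j then a j else k) | i < 1 + n].
have tailc k a' : tail (c k a') = a' by apply/mnmP => j; rewrite !mnmE split_rshift1.
have degc k a' : mdeg (c k a') = (k + mdeg a')%N.
  rewrite !mdegE big_split_ord /= big_ord1 mnmE split_idx0; congr (_ + _)%N.
  by apply: eq_bigr => j _; rewrite mnmE split_rshift1.
(* Padding crosswise, by d_0^|b| and d_0^|a|, brings both monomials to degree |a| + |b|. *)
move=> Aab; have := tor (c (mdeg b) a) (c (mdeg a) b).
rewrite !(dmon_transfer _ lat) -/(tail (c _ a)) -/(tail (c _ b)) !tailc !degc.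
rewrite [(mdeg b + mdeg a)%N]addnC => H.
apply: (@iter_ser_d0_inj (mdeg a + mdeg b)%N); try exact: lattice_dmon.
by apply: H; apply/rhoE; rewrite !tailc !degc addnC.
Qed.

(** The top row holds for every transferred series: its scalar part vanishes by the choice of
    [hlift], its derivative part by [sum_mderiv_hatp]. The other rows commute with [hatp] and with
    [dpow]. *)
Lemma transfer_euler d (A : 'M[int]_(d, n)) (beta : 'cV[C]_d) phi : lattice v phi ->
  (forall i e, ((map_mx intr A *m e) i 0 - beta i 0) *: phi e +
    \sum_j (A i j)%:~R *: (phi e)^`M(j) = 0) <->
  (forall i e, ((map_mx intr (rho_mx A) *m e) i 0 - rho_par beta0 beta i 0) *: transfer v phi e +
    \sum_j (rho_mx A i j)%:~R *: (transfer v phi e)^`M(j) = 0).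
Proof.
move=> lat.
have hat0 k : dpow s k (hatp (0 : {mpoly C[n]})) = 0 by rewrite hatp0 (@dpow0 _ _ _ vZ).
have rowS i (e : 'cV[C]_n) k p :
    ((map_mx intr (rho_mx A) *m hlift e) (rshift 1 i) 0 - rho_par beta0 beta (rshift 1 i) 0) *:
      dpow s k (hatp p) +
    \sum_j (rho_mx A (rshift 1 i) j)%:~R *: (dpow s k (hatp p))^`M(j) =
    dpow s k (hatp (((map_mx intr A *m e) i 0 - beta i 0) *: p + \sum_j (A i j)%:~R *: p^`M(j))).
  rewrite hatpP (dpow_linear vZ); congr (_ *: _ + _).
    congr (_ - _); last by rewrite /rho_par col_mxEd.
    by rewrite /rho_mx map_block_mx /hlift mul_block_col col_mxEd raddf0 mul0mx add0r.
  rewrite (lin_sumZ _ _ _ (@hatpP R n)) (lin_sumZ _ _ _ (dpow_linear vZ k)) big_split_ord /= big_ord1.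
  rewrite /rho_mx block_mxEdl mxE scale0r add0r; apply: eq_bigr => j _.
  by rewrite block_mxEdr (mderiv_dpow vZ) mderiv_hatp.
split=> [eul i x|eul i e]; last first.
  have [->|/[dup] pe /lat[u eu]] := eqVneq (phi e) 0.
    by rewrite scaler0 add0r big1 // => j _; rewrite mderiv0 scaler0.
  have := eul (rshift 1 i) (hlift e); rewrite {2 3}eu transfer_hlift rowS -eu.
  by move=> /(dpow_eq0 vZ) E; apply: hatp_inj; rewrite E hatp0.
have [->|/[dup] Tx /transfer_neq0[xE /lat[u eu]]] := eqVneq (transfer v phi x) 0.
  by rewrite scaler0 add0r big1 // => j _; rewrite mderiv0 scaler0.
rewrite xE eu transfer_hlift -(splitK i); case: (fintype.split i) => [j|j] /=; last first.
  by rewrite rowS eul.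
rewrite (ord1 j) [X in X *: _](_ : _ = 0) ?scale0r ?add0r; last first.
  rewrite /rho_mx map_block_mx /hlift mul_block_col /rho_par !col_mxEu !mxE big_ord1 !mxE.
  rewrite mul1r; apply/eqP; rewrite subr_eq0; apply/eqP.
  transitivity (beta0 - vsum (shift v u) + vsum (shift v u)); last by rewrite subrK.
  by congr (_ + _); apply: eq_bigr => k _; rewrite !mxE mul1r.
transitivity (dpow s (vsum u) (\sum_k 1 *: (hatp (phi (shift v u)))^`M(k))).
  rewrite (lin_sumZ _ _ _ (dpow_linear vZ (vsum u))); apply: eq_bigr => k _.
  rewrite (mderiv_dpow vZ) /rho_mx; congr (_ *: _).
  by have [->|[l ->]] := split1P k; rewrite ?block_mxEul ?block_mxEur mxE.
rewrite -[RHS](@dpow0 _ n _ vZ (vsum u)) -[in RHS](sum_mderiv_hatp (phi (shift v u))).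
by congr dpow; apply: eq_bigr => k _; rewrite scale1r.
Qed.

Lemma transfer_solution d (A : 'M[int]_(d, n)) (beta : 'cV[C]_d) phi : lattice v phi ->
  solution (hyp_ideal A beta) phi <->
  solution (hyp_ideal (rho_mx A) (rho_par beta0 beta)) (transfer v phi).
Proof.
move=> lat; rewrite !solution_hyp_ideal transfer_toric // transfer_euler //.
Qed.

End BasePoint.
End Transfer.

Section SubstitutionDegree.
Variable K : fieldType.

Lemma msizeM_pred n (p q : {mpoly K[n]}) : (msize (p * q) <= (msize p + msize q).-1)%N.
Proof.
have [->|p0] := eqVneq p 0; first by rewrite mul0r msize0.
have [->|q0] := eqVneq q 0; first by rewrite mulr0 msize0.
rewrite -!mlead_deg ?mulf_neq0 // mleadM // mdegD.
by rewrite addSn addnS.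
Qed.

(** [msize] is one more than the degree, so the bound 2 means that polynomials of degree at most one
    are substituted. *)
Lemma msize_msubst n k (h : 'I_n -> {mpoly K[k]}) p :
  (forall i, msize (h i) <= 2)%N -> (msize (msubst h p) <= msize p)%N.
Proof.
move=> h2; rewrite msubst_mmap /mmap big_seq.
elim/big_ind: _ => [|x y xp yp|m mp]; first by rewrite msize0.
  by rewrite (leq_trans (msizeD_le _ _)) // geq_max xp.
rewrite mul_mpolyC (leq_trans (msizeZ_le _ _)) //.
apply: leq_trans (msize_mdeg_lt mp); rewrite /mmap1 mdegE.
elim/big_rec2: _ => [|i e q _ qe]; first by rewrite msize1.
have hi j : (msize (h i ^+ j) <= j.+1)%N.
  elim: j => [|j IHj]; first by rewrite expr0 msize1.
  rewrite exprS (leq_trans (msizeM_pred _ _)) //.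
  by have := leq_add (h2 i) IHj; rewrite add2n; case: (_ + _)%N.
rewrite (leq_trans (msizeM_pred _ _)) //.
by have := leq_add (hi (m i)) qe; rewrite addSn addnS; case: (_ + _)%N.
Qed.

End SubstitutionDegree.

Section HatDegree.
Variables (R : realType) (n : nat).

Lemma msize_hatp (p : {mpoly R[i][n]}) : (msize (hatp p) <= msize p)%N.
Proof.
apply: msize_msubst => i; rewrite (leq_trans (msizeD_le _ _)) // msizeN !msizeX !mdeg1.
by [].
Qed.

Lemma msize_unhat (r : {mpoly R[i][1 + n]}) : (msize (unhat r) <= msize r)%N.
Proof.
apply: msize_msubst => i; case: fintype.split => j; first by rewrite msize0.
by rewrite msizeX mdeg1.
Qed.

End HatDegree.

(** * Inverse of the transfer and change of base point *)

Section TransferInverse.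
Variables (R : realType) (n : nat) (beta0 : R[i]) (v : 'cV[R[i]]_n).
Local Notation C := R[i].
Local Notation s := (beta0 - vsum v).
Hypothesis vZ : nonint s.

(** The transfer is inverted term by term, by d_0^(-|u|) starting at exponent s - |u| and then by
    [unhat]. The second hypothesis is the top Euler equation, which puts every coefficient in the
    range of [hatp]. The last two conclusions carry supports and degree bounds back to [phi]. *)
Lemma transfer_surj (psi : logseries R (1 + n)) :
  (forall x, psi x != 0 -> exists u, x = hlift beta0 (shift v u)) ->
  (forall x, \sum_i (psi x)^`M(i) = 0) ->
  exists phi : logseries R n,
    [/\ transfer beta0 v phi = psi,
      forall e, phi e != 0 -> exists2 u, e = shift v u & psi (hlift beta0 (shift v u)) != 0
      & forall e, (msize (phi e) <= msize (psi (hlift beta0 e)))%N].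
Proof.
move=> supp inv; pose phi (e : 'cV[C]_n) : {mpoly C[n]} :=
  let u := offset v e in
  if e == shift v u then
    unhat (dpow (s - (vsum u)%:~R) (- vsum u) (psi (hlift beta0 e))) else 0.
have phiE u : phi (shift v u) =
    unhat (dpow (s - (vsum u)%:~R) (- vsum u) (psi (hlift beta0 (shift v u)))).
  by rewrite /phi offset_shift eqxx.
have sZ u : nonint (s - (vsum u)%:~R) by exact: nonintB.
have lat e : phi e != 0 -> exists2 u, e = shift v u & psi (hlift beta0 (shift v u)) != 0.
  have [/eqP eu pe|ne] := boolP (e == shift v (offset v e)).
    exists (offset v e) => //; apply: contra_neq pe => p0.
    by rewrite eu phiE p0 dpow0 // unhat0.
  by rewrite /phi (negPf ne) eqxx.
exists phi; split=> // [|e].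
  apply/funext => x; have [/supp[u ->]|] := boolP (psi x != 0).
    rewrite transfer_hlift phiE hatpK ?dpowNK //.
    under eq_bigr => i _ do rewrite mderiv_dpow //.
    by rewrite -(lin_sum _ _ (dpow_linear (sZ _ u) (- vsum u))) inv dpow0.
  move=> /negPn/eqP psi0; apply/eqP; rewrite psi0; apply: contraT => Tx.
  have [xE pe] := transfer_neq0 vZ Tx; have [u eu pu] := lat _ pe.
  by rewrite -eu -xE psi0 eqxx in pu.
rewrite /phi; case: ifP => _; last by rewrite msize0.
by rewrite (leq_trans (msize_unhat _)) // msize_dpow.
Qed.

(** The power d_0^|u0| read on polynomials in t_1, ..., t_n. For |u0| = 1 it is p -> s p - sum_j
    dp/dt_j. *)
Definition rebase_op (u0 : 'cV[int]_n) (p : {mpoly C[n]}) : {mpoly C[n]} :=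
  unhat (dpow s (vsum u0) (hatp p)).

Lemma hatp_rebase u0 p : hatp (rebase_op u0 p) = dpow s (vsum u0) (hatp p).
Proof.
apply: hatpK; under eq_bigr => i _ do rewrite (mderiv_dpow vZ).
by rewrite -(lin_sum _ _ (dpow_linear vZ (vsum u0))) sum_mderiv_hatp dpow0.
Qed.

Lemma rebase_linear u0 : linear (rebase_op u0).
Proof. by move=> a p q; rewrite /rebase_op hatpP (dpow_linear vZ) unhatP. Qed.

Lemma mderiv_rebase u0 j p : (rebase_op u0 p)^`M(j) = rebase_op u0 p^`M(j).
Proof.
apply: hatp_inj; rewrite -[LHS]mderiv_hatp [in LHS]hatp_rebase [RHS]hatp_rebase.
by rewrite (mderiv_dpow vZ) mderiv_hatp.
Qed.

Lemma rebase_op0 u0 : rebase_op u0 0 = 0.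
Proof. by rewrite /rebase_op hatp0 dpow0 // unhat0. Qed.

Lemma rebase_op_eq0 u0 p : rebase_op u0 p = 0 -> p = 0.
Proof.
move=> p0; apply: hatp_inj; rewrite hatp0; apply: (dpow_eq0 vZ (k := vsum u0)).
by rewrite -hatp_rebase p0 hatp0.
Qed.

Lemma msize_rebase u0 p : (msize (rebase_op u0 p) <= msize p)%N.
Proof. by rewrite (leq_trans (msize_unhat _)) // msize_dpow // msize_hatp. Qed.

Lemma ser_d_rebase u0 i (phi : logseries R n) :
  (fun e => rebase_op u0 (ser_d i phi e)) = ser_d i (fun e => rebase_op u0 (phi e)).
Proof. by apply/funext => e; rewrite /ser_d rebase_linear mderiv_rebase. Qed.

(** One operator is applied to all coefficients, and it commutes with every d/dt_j, hence with the
    d_i and with the Euler operators. *)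
Lemma solution_rebase d (A : 'M[int]_(d, n)) beta u0 (phi : logseries R n) :
  solution (hyp_ideal A beta) phi ->
  solution (hyp_ideal A beta) (fun e => rebase_op u0 (phi e)).
Proof.
have dmonE a : dmon a (fun e => rebase_op u0 (phi e)) = fun e => rebase_op u0 (dmon a phi e).
  exact: (esym (@opm_morph _ _ _ _ (@ser_d R n) (fun f e => rebase_op u0 (f e)) a phi
    (fun i f => ser_d_rebase u0 i f))).
rewrite !solution_hyp_ideal => -[tor eul]; split=> [a b /tor ab|i e].
  rewrite (dmonE a) (dmonE b); exact: (congr1 (fun (f : logseries R n) e => rebase_op u0 (f e)) ab).
under eq_bigr => j _ do rewrite mderiv_rebase.
by rewrite -(lin_sumZ _ _ _ (rebase_linear u0)) -rebase_linear eul rebase_op0.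
Qed.

(** For u = u0 + u1 one has d_0^|u| = d_0^|u1| d_0^|u0|. The second factor goes into [rebase_op],
    the first belongs to the base point v + u0. *)
Lemma transfer_rebase u0 (phi : logseries R n) : lattice v phi ->
  transfer beta0 v phi = transfer beta0 (shift v u0) (fun e => rebase_op u0 (phi e)).
Proof.
move=> lat; have sE : beta0 - vsum (shift v u0) = s - (vsum u0)%:~R.
  by rewrite vsum_shift opprD addrA.
have v'Z : nonint (beta0 - vsum (shift v u0)) by rewrite sE; exact: nonintB.
apply/funext => x; have [p0|/lat[u xu]] := eqVneq (phi (dsubmx x)) 0.
  by rewrite !transfer_eq0 // p0 rebase_op0.
have [/eqP xE|xE] := boolP (x == hlift beta0 (dsubmx x)); last first.
  transitivity (0 : {mpoly C[1 + n]}); last apply/esym.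
    by apply/eqP; apply: contraNT xE => Tx; apply/eqP; have [] := transfer_neq0 vZ Tx.
  by apply/eqP; apply: contraNT xE => Tx; apply/eqP; have [] := transfer_neq0 v'Z Tx.
rewrite xE xu transfer_hlift.
have uE : u = u0 + (u - u0) by rewrite addrC subrK.
move: (u - u0) uE => u1 uE.
rewrite [in RHS]uE [in RHS]shiftD transfer_hlift -shiftD -uE hatp_rebase sE.
rewrite [in LHS]uE vsumD (dpowD _ _ _ vZ) -uE.
by [].
Qed.

(** The row conditions identify [hat A] with [hatp] on all coefficients, and every exponent meets at
    most one summand. *)
Lemma rho_basicE d (A : 'M[int]_(d, n)) (phi : logseries R n) : columns_generate A ->
  lattice v phi -> (forall e i, \sum_j (A i j)%:~R *: (phi e)^`M(j) = 0) ->
  rho_basic A beta0 v phi = transfer beta0 v phi.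
Proof.
move=> genA lat rows; apply/funext => x; rewrite /rho_basic.
have termE u : d0_pow (vsum u) (col_mx (const_mx s) (shift v u)) (hat A (phi (shift v u))) x =
    if x == hlift beta0 (shift v u) then transfer beta0 v phi x else 0.
  rewrite hatE // d0_powE col_mxEu mxE.
  rewrite (_ : col_mx _ _ - _ = hlift beta0 (shift v u)); last first.
    have BZE (X Y : 'cV[C]_(1 + n)) c i : (X - c *: Y) i 0 = X i 0 - c * Y i 0 by rewrite !mxE.
    apply/matrixP => i j; rewrite (ord1 j) BZE.
    have [->|[k ->]] := split1P i.
      by rewrite col_mxEu hlift0 !mxE !eqxx mulr1 vsum_shift opprD addrA.
    by rewrite col_mxEd hliftS [delta_mx _ _ _ _]mxE eq_rlshift mulr0 subr0.
  by rewrite /ser_term; case: eqP => // ->; rewrite transfer_hlift.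
under eq_fsbigr => u _ do rewrite termE.
(* At [x] the sum over a possibly infinite support has at most the single nonzero term at this
   [u]. *)
have [[u xu]|none] := pselect (exists u, x = hlift beta0 (shift v u)); last first.
  rewrite fsbig1 => [|u _]; last by case: eqP => // xu; case: none; exists u.
  apply/esym/eqP; apply: contraT => Tx; case: none.
  by have [xE /lat[u eu]] := transfer_neq0 vZ Tx; exists u; rewrite -eu.
have [p0|pn0] := eqVneq (phi (shift v u)) 0.
  have Tx : transfer beta0 v phi x = 0 by rewrite transfer_eq0 // xu hliftK.
  by rewrite fsbig1 Tx // => w _; rewrite if_same.
rewrite -(@fsbig_widen _ _ _ _ [set u]) ?fsbig_set1 ?xu ?eqxx //.
  by move=> w /= ->.
move=> w [_ /= wu]; case: eqP => // /(can_inj (hliftK beta0))/shift_inj uw.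
by case: wu.
Qed.

End TransferInverse.

(** * Exponents and cones *)

Section FallingFactorials.
Variables (R : realType) (n : nat).
Local Notation C := R[i].
Implicit Types (e y : 'cV[C]_n) (m : 'X_{1..n}) (phi : logseries R n).

(* The product of falling factorials [prod_i y_i (y_i - 1) ... (y_i - m_i + 1)] is zero. *)
Definition vanishes y m := exists i, exists2 k, (k < m i)%N & y i 0 = k%:R.

Lemma vanishes_le y m m' : (m <= m')%MM -> vanishes y m -> vanishes y m'.
Proof.
move=> /mnm_lepP mm' [i [k km yk]]; exists i, k => //; exact: leq_trans km (mm' i).
Qed.

Lemma cnvecD m m' : cnvec R (m + m')%MM = cnvec R m + cnvec R m'.
Proof. by apply/matrixP => i j; rewrite !mxE mnmDE natrD. Qed.

Lemma cnvecU (i : 'I_n) : cnvec R U_(i)%MM = delta_mx i 0.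
Proof. by apply/matrixP => j k; rewrite !mxE mnm1E (ord1 k) eqxx andbT eq_sym. Qed.

Lemma cnvec0 : cnvec R (0%MM : 'X_{1..n}) = 0.
Proof. by apply/matrixP => j k; rewrite !mxE mnm0E. Qed.

Lemma dmon_eq0 m phi e : phi (e + cnvec R m) = 0 -> dmon m phi e = 0.
Proof.
elim/mnm_ind: m e => [|i m IHm] e; first by rewrite cnvec0 addr0 dmon0.
rewrite cnvecD cnvecU addrA => /IHm H.
by rewrite dmonD dmonU /ser_d H scaler0 mderiv0 addr0.
Qed.

(** Applying d^m to x^y p multiplies the top degree part of p by a product of falling factorials of
    y. When that product is nonzero the degree in the logarithms is kept. *)
Lemma dmon_neq0 m phi e : phi (e + cnvec R m) != 0 -> ~ vanishes (e + cnvec R m) m ->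
  dmon m phi e != 0.
Proof.
elim/mnm_ind: m e => [|i m IHm] e; first by rewrite cnvec0 addr0 dmon0.
move=> pn nv; rewrite dmonD dmonU /ser_d.
have eE : e + cnvec R (U_(i) + m)%MM = e + delta_mx i 0 + cnvec R m.
  by rewrite cnvecD cnvecU addrA.
have gn : dmon m phi (e + delta_mx i 0) != 0.
  apply: IHm; rewrite -eE // => H; apply: nv; apply: vanishes_le H; exact: lem_addl.
apply: contraNneq gn => /scale_add_eq0 -> //; last exact: msize_mderiv.
apply/eqP => ei0; apply: nv; exists i, (m i); first by rewrite mnmDE mnm1E eqxx.
by rewrite eE mxE ei0 add0r mxE.
Qed.

Lemma dmon_term m y : vanishes y m -> dmon m (ser_term y 1) = 0.
Proof.
(* Here [c] is the product of falling factorials of y, of which the induction records only its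
   vanishing. *)
move=> ym; have [c [-> /(_ ym) ->]] : exists c,
    dmon m (ser_term y 1) = ser_term (y - cnvec R m) c%:MP /\ (vanishes y m -> c = 0).
  elim/mnm_ind: m {ym} => [|i m [c [IHm c0]]].
    exists 1; rewrite cnvec0 subr0 dmon0; split=> // -[i [k]].
    by rewrite mnm0E.
  exists (c * (y i 0 - (m i)%:R)); rewrite dmonD dmonU IHm; split.
    apply/funext => e; rewrite /ser_d /ser_term cnvecD cnvecU opprD addrCA [in RHS]addrC.
    rewrite -[in RHS](inj_eq (addIr (delta_mx i 0))) subrK.
    case: eqP => [->|_]; last by rewrite scaler0 mderiv0 addr0.
    by rewrite mderivC addr0 -mul_mpolyC -mpolyCM mulrC !mxE.
  move=> [j [k km yk]]; have [kj|mk] := ltnP k (m j).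
    by rewrite c0 ?mul0r //; exists j, k.
  move: km; rewrite mnmDE mnm1E; case: eqP => [->|_]; last by rewrite ltnNge mk.
  rewrite add1n ltnS => km; have -> : m j = k by apply/eqP; rewrite eqn_leq mk km.
  by rewrite yk subrr mulr0.
by apply/funext => e; rewrite /ser_term mpolyC0 if_same.
Qed.

End FallingFactorials.

(** * Open cones and their duals *)

Section Cones.
Variable R : realType.

Lemma small_positive m (a b : 'I_m -> R) : (forall i, 0 < a i) ->
  exists2 eps, 0 < eps & forall i, 0 < a i - eps * b i.
Proof.
(* With S = sum_i |b_i| / a_i, the choice eps = 1 / (1 + S) gives eps |b_i| < a_i for every i. *)
move=> a0; pose S := \sum_i `|b i| / a i.
have S0 : 0 <= S by apply: sumr_ge0 => i _; rewrite divr_ge0 // ltW.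
have S1 : 0 < 1 + S by rewrite ltr_wpDr.
exists (1 + S)^-1; first by rewrite invr_gt0.
move=> i; rewrite subr_gt0 (le_lt_trans (ler_norm _)) // normrM.
rewrite gtr0_norm ?invr_gt0 // mulrC ltr_pdivrMr // mulrC -ltr_pdivrMr //.
apply: le_lt_trans (_ : S < _); last by rewrite ltrDr.
rewrite /S (bigD1 i) //= lerDl; apply: sumr_ge0 => j _.
by rewrite divr_ge0 // ltW.
Qed.

Lemma dotBr n (u x y : 'cV[R]_n) c : dot u (x - c *: y) = dot u x - c * dot u y.
Proof.
rewrite /dot mulr_sumr -sumrB; apply: eq_bigr => i _.
by rewrite !mxE mulrBr mulrCA.
Qed.

Lemma dot_self_gt0 n (u : 'cV[R]_n) : u != 0 -> 0 < dot u u.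
Proof.
move=> u0; rewrite lt_neqAle sumr_ge0 ?andbT; last by move=> i _; rewrite -expr2 sqr_ge0.
apply: contraNneq u0 => /esym/eqP; rewrite psumr_eq0; last by move=> i _; rewrite -expr2 sqr_ge0.
move=> /allP s0; apply/eqP/matrixP => i j; rewrite (ord1 j) mxE.
by have := s0 i (mem_index_enum _); rewrite mulf_eq0 orbb => /eqP.
Qed.

Lemma cone_open n (Cn : set 'cV[R]_n) w u : strongly_convex_open_rational_cone Cn -> Cn w ->
  exists2 eps, 0 < eps & Cn (w - eps *: u).
Proof.
move=> [m [B [-> _]]] /= Bw.
have [eps eps0 H] := small_positive (fun i => (map_mx ratr B *m u) i 0) Bw.
by exists eps => // i; rewrite mulmxBr -scalemxAr [X in _ < X]mxE [X in _ + X]mxE [X in - X]mxE.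
Qed.

(** The cone is open, so it contains w - eps u for some eps > 0. Pairing this with u gives u.w >=
    eps u.u. *)
Lemma dual_cone_gt0 n (Cn : set 'cV[R]_n) w u : strongly_convex_open_rational_cone Cn ->
  Cn w -> dual_cone Cn u -> u = 0 \/ 0 < dot u w.
Proof.
move=> Cc Cw Du; have [->|u0] := eqVneq u 0; [by left|right].
have [eps eps0 /Du] := cone_open u Cc Cw.
rewrite dotBr subr_ge0; apply: lt_le_trans; rewrite mulr_gt0 //.
exact: dot_self_gt0.
Qed.

(** Strong convexity is inherited from the first cone, so the matrix [Q] may have a kernel. *)
Lemma cone_preimage n k (Cn : set 'cV[R]_n) (Ck : set 'cV[R]_k) (Q : 'M[rat]_(k, n)) :
  strongly_convex_open_rational_cone Cn -> strongly_convex_open_rational_cone Ck ->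
  strongly_convex_open_rational_cone (Cn `&` [set y | Ck (map_mx ratr Q *m y)]).
Proof.
move=> [m [B [-> Bc]]] [l [D [-> _]]]; exists (m + l)%N, (col_mx B (D *m Q)).
have colE (y : 'cV[R]_n) : map_mx ratr (col_mx B (D *m Q)) *m y =
    col_mx (map_mx ratr B *m y) (map_mx ratr D *m (map_mx ratr Q *m y)).
  by rewrite map_col_mx mul_col_mx map_mxM mulmxA.
split=> [|y /= y1 y2].
  apply/seteqP; split=> y /=.
    move=> [By Dy] i; rewrite colE -(splitK i).
    by case: (fintype.split i) => j /=; rewrite ?col_mxEu ?col_mxEd.
  move=> H; split=> i; first by have := H (lshift l i); rewrite colE col_mxEu.
  by have := H (rshift m i); rewrite colE col_mxEd.
apply: Bc => i; first by have := y1 (lshift l i); rewrite colE col_mxEu.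
by have := y2 (lshift l i); rewrite colE col_mxEu.
Qed.

End Cones.

Section NilssonStructure.
Variables (R : realType) (d n : nat).
Local Notation C := R[i].
Implicit Types (A : 'M[int]_(d, n)) (beta : 'cV[C]_d) (w : 'cV[R]_n).
Implicit Types (v : 'cV[C]_n) (phi : logseries R n).

Definition above A w v v' :=
  exists u, [/\ v' = shift v u, kerZ A u & 0 < dot (map_mx intr u) w].

(** What leading-term arguments retain of the cone condition: every exponent other than v has
    strictly larger weight. *)
Definition pointed A w v phi := forall e, phi e != 0 -> e = v \/ above A w v e.

Lemma map_intr_eq0 (u : 'cV[int]_n) : map_mx intr u = 0 :> 'cV[R]_n -> u = 0.
Proof.
move=> /matrixP u0; apply/matrixP => i j; have := u0 i j; rewrite !mxE => /eqP.
by rewrite intr_eq0 => /eqP.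
Qed.

Lemma basic_pointed A beta w v phi : basic_nilsson A beta w v phi -> pointed A w v phi.
Proof.
move=> [_ [Cn [S [[Cc Cw _ _] SD supp]]] _ _] e /supp[u /SD[Du Au] <-].
have [/map_intr_eq0 ->|uw] := dual_cone_gt0 Cc Cw Du; first by left; rewrite shift0.
by right; exists u.
Qed.

Lemma pointed_lattice A w v phi : pointed A w v phi -> lattice v phi.
Proof.
by move=> H e /H[->|[u [-> _ _]]]; [exists 0; rewrite shift0|exists u].
Qed.

Lemma above_trans A w v1 v2 v3 : above A w v1 v2 -> above A w v2 v3 -> above A w v1 v3.
Proof.
move=> [u [-> Au uw]] [u' [-> Au' uw']]; exists (u + u'); rewrite shiftD; split=> //.
  by rewrite /kerZ /= mulmxDr Au Au' addr0.
rewrite (_ : dot _ w = dot (map_mx intr u) w + dot (map_mx intr u') w) ?addr_gt0 //.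
by rewrite /dot -big_split; apply: eq_bigr => i _; rewrite !mxE rmorphD mulrDl.
Qed.

Lemma above_irrefl A w v : ~ above A w v v.
Proof.
move=> [u [vu _]]; have -> : u = 0 by apply: (@shift_inj _ _ v); rewrite shift0.
by rewrite /dot big1 ?ltxx // => i _; rewrite !mxE mul0r.
Qed.

(** A scalar multiple plus a degree-lowering operator can kill a nonzero polynomial only if the
    scalar is zero. The two parts of each Euler equation thus vanish separately. *)
Lemma solution_euler A beta phi : solution (hyp_ideal A beta) phi ->
  (forall e, phi e != 0 -> map_mx intr A *m e = beta) /\
  (forall e i, \sum_j (A i j)%:~R *: (phi e)^`M(j) = 0).
Proof.
rewrite solution_hyp_ideal => -[_ eul].
have A0 e : phi e != 0 -> map_mx intr A *m e = beta.
  move=> pe; apply/matrixP => i j; rewrite (ord1 j); apply/eqP; rewrite -subr_eq0.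
  apply: contraNT pe => c0; apply/eqP; apply: scale_add_eq0 c0 _ (eul i e).
  exact: msize_sum_mderiv.
split=> // e i; have [->|pe] := eqVneq (phi e) 0.
  by rewrite big1 // => j _; rewrite mderiv0 scaler0.
by have := eul i e; rewrite (A0 e pe) subrr scale0r add0r.
Qed.

Lemma toric_dact A beta phi f : solution (hyp_ideal A beta) phi -> toric_ideal A f ->
  dact f phi = 0.
Proof. by move=> /solution_ideal_with_euler[H _]; exact: H. Qed.

(** The indicial equations imposed monomial by monomial on each initial form, so that no appeal to
    the monomiality of in_w(I_A) is made. *)
Definition kills_initials A w v := forall f : {mpoly C[n]}, toric_ideal A f ->
  forall m, m \in msupp f -> {in msupp f, forall m', wt_poly w m' <= wt_poly w m} ->
  vanishes v m.

Lemma dot_nvecB w (m m' : 'X_{1..n}) :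
  dot (map_mx intr (nvec m' - nvec m)) w = wt_poly w m' - wt_poly w m.
Proof.
rewrite /dot /wt_poly -sumrB; apply: eq_bigr => i _.
by rewrite !mxE rmorphB /= mulrBl ![w i 0 * _]mulrC.
Qed.

Lemma cnvec_shift v (m m' : 'X_{1..n}) :
  v - cnvec R m + cnvec R m' = shift v (nvec m' - nvec m).
Proof.
apply/matrixP => i j; rewrite !mxE rmorphB /= -addrA; congr (_ + _).
by rewrite addrC.
Qed.

(* The coefficient of [x^(v-m)] in [f(d) phi] only sees [f_m d^m (x^v p_0)]. *)
Lemma pointed_kills A beta w v phi : solution (hyp_ideal A beta) phi -> pointed A w v phi ->
  phi v != 0 -> kills_initials A w v.
Proof.
move=> sol pt pv f If m mf mmax; apply: contrapT => nv.
have := congr1 (fun g : logseries R n => g (v - cnvec R m)) (toric_dact sol If).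
rewrite /dact /mlin fct_sumE (bigD1_seq m) ?msupp_uniq //= big1_seq ?addr0 => [|m' /andP[m'm m'f]].
  move=> E; have /eqP : f@_m *: dmon m phi (v - cnvec R m) = 0 by exact: E.
  rewrite scaler_eq0 mcoeff_eq0 mf /=; apply/negP.
  by apply: dmon_neq0; rewrite subrK.
rewrite -[(_ *: _) _]/(f@_m' *: dmon m' phi (v - cnvec R m)) dmon_eq0 ?scaler0 //.
apply/eqP; apply: contraT => /pt; rewrite cnvec_shift => -[|[u [/shift_inj <- _]]].
  rewrite -[X in _ = X]shift0 => /shift_inj/matrixP E; move: m'm; apply: contraNT => _.
  apply/eqP/mnmP => i; have := E i 0; rewrite !mxE => /eqP; rewrite subr_eq0 => /eqP.
  by case.
by rewrite dot_nvecB subr_gt0 ltNge mmax.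
Qed.

End NilssonStructure.

(** * Initial ideals *)

Section LeftIdeals.

Lemma left_ideal_genP (T : zmodType) (mul : T -> T -> T) (S : set T) :
  left_ideal mul (left_ideal_gen mul S).
Proof.
split=> [J [[J0 _ _] _]|f g If Ig J HJ|p f If J HJ]; first exact: J0.
  have [[_ JD _] _] := HJ; exact: JD (If J HJ) (Ig J HJ).
have [[_ _ JM] _] := HJ; exact: JM (If J HJ).
Qed.

Lemma left_ideal_scale (K : comNzRingType) n J (c : K) (f : {mpoly K[n]}) :
  left_ideal *%R J -> J f -> J (c *: f).
Proof. by move=> [_ _ JM] Jf; rewrite -mul_mpolyC; exact: JM. Qed.

End LeftIdeals.

Section InitialForms.
Variables (K : comNzRingType) (R : realType) (n : nat).
Implicit Types (f g p : {mpoly K[n]}) (w : 'cV[R]_n) (J : set {mpoly K[n]}).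

Lemma mcoeff_init_form (wt : 'X_{1..n} -> R) f m :
  (init_form wt f)@_m =
  if all (fun m' => wt m' <= wt m) (msupp f) then f@_m else 0.
Proof.
rewrite /init_form raddf_sum /=.
transitivity (\sum_(m' <- msupp f) (if (m' == m) && all (fun m' => wt m' <= wt m) (msupp f)
    then f@_m else 0)).
  rewrite big_mkcond; apply: eq_bigr => m' _; rewrite mcoeffZ mcoeffX.
  case: eqP => [->|_]; first by rewrite mulr1.
  by rewrite mulr0 if_same.
case: (boolP (m \in msupp f)) => [mf|mf].
  rewrite (bigD1_seq m) ?msupp_uniq //= eqxx big1 ?addr0 // => m' /negPf ->.
  by [].
rewrite big1_seq; first by rewrite (memN_msupp_eq0 mf) if_same.
by move=> m' /andP[_ m'f]; case: eqP => // m'm; rewrite -m'm m'f in mf.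
Qed.

Lemma in_poly_init w J f : J f -> f != 0 -> in_poly w J (init_form (wt_poly w) f).
Proof. by move=> Jf f0; apply: sub_gen_smallest; exists f. Qed.

Definition graded_part w (t : R) : {mpoly K[n]} -> {mpoly K[n]} :=
  mlin (fun m => if wt_poly w m == t then 'X_[m] else 0).

Lemma mcoeff_graded_part w t f m :
  (graded_part w t f)@_m = if wt_poly w m == t then f@_m else 0.
Proof.
rewrite /graded_part /mlin raddf_sum /=.
transitivity (\sum_(m' <- msupp f) (if (m' == m) && (wt_poly w m == t) then f@_m else 0)).
  apply: eq_bigr => m' _; rewrite mcoeffZ; case: (m' =P m) => [->|mm] /=.
    by case: ifP => _; rewrite ?mcoeffX ?eqxx ?mulr1 // mcoeff0 mulr0.
  by case: ifP => _; rewrite ?mcoeff0 ?mulr0 // mcoeffX; case: eqP mm; rewrite ?mulr0.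
case: (boolP (m \in msupp f)) => [mf|mf].
  rewrite (bigD1_seq m) ?msupp_uniq //= eqxx big1 ?addr0 // => m' /negPf ->.
  by [].
rewrite big1_seq; first by rewrite (memN_msupp_eq0 mf) if_same.
by move=> m' /andP[_ m'f]; case: eqP => // m'm; rewrite -m'm m'f in mf.
Qed.

Lemma wt_polyD w (a b : 'X_{1..n}) : wt_poly w (a + b)%MM = wt_poly w a + wt_poly w b.
Proof.
rewrite /wt_poly -big_split; apply: eq_bigr => i _.
by rewrite mnmDE natrD mulrDr.
Qed.

Lemma graded_part_mulX w t a f :
  graded_part w t ('X_[a] * f) = 'X_[a] * graded_part w (t - wt_poly w a) f.
Proof.
rewrite /graded_part mlin_mulX.
have lX : linear ( *%R ('X_[a] : {mpoly K[n]})).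
  by move=> c x y; rewrite mulrDr scalerAr.
rewrite -(mlin_morph _ _ lX); apply: eq_mlin => m _.
have -> : (wt_poly w m == t - wt_poly w a) = (wt_poly w (a + m)%MM == t).
  by rewrite wt_polyD eq_sym subr_eq eq_sym addrC.
by case: ifP; rewrite ?mpolyXD ?mulr0.
Qed.

(** The ideal is generated by homogeneous elements: a graded part of an initial form is the form
    itself or zero. *)
Lemma in_poly_graded w J t f : in_poly w J f -> in_poly w J (graded_part w t f).
Proof.
have JI : left_ideal *%R (in_poly w J) by exact: left_ideal_genP.
have [J0 JD JM] := JI.
(* All weights are treated at once because multiplication by a monomial shifts the weight. *)
suff H : in_poly w J `<=` [set f | forall t, in_poly w J (graded_part w t f)] by move=> /H/(_ t).
apply: smallest_sub => [|_ [g [Jg g0] <-] s].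
  split=> [s|g h Hg Hh s|p g Hg s]; rewrite /= /graded_part ?linear0 ?linearD //.
    by apply: JD; [exact: Hg|exact: Hh].
  rewrite {1}[p]mpolyE mulr_suml linear_sum; elim/big_ind: _ => [|x y|a _]; [exact: J0|exact: JD|].
  rewrite -scalerAl linearZ /= -/(graded_part w s _) graded_part_mulX.
  by apply: (left_ideal_scale _ JI); apply: JM; exact: Hg.
have [[m ms mf]|none] := pselect (exists2 m, wt_poly w m = s & m \in msupp (init_form (wt_poly w) g)).
  suff -> : graded_part w s (init_form (wt_poly w) g) = init_form (wt_poly w) g.
    exact: in_poly_init.
  apply/mpolyP => m'; rewrite mcoeff_graded_part; case: eqP => // ns; apply/esym.
  rewrite mcoeff_init_form; case: allP => // mx; apply: contra_notP ns => gm'.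
  move: mf; rewrite mcoeff_msupp mcoeff_init_form; case: allP => [mx'|]; last by rewrite eqxx.
  rewrite -mcoeff_msupp -ms => mg; apply/eqP; rewrite eq_le mx // mx' //.
  by rewrite mcoeff_msupp; apply/eqP => /gm'.
suff -> : graded_part w s (init_form (wt_poly w) g) = 0 by exact: J0.
apply/mpolyP => m; rewrite mcoeff_graded_part mcoeff0; case: eqP => // ms.
apply/eqP; apply: contraT => mf; case: none; exists m => //.
by rewrite mcoeff_msupp.
Qed.

(* Two monomials of [f] are separated by some weight in the cone, and the graded parts of
   [f] for that weight have fewer monomials. *)
Lemma in_poly_monomial (Cn : set 'cV[R]_n) w J f m :
  strongly_convex_open_rational_cone Cn -> Cn w ->
  (forall w', Cn w' -> in_poly w J = in_poly w' J) ->
  in_poly w J f -> m \in msupp f -> in_poly w J (f@_m *: 'X_[m]).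
Proof.
move=> Cc Cw Cin.
elim: {f}(size (msupp f)).+1 {-2}f (ltnSn (size (msupp f))) => // k IHk f fk Jf mf.
have [[m' m'f m'm]|none] := pselect (exists2 m', m' \in msupp f & m' != m); last first.
  suff <- : f = f@_m *: 'X_[m] by [].
  rewrite {1}[f]mpolyE (bigD1_seq m) ?msupp_uniq //= big1_seq ?addr0 // => m' /andP[m'm m'f].
  by case: none; exists m'.
have [w' Cw' sep] : exists2 w', Cn w' & wt_poly w' m' != wt_poly w' m.
  have [e|?] := eqVneq (wt_poly w m') (wt_poly w m); last by exists w.
  pose u : 'cV[R]_n := map_mx intr (nvec m' - nvec m).
  have [eps eps0 Cw'] := cone_open u Cc Cw; exists (w - eps *: u) => //.
  rewrite -subr_eq0 -dot_nvecB dotBr dot_nvecB e subrr sub0r oppr_eq0.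
  rewrite mulf_neq0 ?gt_eqF // dot_self_gt0 //; apply: contraNneq m'm.
  move=> /map_intr_eq0/matrixP E; apply/eqP/mnmP => i.
  by have := E i 0; rewrite !mxE => /eqP; rewrite subr_eq0 => /eqP[].
have mg : (graded_part w' (wt_poly w' m) f)@_m = f@_m by rewrite mcoeff_graded_part eqxx.
rewrite -mg; apply: IHk; last first.
- by rewrite mcoeff_msupp mg -mcoeff_msupp.
- by rewrite (Cin _ Cw'); apply: in_poly_graded; rewrite -(Cin _ Cw').
apply: (@leq_ltn_trans (size (rem m' (msupp f)))); last first.
  by rewrite size_rem //; move: fk m'f; case: (msupp f).
apply: uniq_leq_size; first exact: msupp_uniq.
move=> a; rewrite mcoeff_msupp mcoeff_graded_part.
case: ifP => [/eqP am|_]; last by rewrite eqxx.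
rewrite mem_rem_uniq ?msupp_uniq // inE -mcoeff_msupp => ->; rewrite andbT.
by apply: contraNneq sep => <-; rewrite am.
Qed.

End InitialForms.

Section FakeExponents.
Variables (R : realType) (d n : nat).
Local Notation C := R[i].
Implicit Types (A : 'M[int]_(d, n)) (beta : 'cV[C]_d) (w : 'cV[R]_n) (v : 'cV[C]_n).

(** Monomials vanishing at v are closed under multiples, so the polynomials supported on them form
    an ideal. *)
Lemma kills_in_poly A w v (g : {mpoly C[n]}) : kills_initials A w v ->
  in_poly w (toric_ideal A) g -> {in msupp g, forall m, vanishes v m}.
Proof.
move=> kills; suff H : in_poly w (@toric_ideal R d n A) `<=`
  [set g | {in msupp g, forall m, vanishes v m}] by move=> /H.
apply: smallest_sub => [|_ [f [If f0] <-] m].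
  split=> [m|f h Hf Hh m /msuppD_le|p f Hf m /msuppM_le/allpairsP[[a b] /= [ap bf ->]]].
  - by rewrite msupp0.
  - by rewrite mem_cat => /orP[/Hf|/Hh].
  - by apply: vanishes_le (Hf b bf); exact: lem_addl.
rewrite mcoeff_msupp mcoeff_init_form; case: allP => [mx|]; last by rewrite eqxx.
by rewrite -mcoeff_msupp => mf; exact: (kills f If m mf mx).
Qed.

Lemma kills_fake_exponent A beta w v : kills_initials A w v ->
  map_mx intr A *m v = beta -> fake_exponent A beta w v.
Proof.
move=> kills Av; rewrite /fake_exponent solution_ideal_with_euler; split=> [q Jq|i e].
  rewrite /dact /mlin big1_seq // => m /andP[_ mq].
  by rewrite dmon_term ?scaler0 //; exact: (kills_in_poly kills Jq mq).
rewrite /ser_term; case: eqP => [->|_].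
  rewrite Av subrr scale0r add0r big1 // => j _.
  by rewrite -mpolyC1 mderivC scaler0.
by rewrite scaler0 add0r big1 // => j _; rewrite mderiv0 scaler0.
Qed.

(** Exponents of basic Nilsson solutions are fake exponents, to which the condition on [beta0]
    applies. *)
Lemma nonint_exponent A beta w (beta0 : C) v phi : homogenizing_value A beta w beta0 ->
  basic_nilsson A beta w v phi -> nonint (beta0 - vsum v).
Proof.
move=> [_ hom] bas; have [sol _ _ pv] := bas; apply: hom; apply: kills_fake_exponent.
  exact: pointed_kills sol (basic_pointed bas) pv.
by have [+ _] := solution_euler sol; apply.
Qed.

End FakeExponents.

Section HomogenizedMonomials.
Variables (R : realType) (d n : nat).
Local Notation C := R[i].
Implicit Types (A : 'M[int]_(d, n)) (w : 'cV[R]_n).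

(** Padding by the variable of index 0 to total degree N. The subtraction is truncated, so this is a
    homogenization only when |m| <= N. *)
Definition hmon (N : nat) (m : 'X_{1..n}) : 'X_{1..1 + n} :=
  [multinom (if fintype.split i is inr j then m j else (N - mdeg m)%N) | i < 1 + n].

(** A degree N fixed in advance, rather than the degree of [f], keeps homogenization linear. *)
Definition hompoly N (f : {mpoly C[n]}) : {mpoly C[1 + n]} :=
  mlin (fun m => 'X_[hmon N m]) f.

Lemma hmon0 N m : hmon N m (idx0 n) = (N - mdeg m)%N.
Proof. by rewrite mnmE split_idx0. Qed.

Lemma hmonS N m j : hmon N m (rshift 1 j) = m j.
Proof. by rewrite mnmE split_rshift1. Qed.

Lemma hmon_inj N : injective (hmon N).
Proof. by move=> m m' E; apply/mnmP => j; rewrite -(hmonS N) E hmonS. Qed.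

Lemma mcoeff_hompoly N f m : (hompoly N f)@_(hmon N m) = f@_m.
Proof.
rewrite /hompoly /mlin raddf_sum /=.
transitivity (\sum_(m' <- msupp f) (if m' == m then f@_m else 0)).
  apply: eq_bigr => m' _; rewrite mcoeffZ mcoeffX (inj_eq (@hmon_inj N)).
  by case: eqP => [->|_]; rewrite ?mulr1 ?mulr0.
case: (boolP (m \in msupp f)) => [mf|mf].
  by rewrite (bigD1_seq m) ?msupp_uniq //= eqxx big1 ?addr0 // => m' /negPf ->.
rewrite big1_seq; first by rewrite (memN_msupp_eq0 mf).
by move=> m' /andP[_ m'f]; case: eqP => // m'm; rewrite -m'm m'f in mf.
Qed.

Lemma msupp_hompoly N f a : a \in msupp (hompoly N f) ->
  exists2 m, m \in msupp f & a = hmon N m.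
Proof.
rewrite mcoeff_msupp /hompoly /mlin raddf_sum /= => an.
suff /hasP[m mf /eqP ->] : has (fun m => a == hmon N m) (msupp f) by exists m.
apply: contraNT an => /hasPn none; rewrite big1_seq // => m /andP[_ mf].
by rewrite mcoeffZ mcoeffX eq_sym (negPf (none m mf)) mulr0.
Qed.

Lemma wt_hmon N w m : wt_poly (rho_wt w) (hmon N m) = wt_poly w m.
Proof.
rewrite /wt_poly big_split_ord /= big_ord1 /rho_wt col_mxEu mxE mul0r add0r.
by apply: eq_bigr => j _; rewrite col_mxEd hmonS.
Qed.

Lemma rho_hmon A N m : (mdeg m <= N)%N ->
  rho_mx A *m nvec (hmon N m) = col_mx (const_mx N%:Z) (A *m nvec m).
Proof.
move=> mN; have -> : nvec (hmon N m) = col_mx (const_mx (N - mdeg m)%N%:Z) (nvec m).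
  apply/matrixP => i j; rewrite (ord1 j) mxE; have [->|[k ->]] := split1P i.
    by rewrite col_mxEu mxE hmon0.
  by rewrite col_mxEd mxE hmonS.
rewrite /rho_mx mul_block_col mul0mx add0r; congr col_mx.
apply/matrixP => i j; rewrite !mxE big_ord1 !mxE mul1r -[N in RHS](subnK mN) PoszD.
congr (_ + _); rewrite mdegE -natz natr_sum; apply: eq_bigr => k _.
by rewrite !mxE mul1r natz.
Qed.

(** Asking for all large N makes the property stable under sums and multiples, so it only has to be
    checked on binomials. *)
Lemma hompoly_toric A f : toric_ideal A f ->
  exists N0, forall N, (N0 <= N)%N -> @toric_ideal R _ _ (rho_mx A) (hompoly N f).
Proof.
have rI : left_ideal *%R (@toric_ideal R _ _ (rho_mx A)) by exact: left_ideal_genP.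
have [I0 ID IM] := rI.
suff H : @toric_ideal R d n A `<=` [set f | exists N0, forall N, (N0 <= N)%N ->
  @toric_ideal R _ _ (rho_mx A) (hompoly N f)] by move=> /H.
apply: smallest_sub => [|_ [a [b [Aab ->]]]].
  split=> [|f1 f2 [N1 H1] [N2 H2]|p g [N0 Hg]].
  - by exists 0%N => N _; rewrite /hompoly linear0.
  - exists (maxn N1 N2) => N; rewrite geq_max => /andP[l1 l2].
    by rewrite /hompoly linearD; apply: ID; [exact: H1|exact: H2].
  (* For every monomial a of p this leaves N - |a| >= N0, the degree in which the other factor is
     homogenized. *)
  - exists (N0 + msize p)%N => N le; rewrite /hompoly {1}[p]mpolyE mulr_suml linear_sum.
    rewrite big_seq; elim/big_ind: _ => [|x y|a ap]; [exact: I0|exact: ID|].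
    rewrite -scalerAl linearZ; apply: (left_ideal_scale _ rI) => /=.
    have aN : (N0 <= N - mdeg a)%N.
      rewrite leq_subRL; last first.
        by rewrite (leq_trans _ le) // (leq_trans (ltnW (msize_mdeg_lt ap))) // leq_addl.
      by rewrite addnC (leq_trans _ le) // leq_add2l ltnW // msize_mdeg_lt.
    have lX : linear ( *%R ('X_[hmon (mdeg a) a] : {mpoly C[1 + n]})).
      by move=> c x y; rewrite mulrDr scalerAr.
    rewrite mlin_mulX (eq_mlin (G := fun m => 'X_[hmon (mdeg a) a] * 'X_[hmon (N - mdeg a) m])).
      by rewrite (mlin_morph _ _ lX); apply: IM; exact: Hg.
    move=> m _; rewrite -mpolyXD; congr mpolyX; apply/mnmP => i; rewrite mnmDE.
    have [->|[j ->]] := split1P i; first by rewrite !hmon0 mdegD subnn add0n subnDA.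
    by rewrite !hmonS mnmDE.
exists (maxn (mdeg a) (mdeg b)) => N; rewrite geq_max => /andP[aN bN].
rewrite /hompoly linearB /= !mlinX; apply: sub_gen_smallest.
by exists (hmon N a), (hmon N b); rewrite !rho_hmon // Aab.
Qed.

End HomogenizedMonomials.

(** * Standard pairs *)

Section Zariski.
Variables (R : realType) (n : nat).
Local Notation C := R[i].
Implicit Types (Y : set 'cV[C]_n) (f : {mpoly C[n]}).
Local Notation eval f y := (f.@[fun i => y i 0]).

Lemma poly_nat_roots (p : {poly C}) : (forall k : nat, p.[k%:R] = 0) -> p = 0.
Proof.
move=> p0; apply: (@roots_geq_poly_eq0 _ p [seq k%:R | k <- iota 0 (size p)]).
- by apply/allP => _ /mapP[k _ ->]; apply/eqP.
- by rewrite map_inj_uniq ?iota_uniq // => a b /eqP; rewrite eqr_nat => /eqP.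
- by rewrite size_map size_iota.
Qed.

(** The restriction of f to the polynomial curve t -> h(t). *)
Definition along (h : 'I_n -> {poly C}) f : {poly C} := mmap (@polyC C) h f.

Lemma along_eval h f t : (along h f).[t] = f.@[fun i => (h i).[t]].
Proof.
rewrite -[LHS]/(horner_eval t (mmap _ _ _)) mmap_morph /meval.
by apply: mmap_ext => // c; exact: hornerC.
Qed.

Lemma zeros_closed f : zariski_closed [set y : 'cV[C]_n | eval f y = 0].
Proof.
exists [set f]; apply/seteqP; split=> y /=; first by move=> fy g ->.
by move=> H; apply: H.
Qed.

Lemma irreducible_prod Y (I : Type) (r : seq I) (F : I -> {mpoly C[n]}) :
  zariski_irreducible Y -> (forall y, Y y -> eval (\prod_(i <- r) F i) y = 0) ->
  exists i, forall y, Y y -> eval (F i) y = 0.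
Proof.
move=> [[y0 Yy0] irr]; elim: r => [/(_ y0 Yy0)|i r IHr].
  by rewrite big_nil meval1 => /eqP; rewrite oner_eq0.
rewrite big_cons => H.
case: (irr _ _ (zeros_closed (F i)) (zeros_closed (\prod_(i <- r) F i))).
- move=> y /H; rewrite mevalM => /eqP; rewrite mulf_eq0.
  by move=> /orP[]/eqP; [left|right].
- by exists i.
- by move=> /IHr.
Qed.

(** If f1 and f2 are nonzero at points y1 and y2, neither vanishes identically on the line through
    these points. Their product would have every natural number as a root along that line. *)
Lemma coord_affine_irreducible (alpha : 'X_{1..n}) sigma :
  zariski_irreducible (@coord_affine R n alpha sigma).
Proof.
split; first by exists (cnvec R alpha) => i _; rewrite mxE.
move=> _ _ [F1 ->] [F2 ->] sub.
have [|/existsNP[y1 /not_implyP[Y1 /existsNP[f1 /not_implyP[F1f f1y]]]]] := pselect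
  (forall y, coord_affine alpha sigma y -> forall f, F1 f -> eval f y = 0); first by left.
have [|/existsNP[y2 /not_implyP[Y2 /existsNP[f2 /not_implyP[F2f f2y]]]]] := pselect
  (forall y, coord_affine alpha sigma y -> forall f, F2 f -> eval f y = 0); first by right.
pose h i : {poly C} := (y1 i 0)%:P + (y2 i 0 - y1 i 0)%:P * 'X.
have hE t i : (h i).[t] = y1 i 0 + (y2 i 0 - y1 i 0) * t.
  by rewrite hornerD hornerM !hornerC hornerX.
have g1 : along h f1 != 0.
  apply/eqP => g0; apply: f1y; have := along_eval h f1 0; rewrite g0 horner0 => ->.
  by apply: meval_eq => i; rewrite hE mulr0 addr0.
have g2 : along h f2 != 0.
  apply/eqP => g0; apply: f2y; have := along_eval h f2 1; rewrite g0 horner0 => ->.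
  by apply: meval_eq => i; rewrite hE mulr1 addrC subrK.
suff /eqP : along h f1 * along h f2 = 0 by rewrite mulf_eq0 (negPf g1) (negPf g2).
apply: poly_nat_roots => k; rewrite hornerM !along_eval.
pose y : 'cV[C]_n := \col_i (h i).[k%:R].
have yE f : f.@[fun i => (h i).[k%:R]] = eval f y by apply: meval_eq => i; rewrite mxE.
rewrite !yE; have /sub[H|H] : coord_affine alpha sigma y.
- by move=> i si; rewrite mxE hE Y1 // Y2 // subrr mul0r addr0.
- by rewrite (H _ F1f) mul0r.
- by rewrite (H _ F2f) mulr0.
Qed.

(** Coordinates are freed from being natural numbers one at a time: in each one f is a univariate
    polynomial vanishing at all natural numbers. *)
Lemma coord_affine_dense (alpha : 'X_{1..n}) sigma f :
  (forall u : 'X_{1..n}, coord_affine alpha sigma (cnvec R u) -> eval f (cnvec R u) = 0) ->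
  forall y, coord_affine alpha sigma y -> eval f y = 0.
Proof.
move=> f0 y Yy; suff H (s : seq 'I_n) : forall y, coord_affine alpha sigma y ->
    (forall i, i \notin s -> exists k : nat, y i 0 = k%:R) -> eval f y = 0.
  by apply: (H (enum 'I_n)) => // i; rewrite mem_enum.
elim: s {y Yy} => [|i s IHs] y Yy ynat.
  have /choice[u uE] i : exists k : nat, y i 0 = k%:R by exact: ynat.
  have yE : y = cnvec R [multinom u i | i < n].
    by apply/matrixP => i j; rewrite (ord1 j) mxE mnmE.
  by rewrite yE; apply: f0; rewrite -yE.
have [si|si] := boolP (i \in sigma); last first.
  apply: IHs => // j js; have [->|ji] := eqVneq j i; first by exists (alpha i); exact: Yy.
  by apply: ynat; rewrite inE negb_or ji.
pose h j : {poly C} := if j == i then 'X else (y j 0)%:P.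
have -> : eval f y = (along h f).[y i 0].
  rewrite along_eval; apply: meval_eq => j; rewrite /h; case: eqP => [->|_].
    by rewrite hornerX.
  by rewrite hornerC.
suff -> : along h f = 0 by rewrite horner0.
apply: poly_nat_roots => k; rewrite along_eval.
pose z : 'cV[C]_n := \col_j (h j).[k%:R].
have -> : f.@[fun i => (h i).[k%:R]] = eval f z by apply: meval_eq => j; rewrite mxE.
apply: IHs => j js; rewrite mxE /h; case: eqP => [ji|/eqP ji].
- by rewrite ji si in js.
- by rewrite hornerC Yy.
- by exists k; rewrite hornerX.
- by rewrite hornerC; apply: ynat; rewrite inE negb_or ji.
Qed.

Definition ffact_poly (m : 'X_{1..n}) : {mpoly C[n]} :=
  \prod_(i < n) \prod_(k < m i) ('X_i - (k%:R)%:MP).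

Lemma eval_ffact_poly m (y : 'cV[C]_n) : eval (ffact_poly m) y = 0 <-> vanishes y m.
Proof.
rewrite /ffact_poly rmorph_prod /=; split.
  move=> /eqP; rewrite prodf_seq_eq0 => /hasP[i _ /=]; rewrite rmorph_prod /=.
  rewrite prodf_seq_eq0 => /hasP[k _ /=]; rewrite mevalB mevalXU mevalC subr_eq0.
  by move=> /eqP yk; exists i, k.
move=> [i [k km yk]]; rewrite (bigD1 i) //= rmorph_prod /= (bigD1 (Ordinal km)) //=.
by rewrite mevalB mevalXU mevalC yk subrr !mul0r.
Qed.

Lemma vanishes_cnvec (u m : 'X_{1..n}) : vanishes (cnvec R u) m <-> ~~ (m <= u)%MM.
Proof.
split=> [[i [k km]]|/mnm_lepP/existsNP[i /negP]]; rewrite ?mxE.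
  move=> /eqP; rewrite eqr_nat => /eqP uk; apply/negP => /mnm_lepP/(_ i).
  by rewrite uk leqNgt km.
by rewrite -ltnNge => ui; exists i, (u i); rewrite ?mxE.
Qed.

Lemma ideal_mono (J : set {mpoly C[n]}) (m u : 'X_{1..n}) : left_ideal *%R J ->
  J 'X_[m] -> (m <= u)%MM -> J 'X_[u].
Proof. by move=> [_ _ JM] Jm mu; rewrite -(submK mu) mpolyXD; exact: JM. Qed.

Lemma closure_vanishes (J : set {mpoly C[n]}) m y : left_ideal *%R J -> J 'X_[m] ->
  zariski_closure [set cnvec R u | u in [set u | ~ J 'X_[u]]] y -> vanishes y m.
Proof.
move=> JI Jm cy; apply/eval_ffact_poly; move: y cy.
apply: smallest_sub => [|_ [u Ju <-]]; first exact: zeros_closed.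
apply/eval_ffact_poly/vanishes_cnvec; apply/negP => mu; apply: Ju; exact: ideal_mono Jm mu.
Qed.

(* [sigma] is taken maximal among the sets for which [alpha + N^sigma] avoids [J]. *)
Lemma standard_pair_exists (J : set {mpoly C[n]}) (y : 'cV[C]_n) : left_ideal *%R J ->
  (forall m, J 'X_[m] -> vanishes y m) ->
  exists alpha sigma, [/\ standard_pair J alpha sigma, coord_affine alpha sigma y
    & forall i, (forall k : nat, y i 0 != k%:R) -> i \in sigma].
Proof.
move=> JI Jy.
have /choice[a aP] i : exists k : nat, (exists l : nat, y i 0 = l%:R) -> y i 0 = k%:R.
  by have [[k yk]|no] := pselect (exists l : nat, y i 0 = l%:R); [exists k|exists 0%N].
pose tau : {set 'I_n} := [set i | ~~ `[< exists l : nat, y i 0 = l%:R >]]%SET.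
have yE i : i \notin tau -> y i 0 = (a i)%:R.
  by rewrite inE negbK => /asboolP/aP.
pose P (s : {set 'I_n}) := (tau \subset s) &&
  `[< forall m : 'X_{1..n}, J 'X_[m] -> exists2 i, i \notin s & (a i < m i)%N >].
have Ptau : P tau.
  rewrite /P subxx; apply/asboolP => m /Jy[i [k km yk]].
  have it : i \notin tau by rewrite inE negbK; apply/asboolP; exists k.
  exists i => //; move: (yE i it); rewrite yk => /eqP; rewrite eqr_nat => /eqP <-.
  by [].
have [s /maxsetP[/andP[ts /asboolP sJ] smax] _] := maxset_exists Ptau.
pose alpha : 'X_{1..n} := [multinom (if i \in s then 0%N else a i) | i < n].
have alphaE i : i \notin s -> alpha i = a i by move=> /negPf si; rewrite mnmE si.
exists alpha, s; split; last 2 first.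
- by move=> i si; rewrite alphaE // yE //; apply: contraNN si; exact: (fintype.subsetP ts).
- move=> i yi; apply: (fintype.subsetP ts); rewrite inE; apply/asboolPn => -[k yk].
  by move: (yi k); rewrite yk eqxx.
split; last first.
  move=> u uY; apply/mnm_lepP => i; rewrite mnmE; case: ifP => // /negbT si.
  by move: (uY i si); rewrite mxE alphaE // => /eqP; rewrite eqr_nat => /eqP ->.
split; first exact: coord_affine_irreducible.
  move=> z Yz Z [[F ->] FS] f Ff; apply: (coord_affine_dense (sigma := s)) Yz => u uY.
  apply: FS Ff => /=; exists u => //= Ju; have [i si] := sJ u Ju.
  by move: (uY i si); rewrite mxE alphaE // => /eqP; rewrite eqr_nat => /eqP ->; rewrite ltnn.
move=> Y' irr YY' Y'S; apply/seteqP; split=> // z Y'z i si.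
(* By maximality of s some monomial m of J is not avoided once i is added. Irreducibility of Y'
   turns the vanishing at m into one equation y_j = k with k < m_j, and j turns out to be i. *)
have nP : ~~ P (i |: s).
  apply/negP => Pis; have := smax _ Pis (finset.subsetUr _ _) => E.
  by move: si; rewrite -E setU11.
move: nP; rewrite /P (fintype.subset_trans ts (finset.subsetUr _ _)) /= => /asboolPn/existsNP[m].
move=> /not_implyP[Jm none].
have Y'm x : Y' x -> eval (ffact_poly m) x = 0.
  by move=> /Y'S/(closure_vanishes JI Jm)/eval_ffact_poly.
have [j Hj] := irreducible_prod irr Y'm.
have [k Hk] := irreducible_prod irr Hj.
have Y'k x : Y' x -> x j 0 = k%:R.
  by move=> /Hk; rewrite mevalB mevalXU mevalC => /eqP; rewrite subr_eq0 => /eqP.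
have js : j \notin s.
  (* The value -1 is not a natural number, so a coordinate in s cannot be constantly k on Y'. *)
  apply/negP => js; pose x : 'cV[C]_n := \col_l (if l \in s then - 1 else (a l)%:R).
  have /YY'/Y'k : coord_affine alpha s x by move=> l ls; rewrite mxE (negPf ls) alphaE.
  rewrite mxE js => /eqP; rewrite eq_sym -subr_eq0 opprK natr1.
  by rewrite pnatr_eq0.
have jk : a j = k.
  have /YY'/Y'k : coord_affine alpha s (cnvec R alpha) by move=> l _; rewrite mxE.
  by rewrite mxE alphaE // => /eqP; rewrite eqr_nat => /eqP.
have ji : j = i.
  apply/eqP; apply: contraT => ji; case: none; exists j; first by rewrite !inE negb_or ji.
  by rewrite jk.
by rewrite -ji Y'k // alphaE // jk.
Qed.

End Zariski.

Section PassingThroughZero.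
Variables (R : realType) (d n : nat).
Local Notation C := R[i].
Implicit Types (A : 'M[int]_(d, n)) (w : 'cV[R]_n).

(** Homogenization preserves weights, so the homogenized monomial is initial and, J being monomial
    by [in_poly_monomial], lies in J. The affine space of the standard pair is in the closure, so
    that monomial vanishes on all of it. *)
Lemma through_zero_kills A w (Cn : set 'cV[R]_(1 + n)) alpha sigma (v : 'cV[C]_(1 + n)) :
  let J := in_poly (rho_wt w) (@toric_ideal R _ _ (rho_mx A)) in
  strongly_convex_open_rational_cone Cn -> Cn (rho_wt w) ->
  (forall w' : 'cV[R]_(1 + n), Cn w' -> J = in_poly w' (@toric_ideal R _ _ (rho_mx A))) ->
  standard_pair J alpha sigma -> idx0 n \in sigma -> coord_affine alpha sigma v ->
  kills_initials A w (dsubmx v).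
Proof.
move=> J Cc Cw Cin [[_ Ysub _] _] s0 Yv f If m mf mx.
have JI : left_ideal *%R J by exact: left_ideal_genP.
have [N HN] := hompoly_toric If.
have mF : hmon N m \in msupp (hompoly N f) by rewrite mcoeff_msupp mcoeff_hompoly -mcoeff_msupp.
have JM : J 'X_[hmon N m].
  have Jg : J (init_form (wt_poly (rho_wt w)) (hompoly N f)).
    apply: in_poly_init; first exact: HN.
    by apply: contraTneq mF => ->; rewrite msupp0.
  have gm : (init_form (wt_poly (rho_wt w)) (hompoly N f))@_(hmon N m) = f@_m.
    rewrite mcoeff_init_form mcoeff_hompoly; case: allP => // -[] a /msupp_hompoly[m' m'f ->].
    by rewrite !wt_hmon mx.
  have := in_poly_monomial Cc Cw Cin Jg (m := hmon N m).
  rewrite mcoeff_msupp gm -mcoeff_msupp => /(_ mf) /(left_ideal_scale (f@_m)^-1 JI).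
  by rewrite scalerA mulVf ?scale1r // -mcoeff_msupp.
(* Since 0 is in sigma the coordinate of index 0 is free. The value -1 keeps it from causing the
   vanishing, which must come from a coordinate of v. *)
pose x : 'cV[C]_(1 + n) := col_mx (const_mx (- 1)) (dsubmx v).
have Yx : coord_affine alpha sigma x.
  move=> i si; have [i0|[j ij]] := split1P i; first by rewrite i0 s0 in si.
  by rewrite -(Yv i si) ij col_mxEd mxE.
have [i [k km xk]] := closure_vanishes JI JM (Ysub x Yx).
have [i0|[j ij]] := split1P i; last first.
  by exists j, k; move: km xk; rewrite ij hmonS // col_mxEd.
move: xk; rewrite i0 col_mxEu mxE => /eqP; rewrite eq_sym -subr_eq0 opprK natr1.
by rewrite pnatr_eq0.
Qed.

End PassingThroughZero.

(** * The homogenization map *)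

Section LeadingTerms.
Variables (R : realType) (d n : nat) (A : 'M[int]_(d, n)) (w : 'cV[R]_n).
Local Notation C := R[i].
Variables (I : choiceType) (v : I -> 'cV[C]_n) (phi : I -> logseries R n).
Hypothesis ptd : forall i, pointed A w (v i) (phi i).
Hypothesis indep : lin_indep (fun i => init_series (v i) (phi i)).

Lemma sum_fctE (s : seq I) (c : I -> C) (g : I -> logseries R n) e :
  (\sum_(i <- s) c i *: g i) e = \sum_(i <- s) c i *: g i e.
Proof. by rewrite fct_sumE; apply: eq_bigr => i _. Qed.

(** At a minimal exponent only the elements with that same exponent contribute, and their initial
    series are independent. *)
Lemma minimal_leading (s : seq I) (c : I -> C) i :
  uniq s -> {in s, forall j, c j != 0} -> i \in s ->
  (forall j, j \in s -> ~ above A w (v j) (v i)) ->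
  (\sum_(j <- s) c j *: phi j) (v i) != 0.
Proof.
move=> us cs si mini; apply: contra_neq (cs i si) => f0.
pose t := [seq j <- s | v j == v i].
apply: (lin_indep_uniq (c := c) (s := t) indep); first exact: filter_uniq; last first.
  by rewrite mem_filter eqxx.
apply/funext => e; rewrite sum_fctE; have [->|ei] := eqVneq e (v i); last first.
  rewrite big1_seq // => j /andP[_]; rewrite mem_filter => /andP[/eqP ji _].
  by rewrite /init_series /ser_term ji (negPf ei) scaler0.
rewrite big_filter -[RHS]f0 sum_fctE big_mkcond; apply: eq_big_seq => j js.
case: eqP => [ji|ji]; first by rewrite /init_series /ser_term ji eqxx.
suff -> : phi j (v i) = 0 by rewrite scaler0.
by apply/eqP; apply: contraT => /ptd[/esym//|/(mini j js)].
Qed.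

(** Descend to a minimal exponent, by induction on the number of listed exponents below the given
    one. *)
Lemma leading_term (s : seq I) (c : I -> C) i :
  uniq s -> {in s, forall j, c j != 0} -> i \in s ->
  exists2 j, (\sum_(l <- s) c l *: phi l) (v j) != 0 & v j = v i \/ above A w (v j) (v i).
Proof.
move=> us cs; pose below i := [seq j <- s | `[< above A w (v j) (v i) >]].
elim: {i}(size (below i)).+1 {-2}i (ltnSn (size (below i))) => // k IHk i ik si.
have [[j js ji]|none] := pselect (exists2 j, j \in s & above A w (v j) (v i)); last first.
  exists i; [|by left]; apply: minimal_leading => // j js ji; apply: none; by exists j.
have jb : j \in below i by rewrite mem_filter js andbT; apply/asboolP.
have [||l fl lj] := IHk j; [|exact: js|]; last first.
  by exists l => //; right; case: lj => [->|lj] //; exact: above_trans lj ji.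
apply: (@leq_ltn_trans (size (rem j (below i)))); last first.
  by rewrite size_rem //; move: ik jb; case: (below i).
apply: uniq_leq_size; first exact: filter_uniq.
move=> l; rewrite mem_filter => /andP[/asboolP lj ls].
rewrite mem_rem_uniq ?filter_uniq // inE mem_filter ls andbT; apply/andP; split.
  by apply/eqP => ljE; move: lj; rewrite ljE; exact: above_irrefl.
by apply/asboolP; exact: above_trans lj ji.
Qed.

Lemma pointed_sum (s : seq I) (c : I -> C) v0 :
  uniq s -> {in s, forall j, c j != 0} -> pointed A w v0 (\sum_(l <- s) c l *: phi l) ->
  {in s, forall i, v i = v0 \/ above A w v0 (v i)}.
Proof.
move=> us cs pt i /(leading_term us cs)[j /pt[<-|v0j] [<-|ji]]; try by [left|right].
by right; exact: above_trans v0j ji.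
Qed.

End LeadingTerms.

(** * Negative supports and induction on exponents *)

Section NegativeSupport.
Variables (R : realType) (d n : nat) (A : 'M[int]_(d, n)) (w : 'cV[R]_n).
Local Notation C := R[i].

Definition nsupp (v : 'cV[C]_n) : {set 'I_n} :=
  [set i | `[< exists k : nat, v i 0 = - k.+1%:R >]]%SET.

(* [d^(u+)] is the initial monomial of [d^(u+) - d^(u-)], so some falling factorial
   [v'_i (v'_i - 1) ... (v'_i - u_i + 1)] vanishes. *)
Lemma above_nsupp v v' : kills_initials A w v' -> above A w v v' -> nsupp v <> nsupp v'.
Proof.
move=> kills [u [v'E Au uw]].
pose up : 'X_{1..n} := [multinom (if u i 0%R is Posz k then k else 0%N) | i < n].
pose um : 'X_{1..n} := [multinom (if u i 0%R is Negz k then k.+1 else 0%N) | i < n].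
have uE : u = nvec up - nvec um.
  apply/matrixP => i j; rewrite (ord1 j) !mxE !mnmE; case: (u i 0) => k.
    by rewrite subr0.
  by rewrite sub0r NegzE.
have wlt : wt_poly w um < wt_poly w up by rewrite -subr_gt0 -dot_nvecB -uE.
have upm : um != up by apply: contraTneq wlt => ->; rewrite ltxx.
have If : toric_ideal A ('X_[up] - 'X_[um] : {mpoly C[n]}).
  apply: sub_gen_smallest; exists up, um; split=> //.
  by apply/eqP; rewrite -subr_eq0 -mulmxBr -uE; apply/eqP.
have [|m' m's|i [k ku vk]] := kills _ If up.
- by rewrite mcoeff_msupp mcoeffB !mcoeffX eqxx (negPf upm) subr0 oner_eq0.
- move: m's; rewrite mcoeff_msupp mcoeffB !mcoeffX.
  have [<-//|_] := eqVneq up m'; have [<- _|_] := eqVneq um m'; first exact: ltW.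
  by rewrite subrr eqxx.
move=> nE; have : i \in nsupp v'.
  rewrite -nE inE; apply/asboolP; move: ku vk; rewrite v'E mnmE !mxE.
  case: (u i 0) => // l kl vk; exists (l - k).-1.
  have -> : v i 0 = k%:R - l%:R by rewrite -vk addrK.
  by rewrite prednK ?subn_gt0 // natrB ?opprB // ltnW.
rewrite inE => /asboolP[l]; rewrite vk => /eqP.
by rewrite -subr_eq0 opprK -natrD pnatr_eq0 addnS.
Qed.

(** The measure is the number of negative supports occurring at or above an exponent. It drops
    strictly on moving up, because by [above_nsupp] the negative support left behind does not
    recur. *)
Lemma above_ind (I : Type) (v : I -> 'cV[C]_n) (P : I -> Prop) :
  (forall i, kills_initials A w (v i)) ->
  (forall i, (forall j, above A w (v i) (v j) -> P j) -> P i) -> forall i, P i.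
Proof.
move=> kills step.
pose T i : {set {set 'I_n}} :=
  [set X | `[< exists j, (v j = v i \/ above A w (v i) (v j)) /\ nsupp (v j) = X >]]%SET.
move=> i; elim: {i}#|T i|.+1 {-2}i (ltnSn #|T i|) => // k IHk i ik.
rewrite ltnS in ik; apply: step => j ij; apply: IHk; apply: leq_trans ik.
apply: proper_card; apply/fintype.properP; split.
  apply/fintype.subsetP => X; rewrite !inE.
  move=> [l [lj lX]].
  exists l; split=> //; right; case: lj => [->//|jl]; exact: above_trans ij jl.
exists (nsupp (v i)); first by rewrite !inE; exists i; split; [left|].
apply/negP; rewrite !inE => -[l [lj E]]; have il : above A w (v i) (v l).
  by case: lj => [->//|jl]; exact: above_trans ij jl.
by apply: (above_nsupp (kills l) il); rewrite E.
Qed.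

End NegativeSupport.

(** * Transfer of basic Nilsson solutions in both directions *)

Section NilssonTransfer.
Variables (R : realType) (d n : nat) (A : 'M[int]_(d, n)).
Local Notation C := R[i].
Variables (beta : 'cV[C]_d) (w : 'cV[R]_n) (beta0 : C).
Hypothesis hom : homogenizing_value A beta w beta0.
Local Notation hl := (hlift beta0).

(** The lift with coordinate sum zero, which identifies ker A with the kernel of [rho_mx A]. *)
Definition klift (u : 'cV[int]_n) : 'cV[int]_(1 + n) := col_mx (const_mx (- vsum u)) u.

Lemma klift0 u : klift u (idx0 n) 0 = - vsum u.
Proof. by rewrite /klift /idx0 col_mxEu mxE. Qed.

Lemma kliftS u i : klift u (rshift 1 i) 0 = u i 0.
Proof. by rewrite /klift col_mxEd. Qed.

(** The map z -> (z_j - z_0)_j is dual to [klift], so cones can be pulled back along it. *)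
Lemma dot_klift u (z : 'cV[R]_(1 + n)) :
  dot (map_mx intr (klift u)) z =
  dot (map_mx intr u) (\col_i (z (rshift 1 i) 0 - z (idx0 n) 0)).
Proof.
rewrite /dot big_split_ord /= big_ord1 -/(idx0 n) mxE klift0 rmorphN mulNr.
rewrite /vsum rmorph_sum mulr_suml -sumrN -big_split; apply: eq_bigr => i _ /=.
by rewrite [map_mx _ (klift u) _ _]mxE kliftS !mxE mulrBr addrC.
Qed.

Lemma hlift_shift v u : hl (shift v u) = shift (hl v) (klift u).
Proof.
apply/matrixP => i j; rewrite (ord1 j) [RHS]mxE [X in _ + X]mxE /klift.
have [->|[k ->]] := split1P i; last by rewrite !hliftS col_mxEd !mxE.
by rewrite !hlift0 col_mxEu mxE vsum_shift opprD rmorphN addrA.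
Qed.

Lemma rho_klift u : rho_mx A *m klift u = col_mx 0 (A *m u).
Proof.
rewrite /rho_mx mul_block_col mul0mx add0r; congr col_mx.
apply/matrixP => i j; rewrite (ord1 i) (ord1 j) !mxE big_ord1 !mxE mul1r.
by rewrite addrC; apply/eqP; rewrite subr_eq0; apply/eqP; apply: eq_bigr => k _; rewrite !mxE mul1r.
Qed.

Lemma ker_klift (u' : 'cV[int]_(1 + n)) : kerZ (rho_mx A) u' ->
  u' = klift (dsubmx u') /\ kerZ A (dsubmx u').
Proof.
rewrite /kerZ /= -{1}[u']vsubmxK /rho_mx mul_block_col mul0mx add0r => E.
have [E0 E1] : const_mx 1 *m usubmx u' + const_mx 1 *m dsubmx u' = 0 :> 'M_1 /\
    A *m dsubmx u' = 0.
  by move: E; rewrite -[0 in RHS]col_mx0 => /eq_col_mx.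
split=> //; rewrite -{1}[u']vsubmxK /klift; congr col_mx.
apply/matrixP => i j; rewrite (ord1 i) (ord1 j) [RHS]mxE; move/matrixP/(_ 0 0): E0.
rewrite [LHS]mxE [X in X + _]mxE big_ord1 [X in _ + X]mxE [X in X * _]mxE mul1r [RHS]mxE.
move=> /eqP; rewrite addr_eq0 => /eqP ->; congr (- _); apply: eq_bigr => k _.
by rewrite mxE mul1r.
Qed.

Lemma ones_rho : ones_in_row_span (rho_mx A).
Proof.
rewrite /ones_in_row_span; apply/row_subP => i.
have -> : row i (const_mx 1) = row (lshift d ord0) (map_mx intr (rho_mx A)) :> 'rV[rat]_(1 + n).
  apply/matrixP => k j; rewrite 2!mxE [RHS]mxE [RHS]mxE; have [->|[l ->]] := split1P j.
    by rewrite /rho_mx block_mxEul mxE.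
  by rewrite /rho_mx block_mxEur mxE.
exact: row_sub.
Qed.

Lemma basic_transfer v phi :
  weight_vector (rho_mx A) (rho_par beta0 beta) (rho_wt w) ->
  basic_nilsson A beta w v phi ->
  basic_nilsson (rho_mx A) (rho_par beta0 beta) (rho_wt w) (hl v) (transfer beta0 v phi).
Proof.
move=> [Ck [Kc Kw _ Kin]] bas; have vZ := nonint_exponent hom bas.
have lat := pointed_lattice (basic_pointed bas).
have [sol [Cn [S [[Cc Cw _ _] SD supp]]] [K degK] pv] := bas.
split; first exact/(transfer_solution vZ A beta lat).
(* [Q] is the dual of [klift]. Intersecting the pulled back cone with [Ck] supplies strong convexity
   and constant initial ideals. *)
- pose Q : 'M[rat]_(n, 1 + n) := row_mx (const_mx (- 1)) 1%:M.
  have QE (z : 'cV[R]_(1 + n)) i : (map_mx ratr Q *m z) i 0 = z (rshift 1 i) 0 - z (idx0 n) 0.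
    rewrite /Q map_row_mx -{1}[z]vsubmxK mul_row_col map_mx1 mul1mx !mxE big_ord1 !mxE.
    by rewrite rmorphN1 mulN1r addrC.
  exists (Ck `&` [set z | Cn (map_mx ratr Q *m z)]), [set klift u | u in S]; split.
  + split; [exact: cone_preimage| |by left; exact: ones_rho|by move=> z [/Kin]].
    split=> //=; suff -> : map_mx ratr Q *m rho_wt w = w by [].
    apply/matrixP => i j; rewrite (ord1 j) QE /rho_wt col_mxEd.
    by rewrite /idx0 col_mxEu mxE subr0.
  + move=> _ [u /SD[Du Au] <-]; split; last first.
      by rewrite /kerZ /= rho_klift Au col_mx0.
    move=> z [_ /Du]; rewrite dot_klift; congr (0 <= dot _ _).
    by apply/matrixP => i j; rewrite (ord1 j) QE mxE.
  + move=> e /(transfer_neq0 vZ)[eE /supp[u Su ue]].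
    by exists (klift u); [exists u|rewrite -hlift_shift ue -eE].
- exists K => e; rewrite /transfer; case: ifP => _; last by rewrite msize0.
  by rewrite msize_dpow // (leq_trans (msize_hatp _)).
- rewrite transfer_exponent; apply: contra_neq pv => p0.
  by apply: hatp_inj; rewrite p0 hatp0.
Qed.

(** The top Euler row gives v' = [hlift] v. Passing through zero makes v a fake exponent, so beta0 -
    |v| is not an integer and [transfer_surj] applies. *)
Lemma basic_untransfer v' psi alpha sigma :
  weight_vector A beta w ->
  weight_vector (rho_mx A) (rho_par beta0 beta) (rho_wt w) ->
  standard_pair (in_poly (rho_wt w) (@toric_ideal R _ _ (rho_mx A))) alpha sigma ->
  idx0 n \in sigma ->
  exponent_of_pair (rho_mx A) (rho_par beta0 beta) alpha sigma v' ->
  basic_nilsson (rho_mx A) (rho_par beta0 beta) (rho_wt w) v' psi ->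
  exists v phi, basic_nilsson A beta w v phi /\ transfer beta0 v phi = psi.
Proof.
move=> [Cn [Cc Cw Cpos Cin]] [Ck0 [Kc0 Kw0 _ Kin0]] std s0 [Av' Yv'] bas.
have [sol [Ck [S [[Kc Kw _ Kin] SD supp]]] [K degK] pv] := bas.
pose v := dsubmx v'.
have [v'E Av] : v' = hl v /\ map_mx intr A *m v = beta.
  move: Av'; rewrite -{1}[v']vsubmxK /rho_mx map_block_mx mul_block_col raddf0 mul0mx add0r.
  move=> /eq_col_mx[/matrixP/(_ 0 0) E ->]; split=> //; apply/eqP; rewrite hliftP.
  move: E; rewrite !mxE big_ord1 !mxE mul1r => <-; rewrite -addrA [X in _ == _ + X](_ : _ = 0) ?addr0 //.
  apply/eqP; rewrite subr_eq0; apply/eqP; apply: eq_bigr => k _.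
  by rewrite !mxE mul1r.
have kills := through_zero_kills Kc0 Kw0 (fun w' H => (Kin0 w' H).1) std s0 Yv'.
have vZ : nonint (beta0 - vsum v) by apply: hom.2; exact: kills_fake_exponent.
have suppu x : psi x != 0 -> exists u, [/\ x = hl (shift v u), S (klift u) & kerZ A u].
  move=> /supp[u' Su' <-]; have [_ /ker_klift[u'E Au]] := SD _ Su'.
  by exists (dsubmx u'); rewrite -u'E hlift_shift -u'E -v'E.
have [phi [Tphi psup pdeg]] : exists phi : logseries R n,
    [/\ transfer beta0 v phi = psi,
      forall e, phi e != 0 -> exists2 u, e = shift v u & psi (hl (shift v u)) != 0
      & forall e, (msize (phi e) <= msize (psi (hl e)))%N].
  apply: transfer_surj => // [x /suppu[u [-> _ _]]|x]; first by exists u.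
  have [_ /(_ x (lshift d ord0)) E] := solution_euler sol.
  rewrite -[RHS]E; apply: eq_bigr => k _.
  rewrite /rho_mx; have [->|[l ->]] := split1P k; rewrite ?block_mxEul ?block_mxEur mxE.
    by rewrite scale1r.
  by rewrite scale1r.
have lat : lattice v phi by move=> e /psup[u -> _]; exists u.
exists v, phi; split=> //; split.
- by apply/(transfer_solution vZ A beta lat); rewrite Tphi.
(* The embedding y -> (0, y). Intersecting with [Cn] supplies strong convexity, positivity and
   constant initial ideals. *)
- pose Q : 'M[rat]_(1 + n, n) := col_mx 0 1%:M.
  have QE (y : 'cV[R]_n) : map_mx ratr Q *m y = col_mx 0 y.
    by rewrite /Q map_col_mx raddf0 map_mx1 mul_col_mx mul0mx mul1mx.
  exists (Cn `&` [set y | Ck (map_mx ratr Q *m y)]), [set u | S (klift u)]; split.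
  + split; [exact: cone_preimage|by split=> //=; rewrite QE| |by move=> y [/Cin]].
    by case: Cpos => [?|Cpos]; [left|right => y [/Cpos]].
  + move=> u /SD[Du /ker_klift[_]]; rewrite /klift col_mxKd => Au; split=> //.
    move=> y [_ /= /Du]; rewrite QE dot_klift; congr (0 <= dot _ _).
    apply/matrixP => i j; rewrite (ord1 j) mxE col_mxEd /idx0 col_mxEu [X in _ - X]mxE.
    by rewrite subr0.
  + move=> e /psup[u -> /suppu[u' [/(can_inj (hliftK beta0))/shift_inj <- Su _]]].
    by exists u.
- by exists K => e; exact: leq_trans (pdeg e) _.
- by move: pv; rewrite -Tphi => /(transfer_neq0 vZ)[].
Qed.

End NilssonTransfer.

Lemma lspan_linear (K : pzRingType) (V : lmodType K) (S : set V) a f g :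
  lspan S f -> lspan S g -> lspan S (a *: f + g).
Proof.
move=> Sf Sg; have := lspan_sum [:: true; false] (fun b : bool => if b then a else 1)
  (g := fun b : bool => if b then f else g).
by rewrite !big_cons big_nil /= scale1r addr0; apply=> -[].
Qed.

Section RestrictedLinearMap.
Variables (K : pzRingType) (V W : lmodType K) (S : set V) (h : V -> W).
Hypothesis h_linear : forall a f g, lspan S f -> lspan S g -> h (a *: f + g) = a *: h f + h g.

Lemma lspan0 : lspan S 0.
Proof. by exists 0%N, (fun=> 0), (fun=> 0); split=> [[]//|]; rewrite big_ord0. Qed.

(** Linearity is known only on the span, so the partial sums must stay in it; h 0 = 0 follows from 0
    = 1 . 0 + 0. *)
Lemma restricted_linear_sum (I : Type) (r : seq I) (c : I -> K) (g : I -> V) :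
  (forall i, lspan S (g i)) -> h (\sum_(i <- r) c i *: g i) = \sum_(i <- r) c i *: h (g i).
Proof.
move=> gS; elim: r => [|i r IHr]; last by rewrite !big_cons h_linear ?IHr //; exact: lspan_sum.
rewrite !big_nil; have := h_linear 1 lspan0 lspan0.
by rewrite !scale1r addr0 => /eqP; rewrite -subr_eq subrr => /eqP.
Qed.

Lemma image_linear_sum (I : choiceType) (r : seq I) (c : I -> K) (g : I -> W) :
  {in r, forall i, (h @` lspan S) (g i)} -> (h @` lspan S) (\sum_(i <- r) c i *: g i).
Proof.
elim: r => [_|i r IHr rS].
  exists 0; first exact: lspan0.
  by have := restricted_linear_sum [::] (fun=> 0) (g := fun=> 0) (fun _ : I => lspan0); rewrite !big_nil.
have [|f Sf hf] := rS i; first by rewrite inE eqxx.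
have [|f' Sf' hf'] := IHr; first by move=> j jr; apply: rS; rewrite inE jr orbT.
rewrite big_cons -hf -hf' -h_linear //; exists (c i *: f + f') => //.
exact: lspan_linear.
Qed.

End RestrictedLinearMap.

Lemma rebase_basic (R : realType) d n (A : 'M[int]_(d, n)) beta (w : 'cV[R]_n) (beta0 : R[i])
    v0 u0 v phi : nonint (beta0 - vsum v0) ->
  basic_nilsson A beta w v phi ->
  basic_nilsson A beta w v (fun e => rebase_op beta0 v0 u0 (phi e)).
Proof.
move=> v0Z [sol [Cn [S [Cc SD supp]]] [K degK] pv]; split.
- exact: solution_rebase.
- exists Cn, S; split=> // e pe; apply: supp; apply: contra_neq pe => /= ->.
  exact: rebase_op0.
- by exists K => e; exact: leq_trans (msize_rebase _ _ _) (degK e).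
- by apply: contra_neq pv; exact: rebase_op_eq0.
Qed.

Theorem theorem3p18 (R : realType) (d n : nat) (A : 'M[int]_(d, n))
    (beta : 'cV[R[i]]_d) (w : 'cV[R]_n) (beta0 : R[i])
    (rho : logseries R n -> logseries R (1 + n)) :
  columns_generate A ->
  weight_vector A beta w ->
  homogenizing_value A beta w beta0 ->
  weight_vector (rho_mx A) (rho_par beta0 beta) (rho_wt w) ->
  homogenization_map A beta w beta0 rho ->
  set_inj (nilsson_space A beta w) rho /\
  rho @` nilsson_space A beta w =
    lspan (through_zero_solutions A beta w beta0).
Proof.
move=> genA wv hom wvr [rho_lin [I0 [v0 [phi0 [bas0 [_ span0] ind0 rho0]]]]].
(* A classical choice structure on the index type of the basis makes duplicate-free lists of indices
   available. *)
pose I : choiceType := {classic I0}.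
pose v : I -> 'cV[R[i]]_n := v0; pose phi : I -> logseries R n := phi0.
have bas (i : I) : basic_nilsson A beta w (v i) (phi i) by exact: bas0.
have ind : lin_indep (fun i : I => init_series (v i) (phi i)) by exact: ind0.
set N := nilsson_space A beta w in rho_lin span0 *.
have span : lspan (range phi) = N by exact: span0.
have vZ (i : I) : nonint (beta0 - vsum (v i)) by exact: nonint_exponent (bas i).
have pt i := basic_pointed (bas i); have lat i := pointed_lattice (pt i).
have Nbasic v' f : basic_nilsson A beta w v' f -> N f.
  by move=> bf; apply: lspan_incl; exists v'.
have kills i : kills_initials A w (v i).
  by have [sol _ _ pv] := bas i; exact: pointed_kills sol (pt i) pv.
have rhoE i : rho (phi i) = transfer beta0 (v i) (phi i).
  rewrite -[LHS]/(rho (phi0 i)) rho0.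
  apply: (rho_basicE (vZ i) genA (lat i)).
  by have [sol _ _ _] := bas i; have [] := solution_euler sol.
have basT i := basic_transfer hom wvr (bas i).
have ptT i := basic_pointed (basT i).
have rho_sum (s : seq I) c : rho (\sum_(i <- s) c i *: phi i) = \sum_(i <- s) c i *: rho (phi i).
  by apply: (restricted_linear_sum rho_lin) => i; exact: Nbasic (bas i).
(* At the lifted exponent [transfer] acts by [hatp] alone, which is linear and injective, so a
   relation descends. *)
have indT : lin_indep (fun i : I => init_series (hlift beta0 (v i)) (transfer beta0 (v i) (phi i))).
  move=> k j c jinj sum0; apply: (ind k j c jinj).
  apply/funext => e; apply: hatp_inj; rewrite [0 e]/(0 : {mpoly R[i][n]}) hatp0.
  rewrite -[RHS](congr1 (fun f : logseries R (1 + n) => f (hlift beta0 e)) sum0).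
  rewrite !fct_sumE (lin_sum _ _ (@hatpP R n)); apply: eq_bigr => a _.
  rewrite -[(_ *: _) e]/(c a *: init_series (v (j a)) (phi (j a)) e).
  rewrite -[(_ *: _) (hlift _ e)]/(c a *: init_series _ _ (hlift beta0 e)).
  rewrite /init_series /ser_term (inj_eq (can_inj (hliftK beta0))).
  case: eqP => [_|_]; last by rewrite !scaler0 hatp0.
  by rewrite transfer_exponent hatpZ.
have inj : set_inj N rho.
  move=> f g; rewrite !inE => Nf Ng fg.
  have Nh : N (-1 *: g + f) by exact: lspan_linear.
  have h0 : rho (-1 *: g + f) = 0 by rewrite rho_lin // fg scaleN1r addNr.
  move: Nh h0; rewrite -span => /(lspan_uniq (I := I))[s [c [us cs E]]].
  rewrite E rho_sum; under eq_bigr => i _ do rewrite rhoE.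
  move=> h0; suff s0 : s = [::].
    by move: E; rewrite s0 big_nil scaleN1r addrC => /eqP; rewrite subr_eq0 => /eqP.
  case: s us cs E h0 => // i s us cs _ h0.
  (* A nonempty combination has a surviving leading term, so it cannot be zero. *)
  have [|j] := leading_term ptT indT us cs (i := i); first by rewrite inE eqxx.
  by rewrite h0 eqxx.
split=> //; apply/seteqP; split.
  move=> _ [f + <-]; rewrite -span => /(lspan_uniq (I := I))[s [c [_ _ ->]]].
  rewrite rho_sum; apply: lspan_sum => i; apply: lspan_incl; rewrite rhoE.
  have [sol _ _ pv] := basT i; have killsT := pointed_kills sol (ptT i) pv.
  (* The lifted exponent satisfies the initial monomials, hence lies on a standard pair. Its
     coordinate beta0 - |v_i| is not a natural number, which puts 0 into sigma. *)
  have [|al [si [std Yv inS]]] := standard_pair_exists (y := hlift beta0 (v i))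
    (left_ideal_genP *%R [set init_form (wt_poly (rho_wt w)) f | f in
      @toric_ideal R _ _ (rho_mx A) `&` [set f | f != 0]]).
    move=> m Jm; apply: (kills_in_poly killsT Jm); rewrite msuppX; exact: mem_head.
  exists al, si, (hlift beta0 (v i)); split=> //.
    by apply: inS => k; rewrite hlift0; exact: vZ (Posz k).
  by split=> //; have [+ _] := solution_euler sol; apply.
(* [transfer vb (phi i)] is the transfer of some [h] based at [v i]; expanding [h] in the
   basis, [rho] itself appears at the elements with exponent [v i]. *)
have im_transfer i : forall vb u, v i = shift vb u -> (rho @` N) (transfer beta0 vb (phi i)).
  (* The claim quantifies over all base points because the induction hypothesis is used at the base
     point [v i]. *)
  move: i; apply: (above_ind kills) => i IHi vb u vE.
  have vbZ : nonint (beta0 - vsum vb).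
    have -> : beta0 - vsum vb = beta0 - vsum (v i) - (- vsum u)%:~R.
      by rewrite vE vsum_shift opprD rmorphN opprK addrA subrK.
    exact/nonintB/vZ.
  have latb : lattice vb (phi i).
    by move=> e /lat[u' ->]; exists (u + u'); rewrite shiftD -vE.
  rewrite (transfer_rebase vbZ u latb) -vE; set h := (fun e => _).
  have bash : basic_nilsson A beta w (v i) h by exact: rebase_basic.
  have := Nbasic _ _ bash; rewrite -{1}span => /(lspan_uniq (I := I))[s [c [us cs hE]]].
  have pth := basic_pointed bash; rewrite hE in pth *.
  rewrite (lin_sumZ _ _ _ (transfer_linear (vZ i))) /N.
  apply: (image_linear_sum rho_lin) => j js.
  have [vji|aij] := pointed_sum pt ind us cs pth js.
    by rewrite -vji -rhoE; exists (phi j) => //; exact: Nbasic (bas j).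
  by have [u' [vj _ _]] := aij; exact: IHi aij _ u' vj.
move=> _ [k [c [psi [psiT ->]]]]; apply: (image_linear_sum rho_lin) => a _.
have [al [si [v' [std s0 ex bpsi]]]] := psiT a.
have [vb [f [bf <-]]] := basic_untransfer hom wv wvr std s0 ex bpsi.
(* The given solution is the transfer of [f] at [vb]. All exponents in the expansion of [f] lie in
   vb + ker A, so [im_transfer] handles each basis element at this base point. *)
have := Nbasic _ _ bf; rewrite -{1}span => /(lspan_uniq (I := I))[s [b [us bs fE]]].
have ptf := basic_pointed bf; rewrite fE in ptf *.
have vbZ := nonint_exponent hom bf.
rewrite (lin_sumZ _ _ _ (transfer_linear vbZ)).
apply: (image_linear_sum rho_lin) => j js.
have [vj|[u [vj _ _]]] := pointed_sum pt ind us bs ptf js.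
  by apply: (im_transfer j vb 0); rewrite shift0.
exact: im_transfer vj.
Qed.
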